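(* Let $1\le k\le n-1$ and let $\mathcal{L}$ be the non-constant local system with fiber $\mathbb{Z}$ on the real Grassmann manifold $\mathrm{Gr}(k,n)$ of $k$-dimensional subspaces of $\mathbb{R}^n$. Consider the cellular cochain complex with coefficients in $\mathcal{L}$ of the Schubert cell decomposition of $\mathrm{Gr}(k,n)$, with coboundary $\delta\sigma_w=\sum_{w'}[w;w']_{\mathcal{L}}\,\sigma_{w'}$ (sum over $w'\in S_n^{(k)}$ with $\ell(w')=\ell(w)+1$). Then for all $w,w'\in S_n^{(k)}$ with $\ell(w')=\ell(w)+1$: $$[w;w']_{\mathcal{L}}=\pm2\quad\text{if } w'=s_iw\text{ for some simple reflection } s_i\text{ and }\eta^*(w)=\eta^*(w'),$$ and $[w;w']_{\mathcal{L}}=0$ otherwise. In other words, the graph $\mathsf{G}^*(k,n)$ is the incidence graph computing the twisted cohomology $H^*(\mathrm{Gr}(k,n);\mathcal{L})$.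
   Context: $S_n$ is the symmetric group with simple reflections $s_i=(i,i+1)$, $1\le i\le n-1$, and length function $\ell$. $S_n^{(k)}$ is the set of minimal length coset representatives $w\in S_n$ modulo $P_k=\langle s_1,\dots,\hat s_k,\dots,s_{n-1}\rangle\cong S_k\times S_{n-k}$; equivalently $w(1)<\cdots<w(k)$ and $w(k+1)<\cdots<w(n)$. Schubert cells: for $w\in S_n^{(k)}$, $\Omega_w^\circ\subset \mathrm{Gr}(k,n)$ is the set of $k$-dimensional subspaces $V$ such that $\{i: \dim(V\cap\langle e_1,\dots,e_i\rangle)>\dim(V\cap\langle e_1,\dots,e_{i-1}\rangle)\}=\{w(1),\dots,w(k)\}$. It is a cell of dimension $\ell(w)=\sum_{j=1}^k (w(j)-j)$, and these cells form a CW decomposition of $\mathrm{Gr}(k,n)$. Choosing an orientation of each cell and a trivialization of $\mathcal{L}$ over each (contractible) cell, the cochain group in degree $d$ is free over $\mathbb{Z}$ with basis $\{\sigma_w:\ell(w)=d\}$, where $\sigma_w$ is dual to $\Omega_w^\circ$; other choices change the incidence numbers $[w;w']_{\mathcal{L}}$ only by signs. The non-constant local system $\mathcal{L}$ with fiber $\mathbb{Z}$ on $\mathrm{Gr}(k,n)$ is unique up to isomorphism. Weights: $Y_w$ is the Young diagram of left-justified boxes contained in the $k\times(n-k)$ rectangle having $w(j)-j$ boxes in the $j$-th row from the bottom, $j=1,\dots,k$. Fill the boxes of $Y_w$ in the $q$-shifted checkerboard pattern, with $1$ in the northwest corner: the box in the $a$-th row from the top and $b$-th column contains $1$ if $a+b$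 is even and $q$ if $a+b$ is odd. Then $\eta^*(w)$ is the number of $q$'s in $Y_w$. The graph $\mathsf{G}^*(k,n)$ has vertex set $S_n^{(k)}$ (vertices identified with the diagrams $Y_w$) and an edge $w\Rightarrow w'$ iff $w'=s_iw$ for some $i$, $\ell(w')=\ell(w)+1$ and $\eta^*(w)=\eta^*(w')$. *)

(* Defs.v *)
From HB Require Import structures.
From mathcomp Require Import all_boot all_order all_algebra all_fingroup.
From mathcomp Require Import all_classical all_reals all_analysis.

Set Implicit Arguments.
Unset Strict Implicit.
Unset Printing Implicit Defensive.

Import Order.TTheory GRing.Theory Num.Theory.
Import numFieldNormedType.Exports.

Local Open Scope classical_set_scope.
Local Open Scope ring_scope.

(* Transports and cochains are functions of arbitrary maps out of [0, 1] or
   [0, 1]^d; every axiom or condition below only concerns continuous maps, so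
   the values on discontinuous maps play no role. *)
Definition unit_itv (R : realType) : set R := [set t | 0 <= t <= 1].
Arguments unit_itv : clear implicits.

Section LocalSystem.
Variables (R : realType) (T : topologicalType).
Local Notation I := (unit_itv R).

Lemma unit_itv0 : (0 : R) \in unit_itv R.
Proof. by apply/mem_set; rewrite /unit_itv /= lexx ler01. Qed.

Lemma unit_itv1 : (1 : R) \in unit_itv R.
Proof. by apply/mem_set; rewrite /unit_itv /= lexx ler01. Qed.

Definition I0 : I := exist _ 0 unit_itv0.
Definition I1 : I := exist _ 1 unit_itv1.

(* r runs through p on [0, 1/2] and then through q on [1/2, 1]. *)
Definition is_concat (p q r : I -> T) : Prop :=
  forall s t : I, (val s = val t / 2 -> r s = p t) /\
                  (val s = (1 + val t) / 2 -> r s = q t).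

Definition homotopic_rel_ends (p q : I -> T) : Prop :=
  exists H : I * I -> T, [/\ continuous H,
    forall t, H (I0, t) = p t /\ H (I1, t) = q t &
    forall s, H (s, I0) = p I0 /\ H (s, I1) = p I1].

(* A functor from the fundamental groupoid of T to abelian groups all of whose
   values are Z: a path g induces an automorphism of Z, which is
   multiplication by a unit [transport g] of Z. *)
Record local_system := LocalSystem {
  transport :> (I -> T) -> int;
  transport_unit : forall p, continuous p -> transport p \is a GRing.unit;
  transport_cst : forall x, transport (fun=> x) = 1;
  transport_concat : forall p q r, continuous p -> continuous q ->
    continuous r -> is_concat p q r -> transport r = transport q * transport p;
  transport_homotopic : forall p q, continuous p -> continuous q ->
    homotopic_rel_ends p q -> transport p = transport q
}.

(* L is isomorphic to the constant functor Z, through automorphisms g x. *)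
Definition constant_system (L : local_system) : Prop :=
  exists g : T -> int, (forall x, g x \is a GRing.unit) /\
    forall p, continuous p -> L p * g (p I0) = g (p I1).

End LocalSystem.

Definition cube (R : realType) (d : nat) : set 'rV[R]_d :=
  [set x | forall j, 0 <= x 0 j <= 1].
Arguments cube : clear implicits.

(* Singular cohomology is set up with normalized singular cubes (Serre, Massey)
   rather than simplices: cochains vanish on degenerate cubes. *)
Section SingularCohomology.
Variables (R : realType) (T : topologicalType).
Local Notation I := (unit_itv R).
Local Notation cube := (cube R).

Definition face_fun d (i : 'I_d.+1) (t : I) (x : cube d) : 'rV[R]_d.+1 :=
  \row_j (if unlift i j is Some j' then val x 0 j' else val t).

Lemma face_subproof d (i : 'I_d.+1) (t : I) (x : cube d) :
  face_fun i t x \in cube d.+1.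
Proof.
apply/mem_set => j; rewrite mxE; case: unliftP => [j' _|_].
  exact: (set_mem (valP x)).
exact: (set_mem (valP t)).
Qed.

(* The face x_i = t of the (d+1)-cube. *)
Definition face d (i : 'I_d.+1) (t : I) (x : cube d) : cube d.+1 :=
  exist _ (face_fun i t x) (face_subproof i t x).

Definition edge_fun d (i : 'I_d) (t : I) : 'rV[R]_d :=
  \row_j (if j == i then val t else 0).

Lemma edge_subproof d (i : 'I_d) (t : I) : edge_fun i t \in cube d.
Proof.
apply/mem_set => j; rewrite mxE; case: ifP => _; last by rewrite lexx ler01.
exact: (set_mem (valP t)).
Qed.

(* The edge from the origin to the i-th unit vector. *)
Definition edge d (i : 'I_d) (t : I) : cube d :=
  exist _ (edge_fun i t) (edge_subproof i t).

Definition singular (X : set T) d (u : cube d -> T) : Prop :=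
  continuous u /\ range u `<=` X.

(* u does not depend on one of the coordinates. *)
Definition degenerate d (u : cube d -> T) : Prop :=
  exists i : 'I_d, forall x y : cube d,
    (forall j, j != i -> val x 0 j = val y 0 j) -> u x = u y.

(* The value of a cochain on u lies in the fiber of L at u(0, ..., 0). A cochain
   on a subspace X is handled through an arbitrary extension to cubes of T. *)
Definition cochain d := (cube d -> T) -> int.

(* The face x_i = 1 has base point u(e_i): the value of c on it is brought back
   to the fiber at u(0) along the i-th edge, by transport^-1 = transport. *)
Definition coboundary (L : local_system R T) d (c : cochain d) :
    cochain d.+1 :=
  fun u => \sum_(i < d.+1) (-1) ^+ i *
    (L (u \o edge i) * c (u \o face i (I1 R)) - c (u \o face i (I0 R))).

Definition rel_cochain (A : set T) d (c : cochain d) : Prop :=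
  forall u, continuous u -> range u `<=` A \/ degenerate u -> c u = 0.

Definition rel_cocycle (L : local_system R T) (X A : set T) d (c : cochain d) :
    Prop :=
  rel_cochain A c /\ forall u, singular X u -> coboundary L c u = 0.

(* Equality of the classes of two relative cocycles in H^d(X, A; L). *)
Definition cohomologous (L : local_system R T) (X A : set T) d :
    cochain d -> cochain d -> Prop :=
  if d is d'.+1 then fun c c' =>
    exists2 b : cochain d', rel_cochain A b &
      forall u, singular X u -> c u - c' u = coboundary L b u
  else fun c c' => forall u, singular X u -> c u = c' u.

(* The class of c generates the group H^d(X, A; L). *)
Definition generates (L : local_system R T) (X A : set T) d (c : cochain d) :
    Prop :=
  rel_cocycle L X A c /\
  forall c', rel_cocycle L X A c' ->
    exists m : int, cohomologous L X A c' (fun u => m * c u).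

End SingularCohomology.

Definition Gr (R : realType) (k n : nat) :=
  {V : {vspace 'rV[R]_n} | \dim V == k}.

Section Grassmannian.
Variables (R : realType) (k n : nat).

Definition rows (A : 'M[R]_(k, n)) : k.-tuple 'rV[R]_n :=
  [tuple row i A | i < k].

Definition frames : set 'M[R]_(k, n) := [set A | free (rows A)].

Lemma span_frame_subproof (A : frames) : \dim <<rows (val A)>> == k.
Proof.
have : free (rows (val A)) by exact: (set_mem (valP A)).
by rewrite /free size_tuple.
Qed.

Definition span_frame (A : frames) : Gr R k n :=
  exist _ <<rows (val A)>>%VS (span_frame_subproof A).

(* Gr(k, n) carries the quotient topology of the space of k-frames in R^n. *)
Definition Gr_open : set_system (Gr R k n) :=
  [set U | open (span_frame @^-1` U)].

Lemma Gr_openT : Gr_open setT.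
Proof. exact: openT. Qed.

Lemma Gr_openI (A B : set (Gr R k n)) :
  Gr_open A -> Gr_open B -> Gr_open (A `&` B).
Proof. exact: openI. Qed.

Lemma Gr_open_bigcup (J : Type) (f : J -> set (Gr R k n)) :
  (forall j, Gr_open (f j)) -> Gr_open (\bigcup_j f j).
Proof.
move=> fo; rewrite /Gr_open /= preimage_bigcup.
by apply: bigcup_open => j _; exact: fo.
Qed.

HB.instance Definition _ := Choice.on (Gr R k n).
HB.instance Definition _ := isOpenTopological.Build (Gr R k n)
  Gr_openT Gr_openI Gr_open_bigcup.

End Grassmannian.

(* Indices are shifted by one: 'S_n permutes 'I_n = {0, ..., n-1}. *)
Definition is_minrep (n k : nat) (w : 'S_n) : bool :=
  [forall i : 'I_n, forall j : 'I_n,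
    [&& (i < j)%N & (j < k)%N || (k <= i)%N] ==> (w i < w j)%N].

Definition minrep (n k : nat) := {w : 'S_n | is_minrep k w}.

Section Schubert.
Variables (R : realType) (n k : nat).
Implicit Types w : minrep n k.

(* The Coxeter length as a number of inversions; on minrep n k it equals
   \sum_(j < k) (w j - j). *)
Definition ell w : nat :=
  #|[set p : 'I_n * 'I_n | (p.1 < p.2)%N && (val w p.2 < val w p.1)%N]%SET|.

(* The span of the first i vectors of the standard basis. *)
Definition flag (i : nat) : {vspace 'rV[R]_n} :=
  <<[seq (delta_mx 0%R j : 'rV[R]_n) | j : 'I_n <- enum 'I_n & (j < i)%N]>>%VS.

Definition schubert_cell w : set (Gr R k n) :=
  [set V | [set i : 'I_n | (\dim (val V :&: flag i) <
                            \dim (val V :&: flag i.+1))%N]%SET =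
           [set val w j | j : 'I_n & (j < k)%N]%SET].

Definition skeleton (d : nat) : set (Gr R k n) :=
  \bigcup_(w in [set w | (ell w <= d)%N]) schubert_cell w.

(* The box (a, b) lies in row a from the top and column b, from 0; the j-th row
   from the bottom is row a with a + j = k - 1. *)
Definition young w : {set 'I_k * 'I_(n - k)} :=
  [set p : 'I_k * 'I_(n - k) | [exists j : 'I_n, (p.1 + j == k.-1)%N &&
                                                 (p.2 < val w j - j)%N]]%SET.

(* The parity of a + b is the same whether counting starts at 0 or at 1. *)
Definition eta_star w : nat :=
  #|[set p in young w | odd (p.1 + p.2)]%SET|.

(* (s_i w)(j) = s_i (w(j)); products in 'S_n are composed from left to right. *)
Definition Gstar_edge w w' : Prop :=
  [/\ exists i j : 'I_n, j = i.+1 :> nat /\ val w' = (val w * tperm i j)%g,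
      ell w' = (ell w).+1 & eta_star w = eta_star w'].

End Schubert.

Section Cellular.
Variables (R : realType) (n k : nat) (L : local_system R (Gr R k n)).
Local Notation skeleton := (@skeleton R n k).

(* The d-th cellular cochain group is H^d(X_d, X_(d-1); L), the direct sum over
   the d-cells w of the infinite cyclic groups H^d(X_d, X_d - cell w; L). The
   basis element dual to the cell w is a generator of the w-th summand; its two
   possible choices come from orienting the cell and trivializing L over it.
   Only the values sigma (ell w) w are used. *)
Definition dual_basis (sigma : forall d, minrep n k -> cochain R (Gr R k n) d) :
    Prop :=
  forall w, generates L (skeleton (ell w))
    (skeleton (ell w) `\` schubert_cell w) (sigma (ell w) w).

(* The cellular coboundary is the connecting map
   H^d(X_d, X_(d-1); L) -> H^(d+1)(X_(d+1), X_d; L): extend a representing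
   cocycle to X_(d+1) and take its coboundary. *)
Definition incidence_numbers
    (sigma : forall d, minrep n k -> cochain R (Gr R k n) d)
    (inc : minrep n k -> minrep n k -> int) : Prop :=
  forall w, cohomologous L (skeleton (ell w).+1) (skeleton (ell w))
    (coboundary L (sigma (ell w) w))
    (fun u => \sum_(w' : minrep n k | ell w' == (ell w).+1)
                inc w w' * sigma (ell w).+1 w' u).

End Cellular.

(* Main.v *)
(* The coboundary of sigma_w is evaluated on one singular cube for each w', the
   Bott-Samelson parametrization of the closed cell of w': if w' = s_i w it is
   (t, y) |-> R_i(t) u_w(y), where R_i(t) runs through a half turn in the plane of
   e_i and e_(i+1).  Its faces lie in the d-skeleton, and the only ones to meet the
   cell of w are t = 0 and t = 1.  The first is u_w; the second is u_w followed by
   the reflection diag(.., -1, -1, ..), which acts on the cell of w with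
   determinant (-1)^(a + b), where (a, b) is the box added to Y_w.  Their base
   points are joined by a loop that generates the fundamental group, around which
   the non-constant system has transport -1, so the two faces contribute
   +-(1 + (-1)^(a + b)).  The loop has transport -1 because, were the transport 1,
   the trivializations of L over the affine charts of the Grassmannian would agree
   up to constants on overlaps, by moving one row of a frame at a time.

   That sigma_w takes the value +-1 on u_w needs only one relative cocycle with
   this property.  On small cubes it is a cup product of the coboundaries of the
   Heaviside functions of d coordinates of the cell, cut off far from the center;
   repeated subdivision into 2^d cubes extends it to all cubes. *)

Require Import Defs.
From mathcomp Require Import all_boot all_order all_algebra all_fingroup.
From mathcomp Require Import all_classical all_reals all_analysis.
From mathcomp Require Import ring lra zify.

Set Implicit Arguments.
Unset Strict Implicit.
Unset Printing Implicit Defensive.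

Import Order.TTheory GRing.Theory Num.Theory.
Import numFieldNormedType.Exports.

Local Open Scope classical_set_scope.
Local Open Scope ring_scope.

(** * Transport along convex sets *)

(** The cochains [sigma] are known only through [generates], so they are read only on cubes whose
    faces lie in the relative part, where a value depends on the class alone. If an explicit cocycle
    c0 has value 1 or -1 on such a cube, then c0 = m * sigma forces m to be a unit, and no
    cohomology group has to be computed. The same unit serves for the cube of w and for its
    reflection, so it factors out of the sum of the two faces. The cutoff is at level 1/2 of the
    squared cosine to the coordinate plane of the cell, which is 1 at the center and 0 outside the
    chart. On that level set some coordinate is nonzero, so the cup product already vanishes on
    small cubes there and can be truncated. For the loop, the obstacle is that two affine charts
    meet in the complement of a hypersurface, which may be disconnected. When the determinant
    changes sign during the move of one row, the segment leaves the second chart but the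
    complementary arc of the pencil does not; the two arcs have equal transport as soon as the whole
    pencil has transport 1. If w' is not of the form s_i w, no face meets the cell of w, by the
    Bruhat order on pivot sets. *)

Section ContinuityHelpers.
Variable R : realType.

Lemma continuous_at_mx (Y : topologicalType) m n (f : Y -> 'M[R]_(m, n)) y :
  (forall i j, {for y, continuous (fun z => f z i j)}) -> {for y, continuous f}.
Proof.
move=> fc A [P nP sPA].
have H : \forall z \near y, forall i j, P i j (f z i j).
  by apply: filter_forall => i; apply: filter_forall => j; exact: (fc i j _ (nP i j)).
by apply: filterS H => z Hz; apply: sPA => i j; exact: Hz.
Qed.

Lemma continuous_mx (Y : topologicalType) m n (f : Y -> 'M[R]_(m, n)) :
  (forall i j, continuous (fun z => f z i j)) -> continuous f.
Proof. by move=> fc y; apply: continuous_at_mx => i j; exact: fc. Qed.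

Lemma continuous_entry (Y : topologicalType) m n (f : Y -> 'M[R]_(m, n)) i j y :
  {for y, continuous f} -> {for y, continuous (fun z => f z i j)}.
Proof.
move=> fc; apply: (@continuous_comp _ _ _ f (fun M : 'M[R]_(m, n) => M i j)) => //.
exact: coord_continuous.
Qed.

Lemma cont_cst (Y X : topologicalType) (a : X) (y : Y) :
  {for y, continuous (fun=> a)}.
Proof. exact: cst_continuous. Qed.

Lemma cont_all (Y X : topologicalType) (f : Y -> X) :
  (forall y, {for y, continuous f}) -> continuous f.
Proof. by []. Qed.

Lemma cont_add (V : normedModType R) (Y : topologicalType) (f g : Y -> V) y :
  {for y, continuous f} -> {for y, continuous g} ->
  {for y, continuous (fun z => f z + g z)}.
Proof. by move=> fc gc; apply: cvgD. Qed.

Lemma cont_opp (V : normedModType R) (Y : topologicalType) (f : Y -> V) y :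
  {for y, continuous f} -> {for y, continuous (fun z => - f z)}.
Proof. by move=> fc; apply: cvgN. Qed.

Lemma cont_mul (Y : topologicalType) (f g : Y -> R) y :
  {for y, continuous f} -> {for y, continuous g} ->
  {for y, continuous (fun z => f z * g z)}.
Proof. by move=> fc gc; apply: cvgM. Qed.

Lemma cont_norm (Y : topologicalType) (f : Y -> R) y :
  {for y, continuous f} -> {for y, continuous (fun z => `|f z|)}.
Proof. by move=> fc; apply: cvg_norm. Qed.

Lemma cont_inv (Y : topologicalType) (f : Y -> R) y :
  f y != 0 -> {for y, continuous f} -> {for y, continuous (fun z => (f z)^-1)}.
Proof. by move=> f0 fc; apply: cvgV. Qed.

Lemma cont_sum (Y : topologicalType) (J : Type) (r : seq J) (P : pred J)
    (f : J -> Y -> R) y : (forall j, P j -> {for y, continuous (f j)}) ->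
  {for y, continuous (fun z => \sum_(j <- r | P j) f j z)}.
Proof.
move=> fc; elim: r => [|j r IH].
  rewrite (_ : (fun z => _) = fun=> 0); first exact: cont_cst.
  by apply/funext => z; rewrite big_nil.
rewrite (_ : (fun z => _) = fun z =>
  (if P j then f j z else 0) + \sum_(j <- r | P j) f j z).
  apply: cont_add => //; case: (P j) (fc j) => fj; [exact: fj|exact: cont_cst].
by apply/funext => z; rewrite big_cons; case: ifP; rewrite ?add0r.
Qed.

Lemma cont_prod (Y : topologicalType) (J : Type) (r : seq J) (P : pred J)
    (f : J -> Y -> R) y : (forall j, P j -> {for y, continuous (f j)}) ->
  {for y, continuous (fun z => \prod_(j <- r | P j) f j z)}.
Proof.
move=> fc; elim: r => [|j r IH].
  rewrite (_ : (fun z => _) = fun=> 1); first exact: cont_cst.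
  by apply/funext => z; rewrite big_nil.
rewrite (_ : (fun z => _) = fun z =>
  (if P j then f j z else 1) * \prod_(j <- r | P j) f j z).
  apply: cont_mul => //; case: (P j) (fc j) => fj; [exact: fj|exact: cont_cst].
by apply/funext => z; rewrite big_cons; case: ifP; rewrite ?mul1r.
Qed.

Lemma continuous_det (Y : topologicalType) n (f : Y -> 'M[R]_n) y :
  {for y, continuous f} -> {for y, continuous (fun z => \det (f z))}.
Proof.
move=> fc; apply: cont_sum => s _; apply: cont_mul; first exact: cont_cst.
by apply: cont_prod => i _; exact: continuous_entry.
Qed.

Lemma continuous_mulmx (Y : topologicalType) m n p (f : Y -> 'M[R]_(m, n))
    (g : Y -> 'M[R]_(n, p)) y : {for y, continuous f} -> {for y, continuous g} ->
  {for y, continuous (fun z => f z *m g z)}.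
Proof.
move=> fc gc; apply: continuous_at_mx => i j.
rewrite (_ : (fun z => _) = fun z => \sum_l f z i l * g z l j); last first.
  by apply/funext => z; rewrite mxE.
by apply: cont_sum => l _; apply: cont_mul; exact: continuous_entry.
Qed.

Lemma continuous_minr (Y : topologicalType) (f g : Y -> R) y :
  {for y, continuous f} -> {for y, continuous g} ->
  {for y, continuous (fun z => Num.min (f z) (g z))}.
Proof. exact: (@continuous_min R Y f g y). Qed.

Lemma continuous_maxr (Y : topologicalType) (f g : Y -> R) y :
  {for y, continuous f} -> {for y, continuous g} ->
  {for y, continuous (fun z => Num.max (f z) (g z))}.
Proof. exact: (@continuous_max R Y f g y). Qed.

End ContinuityHelpers.

Lemma continuous_set_val (X : topologicalType) (A : set X) :
  continuous (fun x : A => val x).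
Proof. exact: initial_continuous. Qed.

Lemma continuous_at_sub (X Y : topologicalType) (A : set X) (f : Y -> A) y :
  {for y, continuous (fun z => val (f z))} -> {for y, continuous f}.
Proof.
move=> fc U; rewrite nbhsE => -[V [[W oW WV] Vfy] VU].
have Wy : nbhs (val (f y)) W by apply: open_nbhs_nbhs; split=> //; rewrite -WV in Vfy.
have H : \forall z \near y, W (val (f z)) by exact: fc.
by apply: filterS H => z /= Wz; apply: VU; rewrite -WV; exact: Wz.
Qed.

Lemma continuous_sub (X Y : topologicalType) (A : set X) (f : Y -> A) :
  continuous (fun z => val (f z)) -> continuous f.
Proof. by move=> fc y; apply: continuous_at_sub; exact: fc. Qed.

Lemma continuous_val_of (X Y : topologicalType) (A : set X) (f : Y -> A) :
  continuous f -> continuous (fun z => val (f z)).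
Proof.
move=> fc y; apply: (@continuous_comp _ _ _ f (fun x : A => val x)); first exact: fc.
exact: continuous_set_val.
Qed.

Definition mkS (X : Type) (A : set X) (x : X) (h : A x) : A :=
  exist (fun y => y \in A) x (mem_set h).

Lemma valS (X : Type) (A : set X) (x : A) : A (val x).
Proof. exact: (set_mem (valP x)). Qed.

Section ConvexTransport.
Variables (R : realType) (T : topologicalType) (L : local_system R T).
Local Notation I := (unit_itv R).

Lemma unit_itvP (t : I) : 0 <= val t <= 1.
Proof. exact: (valS t). Qed.

Definition mkI (t : R) (h : 0 <= t <= 1) : I := @mkS _ (unit_itv R) t h.

Lemma transport_pm (p : I -> T) : continuous p -> L p = 1 \/ L p = -1.
Proof.
by move=> /(@transport_unit _ _ L); case: (L p) => [[|[|?]]|[|?]] //= _; [left|right].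
Qed.

Lemma transport_sqr (p : I -> T) : continuous p -> L p * L p = 1.
Proof. by move=> /transport_pm[] ->. Qed.

Variables (E : normedModType R) (K : set E).
Hypothesis Kcvx : forall x y t, K x -> K y -> 0 <= t <= 1 ->
  K ((1 - t) *: x + t *: y).
Variable phi : K -> T.
Hypothesis phic : continuous phi.

Definition segK (x y : K) (t : I) : K :=
  mkS (Kcvx (valS x) (valS y) (unit_itvP t)).

Lemma segK0 x y : segK x y (I0 R) = x.
Proof. by apply: val_inj; rewrite /= subr0 scale1r scale0r addr0. Qed.

Lemma segK1 x y : segK x y (I1 R) = y.
Proof. by apply: val_inj; rewrite /= subrr scale1r scale0r add0r. Qed.

Lemma continuous_lerp (Y : topologicalType) (f : Y -> R) (p q : Y -> E) y :
  {for y, continuous f} -> {for y, continuous p} -> {for y, continuous q} ->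
  {for y, continuous (fun z => (1 - f z) *: p z + f z *: q z)}.
Proof.
move=> fc pc qc; apply: cvgD; apply: cvgZ => //.
by apply: cvgB => //; exact: cvg_cst.
Qed.

Lemma segK_continuous x y : continuous (segK x y).
Proof.
apply: continuous_sub => t /=.
by apply: continuous_lerp; [exact: continuous_set_val|exact: cst_continuous..].
Qed.

(** The homotopy moves [p t] to [q t] along the segment of [K] joining them; at the common ends this
    segment is constant. *)
Lemma transport_convex (p q : I -> K) : continuous p -> continuous q ->
  p (I0 R) = q (I0 R) -> p (I1 R) = q (I1 R) -> L (phi \o p) = L (phi \o q).
Proof.
move=> pc qc e0 e1; apply: transport_homotopic.
- by move=> x; apply: continuous_comp; [exact: pc|exact: phic].
- by move=> x; apply: continuous_comp; [exact: qc|exact: phic].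
exists (fun st => phi (segK (p st.2) (q st.2) st.1)); split=> [st|t|s] /=.
- apply: continuous_comp; last exact: phic.
  apply: continuous_at_sub; apply: continuous_lerp.
  + apply: (@continuous_comp _ _ _ fst (fun t : I => val t)); first exact: cvg_fst.
    exact: continuous_set_val.
  + apply: (@continuous_comp _ _ _ snd (fun t : I => val (p t))); first exact: cvg_snd.
    exact: continuous_val_of.
  + apply: (@continuous_comp _ _ _ snd (fun t : I => val (q t))); first exact: cvg_snd.
    exact: continuous_val_of.
- by rewrite segK0 segK1.
- rewrite -e0 -e1; split; congr phi; apply: val_inj => /=.
    by rewrite -scalerDl subrK scale1r.
  by rewrite -scalerDl subrK scale1r.
Qed.

Lemma min1_itv (t : I) : 0 <= Num.min 1 (2 * val t) <= 1.
Proof. by have /andP[t0 t1] := unit_itvP t; rewrite le_min ge_min lexx ler01 /= mulr_ge0. Qed.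

Lemma max0_itv (t : I) : 0 <= Num.max 0 (2 * val t - 1) <= 1.
Proof.
by move: (unit_itvP t) => /= /andP[t0 t1]; rewrite le_max ge_max lexx ler01 /=; lra.
Qed.

(* The concatenation of p and q is p (min (1, 2t)) + q (max (0, 2t - 1)) - p 1,
   whose continuity needs no pasting lemma. *)
Lemma transport_triangle (p q r : I -> K) : continuous p -> continuous q ->
  continuous r -> p (I0 R) = r (I0 R) -> p (I1 R) = q (I0 R) ->
  q (I1 R) = r (I1 R) -> L (phi \o r) = L (phi \o q) * L (phi \o p).
Proof.
move=> pc qc rc e0 e1 e2.
pose a (t : I) := mkI (min1_itv t); pose b (t : I) := mkI (max0_itv t).
have a1 t : 1 <= 2 * val t -> a t = I1 R.
  by move=> h; apply: val_inj => /=; apply/min_idPl.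
have b0 t : 2 * val t <= 1 -> b t = I0 R.
  by move=> h; apply: val_inj => /=; apply/max_idPl; rewrite subr_le0.
pose f t := val (p (a t)) + val (q (b t)) - val (p (I1 R)).
have fE t : f t = if 2 * val t <= 1 then val (p (a t)) else val (q (b t)).
  rewrite /f; case: ifPn => [/b0 ->|]; first by rewrite e1 addrK.
  by rewrite -ltNge => /ltW/a1 ->; rewrite addrAC subrr add0r.
have Kf t : K (f t) by rewrite fE; case: ifP => _; exact: valS.
pose c t : K := mkS (Kf t).
have ac : continuous a.
  apply: continuous_sub => t /=.
  apply: (@continuous_minr R I (fun=> 1) (fun z => 2 * val z)); first exact: cst_continuous.
  by apply: cont_mul; [exact: cont_cst|exact: continuous_set_val].
have bc : continuous b.
  apply: continuous_sub => t /=.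
  apply: (@continuous_maxr R I (fun=> 0) (fun z => 2 * val z - 1)); first exact: cst_continuous.
  apply: cont_add; last exact: cont_cst.
  by apply: cont_mul; [exact: cont_cst|exact: continuous_set_val].
have cc : continuous c.
  apply: continuous_sub => t.
  apply: (@cont_add R E I (fun z => val (p (a z)) + val (q (b z)))
    (fun=> - val (p (I1 R)))); last exact: cont_cst.
  apply: cont_add.
    apply: (@continuous_comp _ _ _ a (fun t : I => val (p t))); first exact: ac.
    exact: continuous_val_of.
  apply: (@continuous_comp _ _ _ b (fun t : I => val (q t))); first exact: bc.
  exact: continuous_val_of.
have comp (g : I -> K) : continuous g -> continuous (phi \o g).
  by move=> gc x; apply: continuous_comp; [exact: gc|exact: phic].
rewrite (@transport_convex r c) //.
- apply: transport_concat; do ?exact: comp.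
  move=> s t; split=> st /=; congr phi; apply: val_inj; rewrite /= fE.
    have /andP[t0 t1] := unit_itvP t.
    rewrite ifT; last by rewrite st; lra.
    congr (val (p _)); apply: val_inj => /=.
    have -> : 2 * val s = val t by rewrite st; field.
    exact/min_idPr.
  have /andP[t0 t1] := unit_itvP t.
  case: ifPn => h.
    have t00 : t = I0 R.
      by apply: val_inj; rewrite -[val (I0 R)]/(0 : R); move: h; rewrite st; lra.
    rewrite a1 ?e1 ?t00 //; rewrite st t00 -[val (I0 R)]/(0 : R); lra.
  congr (val (q _)); apply: val_inj => /=.
  have -> : 2 * val s - 1 = val t by rewrite st; field.
  exact/max_idPr.
- apply: val_inj; rewrite /= fE ifT /=; last by rewrite mulr0 ler01.
  by rewrite -e0; congr (val (p _)); apply: val_inj; rewrite /= mulr0; apply/esym/min_idPr.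
- apply: val_inj; rewrite /= fE ifF /=; last by rewrite mulr1; apply/negbTE; rewrite -ltNge; lra.
  by rewrite -e2; congr (val (q _)); apply: val_inj => /=; rewrite mulr1 [2 - 1](_ : _ = 1 :> R);
    [exact/esym/max_idPr|lra].
Qed.

End ConvexTransport.

(** * Cubical cochains and subdivision *)

Section CubeMaps.
Variable R : realType.
Local Notation I := (unit_itv R).
Local Notation cube := (cube R).

Lemma cube_convex d (x y : 'rV[R]_d) t : cube d x -> cube d y -> 0 <= t <= 1 ->
  cube d ((1 - t) *: x + t *: y).
Proof.
move=> hx hy /andP[t0 t1] j; rewrite !mxE.
have /andP[x0 x1] := hx j; have /andP[y0 y1] := hy j; nra.
Qed.

Lemma cubeP d (x : cube d) j : 0 <= val x 0 j <= 1.
Proof. exact: (valS x). Qed.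

Definition mkcube d (x : 'rV[R]_d) (h : forall j, 0 <= x 0 j <= 1) : cube d :=
  @mkS _ (cube d) x h.

Lemma cube_ext d (x y : cube d) : (forall j, val x 0 j = val y 0 j) -> x = y.
Proof. by move=> h; apply: val_inj; apply/rowP. Qed.

Lemma cube0_subproof d j : 0 <= (0 : 'rV[R]_d) 0 j <= 1.
Proof. by rewrite mxE lexx ler01. Qed.

Definition cube0 d : cube d := mkcube (@cube0_subproof d).

Lemma continuous_cube (Y : topologicalType) d (f : Y -> cube d) :
  (forall j, continuous (fun z => val (f z) 0 j)) -> continuous f.
Proof.
move=> fc; apply: continuous_sub; apply: continuous_mx => i j.
by rewrite ord1; exact: fc.
Qed.

Lemma continuous_coord d j : continuous (fun x : cube d => val x 0 j).
Proof. by move=> x; apply: continuous_entry; exact: continuous_set_val. Qed.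

Lemma faceE d (i : 'I_d.+1) t (x : cube d) j :
  val (face i t x) 0 j = if unlift i j is Some j' then val x 0 j' else val t.
Proof. by rewrite mxE. Qed.

Lemma face_same d (i : 'I_d.+1) t (x : cube d) : val (face i t x) 0 i = val t.
Proof. by rewrite faceE unlift_none. Qed.

Lemma face_lift d (i : 'I_d.+1) t (x : cube d) j :
  val (face i t x) 0 (lift i j) = val x 0 j.
Proof. by rewrite faceE liftK. Qed.

Lemma edgeE d (i : 'I_d) (t : I) j :
  val (edge i t) 0 j = if j == i then val t else 0.
Proof. by rewrite mxE. Qed.

Lemma face_continuous d (i : 'I_d.+1) t : continuous (@face R d i t).
Proof.
apply: continuous_cube => j; rewrite (_ : (fun z => _) = fun z : cube d =>
  if unlift i j is Some j' then val z 0 j' else val t); last first.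
  by apply/funext => z; exact: faceE.
by case: unliftP => [j' _|_] x; [exact: continuous_coord|exact: cont_cst].
Qed.

Lemma edge_continuous d (i : 'I_d) : continuous (@edge R d i).
Proof.
apply: continuous_cube => j; rewrite (_ : (fun z => _) = fun z : I =>
  if j == i then val z else 0); last by apply/funext => z; exact: edgeE.
by case: (j == i) => x; [exact: continuous_set_val|exact: cont_cst].
Qed.

Definition bI (b : bool) : I := if b then I1 R else I0 R.

Lemma bIE b : val (bI b) = b%:R.
Proof. by case: b. Qed.

Lemma half_subproof d (e : {ffun 'I_d -> bool}) (x : cube d) j :
  0 <= (\row_l ((val x 0 l + (e l)%:R) / 2) : 'rV[R]_d) 0 j <= 1.
Proof. by rewrite mxE; move: (cubeP x j); case: (e j) => /= /andP[? ?]; lra. Qed.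

Definition half d (e : {ffun 'I_d -> bool}) (x : cube d) : cube d :=
  mkcube (half_subproof e x).

Lemma halfE d (e : {ffun 'I_d -> bool}) (x : cube d) j :
  val (half e x) 0 j = (val x 0 j + (e j)%:R) / 2.
Proof. by rewrite mxE. Qed.

Definition grow_fun (b : bool) (s t : R) : R :=
  if b then ((1 - s) * t + 1 + s) / 2 else t * (1 + s) / 2.

Lemma grow_subproof d (e : {ffun 'I_d -> bool}) (x : cube d.+1) j :
  0 <= (\row_l grow_fun (e l) (val x 0 ord0) (val x 0 (lift ord0 l)) : 'rV[R]_d) 0 j
    <= 1.
Proof.
rewrite mxE /grow_fun; move: (cubeP x ord0) (cubeP x (lift ord0 j)).
by case: (e j) => /= /andP[? ?] /andP[? ?]; apply/andP; split; nra.
Qed.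

(* With s the first coordinate, a homotopy from [half e] at s = 0 to a map which
   at s = 1 is the identity if e = 0, and else is constant in one variable. *)
Definition grow d (e : {ffun 'I_d -> bool}) (x : cube d.+1) : cube d :=
  mkcube (grow_subproof e x).

Lemma growE d (e : {ffun 'I_d -> bool}) (x : cube d.+1) j :
  val (grow e x) 0 j = grow_fun (e j) (val x 0 ord0) (val x 0 (lift ord0 j)).
Proof. by rewrite mxE. Qed.

Lemma half_continuous d (e : {ffun 'I_d -> bool}) : continuous (half e).
Proof.
apply: continuous_cube => j; rewrite (_ : (fun z => _) = fun z : cube d =>
  (val z 0 j + (e j)%:R) / 2); last by apply/funext => z; exact: halfE.
apply: cont_all => x; apply: cont_mul; last exact: cont_cst.
by apply: cont_add; [exact: continuous_coord|exact: cont_cst].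
Qed.

Lemma grow_continuous d (e : {ffun 'I_d -> bool}) : continuous (grow e).
Proof.
apply: continuous_cube => j; rewrite (_ : (fun z => _) = fun z : cube d.+1 =>
  grow_fun (e j) (val z 0 ord0) (val z 0 (lift ord0 j))); last first.
  by apply/funext => z; exact: growE.
have c0 := @continuous_coord d.+1 ord0; have c1 := @continuous_coord d.+1 (lift ord0 j).
apply: cont_all => x; rewrite /grow_fun; case: (e j).
  apply: cont_mul; last exact: cont_cst.
  apply: cont_add; last exact: c0.
  apply: cont_add; last exact: cont_cst.
  apply: cont_mul; last exact: c1.
  by apply: cont_add; [exact: cont_cst|apply: cont_opp; exact: c0].
apply: cont_mul; last exact: cont_cst.
apply: cont_mul; first exact: c1.
by apply: cont_add; [exact: cont_cst|exact: c0].
Qed.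

Definition insb d (i : 'I_d.+1) (b : bool) (e : {ffun 'I_d -> bool}) :
    {ffun 'I_d.+1 -> bool} :=
  [ffun j => if unlift i j is Some j' then e j' else b].

Lemma insb_same d (i : 'I_d.+1) b (e : {ffun 'I_d -> bool}) : insb i b e i = b.
Proof. by rewrite ffunE unlift_none. Qed.

Lemma insb_lift d (i : 'I_d.+1) b (e : {ffun 'I_d -> bool}) j :
  insb i b e (lift i j) = e j.
Proof. by rewrite ffunE liftK. Qed.

Lemma sum_insb d (i : 'I_d.+1) (F : {ffun 'I_d.+1 -> bool} -> int) :
  \sum_e F e = \sum_b \sum_e F (insb i b e).
Proof.
rewrite pair_bigA /= (reindex (fun p : bool * {ffun 'I_d -> bool} => insb i p.1 p.2)) //.
exists (fun e : {ffun 'I_d.+1 -> bool} => (e i, [ffun j : 'I_d => e (lift i j)])) => [[b e]|e] _ /=.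
  by rewrite insb_same; congr (_, _); apply/ffunP => j; rewrite ffunE insb_lift.
apply/ffunP => j; case: (unliftP i j) => [j' ->|->]; last by rewrite insb_same.
by rewrite insb_lift ffunE.
Qed.

Lemma half_face d (i : 'I_d.+1) b (e : {ffun 'I_d -> bool}) :
  half (insb i b e) \o face i (bI b) = face i (bI b) \o half e.
Proof.
apply/funext => x; apply: cube_ext => j; rewrite /comp; rewrite halfE.
case: (unliftP i j) => [j' ->|->].
  by rewrite !face_lift halfE insb_lift.
by rewrite !face_same insb_same bIE; case: b; lra.
Qed.

(** Two neighbouring small cubes share this face, at coordinate 1/2; its two occurrences have
    opposite signs in [sum_signed_split]. *)
Lemma half_face_mid d (i : 'I_d.+1) b (e : {ffun 'I_d -> bool}) :
  half (insb i (~~ b) e) \o face i (bI b) = half (insb i b e) \o face i (bI (~~ b)).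
Proof.
apply/funext => x; apply: cube_ext => j; rewrite /comp; rewrite !halfE.
case: (unliftP i j) => [j' ->|->].
  by rewrite !face_lift !insb_lift.
by rewrite !face_same !insb_same !bIE; case: b; lra.
Qed.

Lemma lift0_face d (i : 'I_d.+1) t (x : cube d.+1) :
  val (face (lift ord0 i) t x) 0 ord0 = val x 0 ord0.
Proof.
have -> : (ord0 : 'I_d.+2) = lift (lift ord0 i) (ord0 : 'I_d.+1).
  by apply: val_inj.
by rewrite face_lift.
Qed.

Lemma lift0_face_same d (i : 'I_d.+1) t (x : cube d.+1) :
  val (face (lift ord0 i) t x) 0 (lift ord0 i) = val t.
Proof. exact: face_same. Qed.

Lemma lift0_face_lift d (i : 'I_d.+1) t (x : cube d.+1) j :
  val (face (lift ord0 i) t x) 0 (lift ord0 (lift i j)) = val x 0 (lift ord0 j).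
Proof.
have -> : lift ord0 (lift i j) = lift (lift ord0 i) (lift ord0 j) :> 'I_d.+2.
  by apply: val_inj; rewrite /= /bump /=; lia.
by rewrite face_lift.
Qed.

Lemma grow_face d (i : 'I_d.+1) b (e : {ffun 'I_d -> bool}) :
  grow (insb i b e) \o face (lift ord0 i) (bI b) = face i (bI b) \o grow e.
Proof.
apply/funext => x; apply: cube_ext => j; rewrite /comp; rewrite growE lift0_face.
case: (unliftP i j) => [j' ->|->].
  by rewrite lift0_face_lift face_lift growE insb_lift.
by rewrite !face_same insb_same bIE /grow_fun; case: b => /=; lra.
Qed.

Lemma grow_face_mid d (i : 'I_d.+1) b (e : {ffun 'I_d -> bool}) :
  grow (insb i (~~ b) e) \o face (lift ord0 i) (bI b) =
  grow (insb i b e) \o face (lift ord0 i) (bI (~~ b)).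
Proof.
apply/funext => x; apply: cube_ext => j; rewrite /comp; rewrite !growE !lift0_face.
case: (unliftP i j) => [j' ->|->].
  by rewrite !lift0_face_lift !insb_lift.
by rewrite !lift0_face_same !insb_same !bIE /grow_fun; case: b => /=; lra.
Qed.

Lemma grow_face00 d (e : {ffun 'I_d -> bool}) : grow e \o face ord0 (I0 R) = half e.
Proof.
apply/funext => x; apply: cube_ext => j; rewrite /comp; rewrite growE halfE face_same face_lift.
by rewrite -[val (I0 R)]/(0 : R) /grow_fun; case: (e j) => /=; lra.
Qed.

Lemma grow_face01 d : grow [ffun=> false] \o face ord0 (I1 R) = @id (cube d).
Proof.
apply/funext => x; apply: cube_ext => j; rewrite /comp; rewrite growE face_same face_lift.
by rewrite /grow_fun ffunE -[val (I1 R)]/(1 : R); lra.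
Qed.

(* j may exceed i: faces are indexed so that the missing coordinate shifts. *)
Definition flip_face d (p : 'I_d.+2 * 'I_d.+1) : 'I_d.+2 * 'I_d.+1 :=
  (lift p.1 p.2, odflt p.2 (unlift (lift p.1 p.2) p.1)).

Lemma flip_faceE d (i : 'I_d.+2) (j : 'I_d.+1) :
  lift (flip_face (i, j)).1 (flip_face (i, j)).2 = i.
Proof.
rewrite /flip_face /=; have := neq_lift i j; rewrite eq_sym => /unlift_some[k ik ->].
by rewrite /= -ik.
Qed.

Lemma flip_faceK d : involutive (@flip_face d).
Proof.
case=> i j; case E : (flip_face (i, j)) => [i' j'].
have h := flip_faceE i j; rewrite E /= in h.
rewrite /flip_face /= h; congr (_, _).
have -> : i' = lift i j by have := congr1 fst E.
by rewrite liftK.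
Qed.

(** This change of parity makes the two orders of taking a double face cancel in
    [coboundary_coboundary]. *)
Lemma flip_face_odd d (i : 'I_d.+2) (j : 'I_d.+1) :
  odd ((flip_face (i, j)).1 + (flip_face (i, j)).2) = ~~ odd (i + j).
Proof.
have h := congr1 val (flip_faceE i j); move: h.
rewrite /flip_face /=; set k := odflt _ _; rewrite /= /bump.
case: (leqP i j) => ij; case: (leqP _ k) => /=; lia.
Qed.

Lemma face_face d (i : 'I_d.+2) (j : 'I_d.+1) s t (x : cube d) :
  face i s (face j t x) =
  face (flip_face (i, j)).1 t (face (flip_face (i, j)).2 s x).
Proof.
have h := flip_faceE i j; have e1 : (flip_face (i, j)).1 = lift i j by [].
have h2 : lift (flip_face (i, j)).1 (flip_face (i, j)).2 = i by exact: h.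
apply: cube_ext => l; case: (unliftP i l) => [l' ->|->]; last first.
  rewrite face_same; move: h2; case: (flip_face _) => a k /= h2.
  by rewrite -h2 face_lift face_same.
rewrite face_lift; case: (unliftP j l') => [m ->|->]; last first.
  by rewrite face_same e1 face_same.
rewrite face_lift.
have -> : lift i (lift j m) =
    lift (flip_face (i, j)).1 (lift (flip_face (i, j)).2 m).
  apply: val_inj; move: (congr1 val h2); rewrite /= /bump => h3.
  move: h3; set k := odflt _ _.
  by case: (leqP i j); case: (leqP j m); case: (leqP k m) => /=; lia.
by rewrite !face_lift.
Qed.

End CubeMaps.

(** * Twisted pullbacks, the coboundary and the subdivision operator *)

Section Pull.
Variables (R : realType) (T : topologicalType) (L : local_system R T).
Local Notation I := (unit_itv R).
Local Notation cube := (cube R).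

Definition segc d (x y : cube d) : I -> cube d := segK (@cube_convex R d) x y.

Lemma segc_continuous d (x y : cube d) : continuous (segc x y).
Proof. exact: segK_continuous. Qed.

Lemma segc0 d (x y : cube d) : segc x y (I0 R) = x. Proof. exact: segK0. Qed.

Lemma segc1 d (x y : cube d) : segc x y (I1 R) = y. Proof. exact: segK1. Qed.

(** The trivialization over the cube of the system pulled back along [u], normalized at the origin;
    by convexity any other path from the origin to [x] gives the same value. *)
Definition tr d (u : cube d -> T) (x : cube d) : int := L (u \o segc (cube0 R d) x).

Lemma continuous_compose (X Y Z : topologicalType) (g : Y -> Z) (f : X -> Y) :
  continuous f -> continuous g -> continuous (g \o f).
Proof. by move=> fc gc x; apply: continuous_comp; [exact: fc|exact: gc]. Qed.

Lemma tr_cube0 d (u : cube d -> T) : tr u (cube0 R d) = 1.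
Proof.
rewrite /tr (_ : _ \o _ = fun=> u (cube0 R d)) ?transport_cst //.
apply/funext => t /=; congr u; apply: cube_ext => j.
by rewrite !mxE; lra.
Qed.

Lemma tr_pm d (u : cube d -> T) x : continuous u -> tr u x = 1 \/ tr u x = -1.
Proof.
by move=> uc; apply: transport_pm; apply: continuous_compose uc; exact: segc_continuous.
Qed.

(** The segment from the origin to [phi x] has the same ends as the segment to [phi 0] followed by
    the image under [phi] of the segment from 0 to [x]. *)
Lemma tr_comp d e (u : cube d -> T) (phi : cube e -> cube d) x :
  continuous u -> continuous phi ->
  tr u (phi x) = tr (u \o phi) x * tr u (phi (cube0 R e)).
Proof.
move=> uc pc; rewrite /tr.
rewrite (@transport_triangle _ _ L _ _ (@cube_convex R d) u uc
  (segc (cube0 R d) (phi (cube0 R e))) (phi \o segc (cube0 R e) x)) //.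
- exact: segc_continuous.
- by apply: continuous_compose pc; exact: segc_continuous.
- exact: segc_continuous.
- by rewrite !segc0.
- by rewrite /= segc1 segc0.
- by rewrite /= !segc1.
Qed.

Lemma tr_path d (u : cube d -> T) (p : I -> cube d) : continuous u -> continuous p ->
  p (I0 R) = cube0 R d -> L (u \o p) = tr u (p (I1 R)).
Proof.
move=> uc pc p0; apply: (@transport_convex _ _ L _ _ (@cube_convex R d) u uc) => //.
- exact: segc_continuous.
- by rewrite segc0.
- by rewrite segc1.
Qed.

Local Notation cochain := (cochain R T).

(* The pullback of c along phi, brought back to the fiber at u(0, ..., 0). *)
Definition pull d e (phi : cube e -> cube d) (c : cochain e) : cochain d :=
  fun u => tr u (phi (cube0 R e)) * c (u \o phi).

Lemma pull_pull d e f (phi : cube e -> cube d) (psi : cube f -> cube e) (c : cochain f) u :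
  continuous u -> continuous phi ->
  pull phi (pull psi c) u = pull (phi \o psi) c u.
Proof.
by move=> uc pc; rewrite /pull mulrA [X in X * _]mulrC -tr_comp.
Qed.

Definition fsgn d (i : 'I_d) (b : bool) : int := (-1) ^+ (i + ~~ b).

Lemma fsgnN d (i : 'I_d) b : fsgn i (~~ b) = - fsgn i b.
Proof. by rewrite /fsgn; case: b; rewrite /= ?addn0 ?addn1 exprS mulN1r ?opprK. Qed.

(** The i-th edge leads from the origin to the base point of the face x_i = 1, so its transport is a
    value of [tr]; the base point of the face x_i = 0 is the origin, where [tr] is 1. Written with
    [pull], faces compose with the other maps of cubes. *)
Lemma coboundaryE d (c : cochain d) u : continuous u ->
  coboundary L c u = \sum_i \sum_b fsgn i b * pull (face i (bI R b)) c u.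
Proof.
move=> uc; apply: eq_bigr => i _; rewrite big_bool /fsgn /= addn0 addn1 exprS.
rewrite mulN1r mulNr -mulrBr; congr (_ * (_ - _)).
  rewrite /pull (tr_path uc) //; last first.
    by apply: cube_ext => j; rewrite edgeE mxE; case: ifP.
    exact: edge_continuous.
  congr (tr u _ * _); apply: cube_ext => j; rewrite edgeE faceE.
  case: unliftP => [j' ->|->]; last by rewrite eqxx.
  by rewrite eq_sym (negbTE (neq_lift _ _)) mxE.
rewrite /pull (_ : face i _ _ = cube0 R _) ?tr_cube0 ?mul1r //.
by apply: cube_ext => j; rewrite faceE mxE; case: unliftP => // j' _; rewrite mxE.
Qed.

(** The axioms of a local system concern continuous paths only, so the identities between cochains
    hold in this sense and not as equalities of functions. *)
Definition ceq d (c c' : cochain d) := forall u, continuous u -> c u = c' u.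

Lemma pull_ceq d e (phi : cube e -> cube d) (c c' : cochain e) :
  continuous phi -> ceq c c' -> ceq (pull phi c) (pull phi c').
Proof. by move=> pc cc u uc; congr (_ * _); apply: cc; exact: continuous_compose. Qed.

Lemma coboundary_ceq d (c c' : cochain d) : ceq c c' ->
  ceq (coboundary L c) (coboundary L c').
Proof.
move=> cc u uc; rewrite !coboundaryE //; apply: eq_bigr => i _; apply: eq_bigr => b _.
by congr (_ * _); apply: pull_ceq => //; exact: face_continuous.
Qed.

Lemma sign_opp m n : odd m = ~~ odd n -> (-1) ^+ m = - (-1) ^+ n :> int.
Proof. by move=> h; rewrite -signr_odd h signrN signr_odd. Qed.

Lemma coboundary_coboundary d (c : cochain d) u : continuous u ->
  coboundary L (coboundary L c) u = 0.
Proof.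
move=> uc; rewrite coboundaryE //.
pose F (p : 'I_d.+2 * 'I_d.+1) := \sum_b \sum_a
  fsgn p.1 b * (fsgn p.2 a * pull (face p.1 (bI R b) \o face p.2 (bI R a)) c u).
have -> : \sum_i \sum_b fsgn i b * pull (face i (bI R b)) (coboundary L c) u =
    \sum_p F p.
  rewrite -(pair_bigA _ (fun i j => F (i, j))) /=; apply: eq_bigr => i _.
  rewrite /F exchange_big /=; apply: eq_bigr => b _.
  rewrite {1}/pull coboundaryE; last by apply: continuous_compose => //; exact: face_continuous.
  rewrite !mulr_sumr; apply: eq_bigr => j _; rewrite !mulr_sumr.
  apply: eq_bigr => a _; congr (_ * _); rewrite mulrCA; congr (_ * _).
  by rewrite -pull_pull //; exact: face_continuous.
have FN p : F (flip_face p) = - F p.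
  case: p => i j; rewrite /F exchange_big -sumrN; apply: eq_bigr => a _.
  rewrite -sumrN; apply: eq_bigr => b _ /=.
  have -> : face (flip_face (i, j)).1 (bI R b) \o face (flip_face (i, j)).2 (bI R a) =
    face i (bI R a) \o face j (bI R b) :> (cube d -> cube d.+2).
    by apply/funext => x; exact/esym/face_face.
  move: (pull _ c u) => P; rewrite !mulrA -mulNr; congr (_ * _); rewrite /fsgn -!exprD; apply: sign_opp.
  have := flip_face_odd i j; rewrite /= => h.
  move: h; set k := odflt _ _; case: (a); case: (b) => /=; lia.
have : \sum_p F p = - \sum_p F p.
  rewrite {1}(reindex_inj (can_inj (@flip_faceK d))) /= -sumrN.
  by apply: eq_bigr => p _; exact: FN.
lia.
Qed.

Definition sd d (c : cochain d) : cochain d := fun u => \sum_e pull (half e) c u.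

(** The cochain homotopy between the identity and [sd]. *)
Definition hsd d (c : cochain d.+1) : cochain d := fun u => \sum_e pull (grow e) c u.

Definition normalized d (c : cochain d) :=
  forall u, continuous u -> degenerate u -> c u = 0.

Lemma pull_degenerate d e (phi : cube e -> cube d) (c : cochain e) (i : 'I_e) u :
  normalized c -> continuous u -> continuous phi ->
  (forall x y : cube e, (forall j, j != i -> val x 0 j = val y 0 j) -> phi x = phi y) ->
  pull phi c u = 0.
Proof.
move=> cn uc pc h; rewrite /pull cn ?mulr0 //; first exact: continuous_compose.
by exists i => x y xy; congr u; exact: h.
Qed.

(** The terms with [e i = ~~ b] belong to faces interior to the subdivision; the first hypothesis
    identifies the two copies of each, and their signs are opposite. The terms with [e i = b] are
    pieces of the outer faces. *)
Lemma sum_signed_split d (i : 'I_d.+1) (F : bool -> {ffun 'I_d.+1 -> bool} -> int)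
    (G : bool -> {ffun 'I_d -> bool} -> int) :
  (forall b e, F b (insb i (~~ b) e) = F (~~ b) (insb i b e)) ->
  (forall b e, F b (insb i b e) = G b e) ->
  \sum_b fsgn i b * \sum_e F b e = \sum_b fsgn i b * \sum_e G b e.
Proof.
move=> mid out; under eq_bigr do rewrite (sum_insb i).
rewrite !big_bool /= -![fsgn i false]/(fsgn i (~~ true)) fsgnN.
under [\sum_(e : {ffun _ -> _}) F true (insb i false e)]eq_bigr do
  rewrite -[false]/(~~ true) mid /=.
under [\sum_(e : {ffun _ -> _}) F true (insb i true e)]eq_bigr do rewrite out.
under [\sum_(e : {ffun _ -> _}) F false (insb i false e)]eq_bigr do rewrite out.
rewrite !mulrDr; ring.
Qed.

Lemma sd_coboundary d (c : cochain d) : ceq (sd (coboundary L c)) (coboundary L (sd c)).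
Proof.
move=> u uc; rewrite coboundaryE //.
have -> : sd (coboundary L c) u =
    \sum_i \sum_b fsgn i b * \sum_e pull (half e \o face i (bI R b)) c u.
  rewrite /sd; transitivity (\sum_(e : {ffun 'I_d.+1 -> bool}) \sum_i \sum_b
      fsgn i b * pull (half e \o face i (bI R b)) c u).
    apply: eq_bigr => e _; rewrite {1}/pull coboundaryE; last first.
      by apply: continuous_compose => //; exact: half_continuous.
    rewrite mulr_sumr; apply: eq_bigr => i _; rewrite mulr_sumr; apply: eq_bigr => b _.
    by rewrite mulrCA -pull_pull //; exact: half_continuous.
  rewrite exchange_big; apply: eq_bigr => i _; rewrite exchange_big.
  by apply: eq_bigr => b _; rewrite mulr_sumr.
apply: eq_bigr => i _.
rewrite (@sum_signed_split _ i (fun b e => pull (half e \o face i (bI R b)) c u)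
  (fun b e => pull (face i (bI R b) \o half e) c u)).
- apply: eq_bigr => b _; congr (_ * _); rewrite {2}/pull mulr_sumr.
  apply: eq_bigr => e _; rewrite -pull_pull //; exact: face_continuous.
- by move=> b e; rewrite half_face_mid.
- by move=> b e; rewrite half_face.
Qed.

(** At the end of the homotopy a coordinate j with [e j] is frozen at 1, so the cube is degenerate.
    This is where normalization of cochains enters. *)
Let grow_face01_zero d (c : cochain d) (e : {ffun 'I_d -> bool}) u :
  normalized c -> continuous u -> e != [ffun=> false] ->
  pull (grow e \o face ord0 (I1 R)) c u = 0.
Proof.
move=> cn uc e0.
have [j ej] : exists j, e j.
  apply/existsP; apply: contraNT e0 => /existsPn h.
  by apply/eqP/ffunP => j; rewrite ffunE; apply/negbTE.
apply: (@pull_degenerate _ _ _ _ j) => //.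
  by apply: continuous_compose; [exact: face_continuous|exact: grow_continuous].
move=> x y xy; apply: cube_ext => l; rewrite /comp !growE !face_same !face_lift.
have [->|lj] := eqVneq l j; last by rewrite xy.
by rewrite ej /grow_fun -[val (I1 R)]/(1 : R); lra.
Qed.

Let grow_ends d (c : cochain d) u : normalized c -> continuous u ->
  \sum_b fsgn (ord0 : 'I_d.+1) b *
    \sum_(e : {ffun 'I_d -> bool}) pull (grow e \o face ord0 (bI R b)) c u =
  c u - sd c u.
Proof.
move=> cn uc; rewrite big_bool /= /fsgn /= expr0 mul1r expr1 mulN1r.
congr (_ - _).
  rewrite (bigD1 [ffun=> false]) //= grow_face01 big1 ?addr0; last first.
    by move=> e e0; exact: grow_face01_zero.
  by rewrite /pull tr_cube0 mul1r.
by apply: eq_bigr => e _; rewrite grow_face00.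
Qed.

Let hsd_coboundaryE d (c : cochain d) u : continuous u ->
  hsd (coboundary L c) u = \sum_i \sum_b fsgn i b *
    \sum_(e : {ffun 'I_d -> bool}) pull (grow e \o face i (bI R b)) c u.
Proof.
move=> uc; rewrite /hsd.
transitivity (\sum_(e : {ffun 'I_d -> bool}) \sum_i \sum_b
    fsgn i b * pull (grow e \o face i (bI R b)) c u).
  apply: eq_bigr => e _; rewrite {1}/pull coboundaryE; last first.
    by apply: continuous_compose => //; exact: grow_continuous.
  rewrite mulr_sumr; apply: eq_bigr => i _; rewrite mulr_sumr; apply: eq_bigr => b _.
  by rewrite mulrCA -pull_pull //; exact: grow_continuous.
rewrite exchange_big; apply: eq_bigr => i _; rewrite exchange_big.
by apply: eq_bigr => b _; rewrite mulr_sumr.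
Qed.

Lemma hsd_homotopy0 (c : cochain 0) u : continuous u ->
  hsd (coboundary L c) u = c u - sd c u.
Proof.
move=> uc; rewrite hsd_coboundaryE // big_ord_recl big_ord0 addr0 grow_ends //.
by move=> v _ [[]].
Qed.

(** The two faces in the homotopy variable give [c u - sd c u]. The other faces give the coboundary
    of [hsd c], negated because the homotopy variable comes first and shifts their index by one. *)
Lemma hsd_homotopy d (c : cochain d.+1) u : normalized c -> continuous u ->
  hsd (coboundary L c) u = c u - sd c u - coboundary L (hsd c) u.
Proof.
move=> cn uc; rewrite hsd_coboundaryE // big_ord_recl grow_ends //; congr (_ + _).
rewrite coboundaryE // -sumrN; apply: eq_bigr => i _.
have fl b : fsgn (lift ord0 i) b = - fsgn i b by rewrite /fsgn /= exprS mulN1r.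
under eq_bigr do rewrite fl mulNr.
rewrite sumrN; congr (- _).
rewrite (@sum_signed_split _ i
  (fun b e => pull (grow e \o face (lift ord0 i) (bI R b)) c u)
  (fun b e => pull (face i (bI R b) \o grow e) c u)).
- apply: eq_bigr => b _; congr (_ * _); rewrite {2}/pull mulr_sumr.
  apply: eq_bigr => e _; rewrite -pull_pull //; exact: face_continuous.
- by move=> b e; rewrite grow_face_mid.
- by move=> b e; rewrite grow_face.
Qed.

End Pull.

(** * Extension of a cocycle from small cubes to all cubes *)

Section Subdivision.
Variables (R : realType) (T : topologicalType) (L : local_system R T).
Local Notation I := (unit_itv R).
Local Notation cube := (cube R).
Local Notation cochain := (cochain R T).
Local Notation sd := (@sd R T L _).
Local Notation hsd := (@hsd R T L _).
Local Notation pull := (@pull R T L _ _).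

Lemma pull_zero d e (phi : cube e -> cube d) (c : cochain e) u :
  c (u \o phi) = 0 -> pull phi c u = 0.
Proof. by rewrite /pull => ->; rewrite mulr0. Qed.

Lemma hsd_normalized d (c : cochain d.+1) : normalized c -> normalized (hsd c).
Proof.
move=> cn u uc [i ui]; rewrite /hsd big1 // => e _; apply: pull_zero; apply: cn.
  by apply: continuous_compose => //; exact: grow_continuous.
exists (lift ord0 i) => x y xy; apply: ui => j ji; rewrite !growE.
by rewrite !xy ?neq_lift // (inj_eq lift_inj).
Qed.

(** In the direction in which the cube is constant the two faces coincide and cancel; every other
    face is again degenerate. *)
Lemma coboundary_normalized d (c : cochain d) : normalized c ->
  normalized (coboundary L c).
Proof.
move=> cn u uc [i ui]; rewrite coboundaryE // (bigD1 i) //= [X in _ + X]big1 => [|j ji].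
  have e1 : u \o face i (I1 R) = u \o face i (I0 R).
    apply/funext => x; apply: ui => l li; have [l' ->|E] := unliftP i l.
      by rewrite !face_lift.
    by rewrite E eqxx in li.
  rewrite addr0 big_bool /= -[fsgn i false]/(fsgn i (~~ true)) fsgnN /pull e1.
  have -> : face i (I0 R) (cube0 R d) = cube0 R d.+1.
    by apply: cube_ext => j; rewrite faceE mxE; case: unliftP => // j' _; rewrite mxE.
  rewrite tr_cube0 (_ : tr L u _ = 1) ?mulNr ?subrr //.
  rewrite /tr (_ : _ \o _ = fun=> u (cube0 R d.+1)) ?transport_cst //.
  apply/funext => t /=; apply: ui => l li; rewrite !mxE.
  case: unliftP => [l' _|E]; last by rewrite E eqxx in li.
  by rewrite mxE; lra.
apply: big1 => b _; rewrite pull_zero ?mulr0 //; apply: cn.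
  by apply: continuous_compose => //; exact: face_continuous.
have [i' ii'] : exists i', i = lift j i'.
  by have [i' ->|E] := unliftP j i; [exists i'|rewrite E eqxx in ji].
exists i' => x y xy; apply: ui => l li; have [l' ll'|->] := unliftP j l.
  rewrite ll' !face_lift; apply: xy; apply: contraNneq li => l'i'.
  by rewrite ll' l'i' -ii'.
by rewrite !face_same.
Qed.

Fixpoint piece d (s : seq {ffun 'I_d -> bool}) : cube d -> cube d :=
  if s is e :: s' then half e \o piece s' else id.

Lemma piece_continuous d (s : seq {ffun 'I_d -> bool}) : continuous (piece s).
Proof.
elim: s => [|e s IH]; first by move=> x; exact: cvg_id.
by apply: continuous_compose => //; exact: half_continuous.
Qed.

Lemma iter_sd_zero d m (c : cochain d) u :
  (forall s, size s = m -> c (u \o piece s) = 0) -> iter m sd c u = 0.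
Proof.
elim: m u => [|m IH] u h; first exact: (h [::]).
rewrite iterS /sd big1 // => e _; apply: pull_zero; apply: IH => s sm.
by apply: (h (e :: s)); rewrite /= sm.
Qed.

Lemma sd_ceq d (c c' : cochain d) : ceq c c' -> ceq (sd c) (sd c').
Proof.
by move=> cc u uc; apply: eq_bigr => e _; apply: pull_ceq => //; exact: half_continuous.
Qed.

Lemma iter_sd_ceq d m (c c' : cochain d) : ceq c c' -> ceq (iter m sd c) (iter m sd c').
Proof. by elim: m => [//|m IH] /IH; rewrite !iterS; exact: sd_ceq. Qed.

Lemma ceq_trans d (b a c : cochain d) : ceq a b -> ceq b c -> ceq a c.
Proof. by move=> ab bc u uc; rewrite ab ?bc. Qed.

Lemma iter_sd_coboundary d m (c : cochain d) :
  ceq (iter m sd (coboundary L c)) (coboundary L (iter m sd c)).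
Proof.
elim: m => [//|m IH]; rewrite !iterS.
by apply: ceq_trans (sd_ceq IH) _; exact: sd_coboundary.
Qed.

Lemma pullB d e (phi : cube e -> cube d) (a b : cochain e) u :
  pull phi (fun v => a v - b v) u = pull phi a u - pull phi b u.
Proof. by rewrite /pull mulrBr. Qed.

Lemma coboundaryB d (a b : cochain d) : ceq (coboundary L (fun v => a v - b v))
  (fun v => coboundary L a v - coboundary L b v).
Proof.
move=> u uc; rewrite !coboundaryE // -sumrB; apply: eq_bigr => i _.
by rewrite -sumrB; apply: eq_bigr => f _; rewrite pullB mulrBr.
Qed.

Lemma iter_sdB d m (a b : cochain d) u :
  iter m sd (fun v => a v - b v) u = iter m sd a u - iter m sd b u.
Proof.
elim: m u => [//|m IH] u; rewrite !iterS /sd -sumrB; apply: eq_bigr => e _.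
by rewrite -pullB /pull IH.
Qed.

Lemma iter_sdS d m (c : cochain d) : iter m.+1 sd c = iter m sd (sd c).
Proof. by rewrite iterSr. Qed.

(* Subdivides the cubes of a chain M times, correcting by coboundaries so that
   the cohomology class does not change. *)
Definition subdivided d (c : cochain d) M : cochain d :=
  fun u => c u - \sum_(m < M) iter m sd (hsd (coboundary L c)) u.

(** By [hsd_homotopy] for the cocycle [coboundary L c], the m-th correction has as coboundary the
    difference of its m-th and (m+1)-st subdivisions, and the sum telescopes. *)
Lemma subdivided_coboundary d (c : cochain d) M : normalized c ->
  ceq (coboundary L (subdivided c M)) (iter M sd (coboundary L c)).
Proof.
move=> cn; elim: M => [|M IH].
  move=> u uc; apply: coboundary_ceq => // v vc.
  by rewrite /subdivided big_ord0 subr0.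
have dn := coboundary_normalized cn.
have E : ceq (subdivided c M.+1)
    (fun v => subdivided c M v - iter M sd (hsd (coboundary L c)) v).
  by move=> v vc; rewrite /subdivided big_ord_recr /= opprD addrA.
apply: ceq_trans (coboundary_ceq L E) _; apply: ceq_trans (@coboundaryB _ _ _) _.
move=> u uc; rewrite IH // iter_sdS -(@iter_sd_coboundary _ M _ u uc) -iter_sdB.
apply: iter_sd_ceq => // v vc.
have := hsd_homotopy L dn vc.
have -> : hsd (coboundary L (coboundary L c)) v = 0.
  rewrite /hsd big1 // => e _; apply: pull_zero; apply: coboundary_coboundary.
  by apply: continuous_compose => //; exact: grow_continuous.
lia.
Qed.

Definition faces_in (A : set T) d : (cube d -> T) -> Prop :=
  if d is d'.+1 return (cube d -> T) -> Prop then
    fun u => forall (i : 'I_d'.+1) b, range (u \o face i (bI R b)) `<=` A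
  else fun=> True.

(** The homotopy formula for [c] itself telescopes too, up to coboundaries of subdivisions of
    [hsd c]. On [u] these involve only pieces of the faces of [u], which lie in [A], where [c]
    vanishes. *)
Lemma subdivided_boundary d (c : cochain d) M (A : set T) u :
  normalized c -> (forall v, continuous v -> range v `<=` A -> c v = 0) ->
  continuous u ->
  faces_in A u ->
  subdivided c M u = iter M sd c u.
Proof.
case: d c u => [|d] c u cn cA uc uA.
  rewrite /subdivided; elim: M => [|M IH]; first by rewrite big_ord0 subr0.
  rewrite big_ord_recr /= opprD addrA IH -iterS iter_sdS -iter_sdB.
  apply: iter_sd_ceq => // v vc; rewrite hsd_homotopy0 //; lia.
rewrite /subdivided; elim: M => [|M IH]; first by rewrite big_ord0 subr0.
rewrite big_ord_recr /= opprD addrA IH -iterS iter_sdS -iter_sdB.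
transitivity (iter M sd (fun v => sd c v - - coboundary L (hsd c) v) u).
  by apply: iter_sd_ceq => // v vc; rewrite hsd_homotopy //; lia.
rewrite iter_sdB -[RHS]subr0; congr (_ - _).
transitivity (iter M sd (fun v => (0 : cochain d.+1) v - coboundary L (hsd c) v) u).
  by apply: iter_sd_ceq => // v vc; rewrite /= sub0r.
rewrite iter_sdB [X in X - _]iter_sd_zero // sub0r iter_sd_coboundary // coboundaryE //.
apply/eqP; rewrite oppr_eq0; apply/eqP.
rewrite big1 // => i _; rewrite big1 // => b _; rewrite pull_zero ?mulr0 //.
apply: iter_sd_zero => s _; rewrite /hsd big1 // => e _; apply: pull_zero; apply: cA.
  apply: continuous_compose; first exact: grow_continuous.
  apply: continuous_compose; first exact: piece_continuous.
  by apply: continuous_compose => //; exact: face_continuous.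
by move=> _ [x _ <-]; apply: (uA i b); exists (piece s (grow e x)).
Qed.

Section Extension.
Variables (d : nat) (c0 : cochain d) (X A : set T) (small : set T -> Prop).
Hypothesis c0_rel : rel_cochain A c0.
Hypothesis small_sub : forall B B' : set T, B' `<=` B -> small B -> small B'.
Hypothesis small_cocycle : forall v : cube d.+1 -> T, singular X v ->
  small (range v) -> coboundary L c0 v = 0.
Hypothesis small_pieces : forall d' (u : cube d' -> T), singular X u ->
  exists M, forall m, (M <= m)%N -> forall s, size s = m -> small (range (u \o piece s)).

Let c0n : normalized c0.
Proof. by move=> u uc ud; apply: c0_rel => //; right. Qed.

Let stable u := exists M, forall m, (M <= m)%N ->
  iter m sd (hsd (coboundary L c0)) u = 0.

Let stableX u : singular X u -> stable u.
Proof.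
move=> uX; have [M hM] := small_pieces uX; exists M => m /hM h.
apply: iter_sd_zero => s /h hs; rewrite /hsd big1 // => e _; apply: pull_zero.
have [uc ur] := uX; apply: small_cocycle.
  split.
    apply: continuous_compose; first exact: grow_continuous.
    by apply: continuous_compose => //; exact: piece_continuous.
  by move=> _ [x _ <-]; apply: ur; exists (piece s (grow e x)).
by apply: small_sub hs => _ [x _ <-]; exists (grow e x).
Qed.

(** The depth of subdivision depends on the cube. The default 0 is taken only off [X], by [stableX];
    it does no harm to the relative condition, since [subdivided_rel] holds at every depth. *)
Let N u : nat := if pselect (stable u) is left h then projT1 (cid h) else 0%N.

Let NP u m : stable u -> (N u <= m)%N -> iter m sd (hsd (coboundary L c0)) u = 0.
Proof.
rewrite /N => us; case: pselect => // h.
by case: (cid h) => M hM /=; exact: hM.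
Qed.

Let c : cochain d := fun u => subdivided c0 (N u) u.

Let cE u m : stable u -> (N u <= m)%N -> c u = subdivided c0 m u.
Proof.
move=> us; rewrite /c; elim: m => [|m IH]; first by rewrite leqn0 => /eqP ->.
rewrite leq_eqVlt => /orP[/eqP -> //|]; rewrite ltnS => Nm.
by rewrite IH // /subdivided big_ord_recr /= (NP us Nm) addr0.
Qed.

Let subdivided_rel M : rel_cochain A (subdivided c0 M).
Proof.
move=> u uc uA; rewrite /subdivided c0_rel // big1 ?subr0 // => m _.
apply: iter_sd_zero => s _.
have pc : continuous (u \o piece s).
  by apply: continuous_compose => //; exact: piece_continuous.
case: uA => uA.
  rewrite /hsd big1 // => e _; apply: pull_zero.
  have vc : continuous ((u \o piece s) \o grow e).
    by apply: continuous_compose => //; exact: grow_continuous.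
  rewrite coboundaryE // big1 // => i _; rewrite big1 // => b _.
  rewrite pull_zero ?mulr0 //; apply: c0_rel.
    by apply: continuous_compose => //; exact: face_continuous.
  by left => _ [x _ <-]; apply: uA; eexists.
have dn := hsd_normalized (coboundary_normalized c0n).
apply: dn => //; case: uA => i ui; exists i => x y xy; apply: ui.
by elim: s {pc} x y xy => [|e s IH] x y xy //= j ji; rewrite !halfE (IH x y).
Qed.

(** Cutting a cube finely enough makes the local cocycle condition apply to each piece. On a cube
    with faces in [A] the corrections leave no trace, so values can be computed by plain
    subdivision. *)
Lemma small_extension : exists c : cochain d, rel_cocycle L X A c /\
  forall u, singular X u ->
    faces_in A u ->
    exists M, forall m, (M <= m)%N -> c u = iter m sd c0 u.
Proof.
exists c; split; last first.
  move=> u uX uA; exists (N u) => m Nm; rewrite (cE (stableX uX) Nm).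
  apply: (@subdivided_boundary _ _ _ A) => //; last by case: uX.
  by move=> v vc vA; apply: c0_rel => //; left.
split=> [u uc uA|v vX]; first exact: subdivided_rel.
have [vc vr] := vX; have [M hM] := small_pieces vX.
(* The faces of [v] are subdivided to different depths by [c]; past the common bound [K] all further
   corrections vanish, so a single [subdivided c0 K] serves every face. *)
pose K := maxn M (\max_(i < d.+1) \max_b N (v \o face i (bI R b))).
transitivity (coboundary L (subdivided c0 K) v).
  rewrite !coboundaryE //; apply: eq_bigr => i _; apply: eq_bigr => b _.
  congr (_ * (_ * _)); apply: cE.
    apply: stableX; split.
      by apply: continuous_compose => //; exact: face_continuous.
    by move=> _ [x _ <-]; apply: vr; eexists.
  apply: leq_trans (leq_maxr _ _).
  apply: leq_trans (@leq_bigmax _ (fun i : 'I_d.+1 => \max_b N (v \o face i (bI R b))) i).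
  exact: (@leq_bigmax _ (fun b => N (v \o face i (bI R b))) b).
rewrite subdivided_coboundary //; apply: iter_sd_zero => s sK.
apply: small_cocycle; last by apply: (hM K); rewrite // leq_maxl.
split; first by apply: continuous_compose => //; exact: piece_continuous.
by move=> _ [x _ <-]; apply: vr; eexists.
Qed.

End Extension.
End Subdivision.

(** * The cocycle of a cell *)

Section Lebesgue.
Variables (R : realType) (T : topologicalType).
Local Notation cube := (cube R).

Lemma piece_dist d (s : seq {ffun 'I_d -> bool}) (x y : cube d) j :
  `|val (piece s x) 0 j - val (piece s y) 0 j| <= 2^-1 ^+ size s.
Proof.
elim: s => [|e s IH]; rewrite [piece _]/=.
  rewrite [size _]/= expr0 /=; have := cubeP x j; have := cubeP y j => /andP[? ?] /andP[? ?].
  by rewrite ler_norml; lra.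
rewrite /comp !halfE [size _]/= exprS.
rewrite (_ : _ - _ = 2^-1 * (val (piece s x) 0 j - val (piece s y) 0 j)); last by field.
by rewrite normrM ger0_norm ?ler_pM2l // invr_gt0.
Qed.

Lemma nbhs_cube d (x : cube d) (W : set (cube d)) : nbhs x W ->
  exists2 e : R, 0 < e &
    forall y : cube d, (forall j, `|val x 0 j - val y 0 j| < e) -> W y.
Proof.
rewrite nbhsE => -[V [[Q oQ QV] Vx] VW].
have : nbhs (val x) Q by apply: open_nbhs_nbhs; split=> //; rewrite -QV in Vx.
move=> /nbhs_ballP[e /= e0 eQ]; exists e => // y xy; apply: VW; rewrite -QV; apply: eQ.
by split=> // i j; rewrite ord1; exact: xy.
Qed.

(** A Lebesgue number argument: by [piece_dist] the pieces of depth m have diameter at most 2^-m. *)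
Lemma lebesgue_pieces (small : set T -> Prop) d (u : cube d -> T) :
  (forall B B' : set T, B' `<=` B -> small B -> small B') ->
  (forall x : cube d, exists2 W, nbhs x W & small (u @` W)) ->
  exists M, forall m, (M <= m)%N -> forall s, size s = m -> small (range (u \o piece s)).
Proof.
move=> sub loc.
have cK : compact (cube d).
  rewrite (_ : cube d = [set v : 'rV[R]_d | forall i, `[0, 1]%classic (v ord0 i)]).
    exact: (@rV_compact R d (fun=> `[0, 1]%classic) (fun=> @segment_compact R 0 1)).
  by apply/seteqP; split=> x xK j; have := xK j; rewrite /= in_itv.
(* The property of a depth m and a point x says that every piece of depth m through x is small. It
   holds near each point for large m, and compactness makes the depth uniform. *)
have /(_ nat \oo (fun m x => forall s, size s = m ->
    (exists z, val (@piece R d s z) = x) -> small (range (u \o piece s))) _)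
  := (compact_near_coveringP _).1 cK.
case=> [x Kx|M _ hM]; last first.
  exists M => m /hM h s sm; apply: (h _ (valS (piece s (cube0 R d)))) => //.
  by exists (cube0 R d).
have [W xW sW] := loc (mkS Kx).
have [e e0 eW] := nbhs_cube xW.
(* One half of [e] is for the distance from x to x', the other for the diameter of a piece through
   x'. *)
have [N hN] : exists N, forall m, (N <= m)%N -> 2^-1 ^+ m < e / 2.
  have /cvgrPdist_lt /(_ (e / 2)) : (2^-1 : R) ^+ n @[n --> \oo] --> 0.
    by apply: cvg_expr; rewrite ger0_norm ?invr_ge0 // invf_lt1 ?ltr1n.
  case=> [|N _ hN]; first exact: divr_gt0.
  exists N => m Nm; have := hN m Nm.
  by rewrite /= sub0r normrN ger0_norm // exprn_ge0 // invr_ge0.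
exists (ball x (e / 2), [set m | (N <= m)%N]) => /=.
  by split; [apply: nbhsx_ballx; exact: divr_gt0|exists N].
move=> [x' m] /= [[_ xx'] Nm] s sm [z zx']; apply: sub sW => _ [t _ <-].
exists (piece s t) => //; apply: eW => j.
have h1 := xx' 0 j; have h2 := piece_dist s z t j; have h3 := hN _ Nm.
have {}zx' : val (piece s z) = x' := zx'; rewrite sm zx' in h2; rewrite /ball /= in h1.
rewrite -[val (mkS Kx)]/x -(subrKA (x' 0 j)) (le_lt_trans (ler_normD _ _)) //; lra.
Qed.

End Lebesgue.

(** * The truncated cup product and its values *)

Section LocalCocycle.
Variables (R : realType) (T : topologicalType) (L : local_system R T).
Local Notation I := (unit_itv R).
Local Notation cube := (cube R).
Local Notation cochain := (cochain R T).
Local Notation sd := (@sd R T L _).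
Local Notation pull := (@pull R T L _ _).

(** In the application [X] is a skeleton, [C] one of its top cells, [A] the rest of it, [rho] the
    squared cosine [cosq], [x] the coordinates of a cell cube and [g] the trivialization given by a
    chart. *)
Variables (X A C : set T) (rho : T -> R) (x : nat -> T -> R) (g : T -> int) (d : nat).
Hypothesis g_triv : forall p : I -> T, continuous p -> range p `<=` C ->
  L p * g (p (I0 R)) = g (p (I1 R)).
Hypothesis CA : forall y, A y -> ~ C y.
Hypothesis rho_cont : continuous rho.
Hypothesis rho_C : forall y, X y -> 0 < rho y -> C y.
Hypothesis x_cont : forall j y, (j < d)%N -> C y -> {for y, continuous (x j)}.
Hypothesis x_boundary : forall y, C y -> rho y = 2^-1 ->
  exists2 j, (j < d)%N & x j y != 0.

Let theta j y : int := if 0 < x j y then 1 else 0.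

(** Each step adds the factor d(theta_e) on the left: as the previous product is a cocycle over [C],
    the coboundary of theta_e times it is d(theta_e) times it. The function theta_e is a 0-cochain,
    hence read at the base vertex. *)
Fixpoint cup e : cochain e :=
  if e is e'.+1 return cochain e then
    coboundary L (fun u => theta e' (u (cube0 R e')) * @cup e' u)
  else fun u => g (u (cube0 R 0)).
Arguments cup : clear implicits.

Lemma cupS e :
  cup e.+1 = coboundary L (fun u => theta e (u (cube0 R e)) * cup e u).
Proof. by []. Qed.

Lemma cup_normalized e : normalized (cup e).
Proof.
elim: e => [u _ [[]] //|e IH]; rewrite cupS; apply: coboundary_normalized => u uc ud.
by rewrite IH // mulr0.
Qed.

Lemma tr_triv e (v : cube e -> T) y : continuous v -> range v `<=` C ->
  tr L v y * g (v (cube0 R e)) = g (v y).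
Proof.
move=> vc vC; rewrite /tr.
have := g_triv (p := v \o segc (cube0 R e) y).
rewrite /= segc0 segc1; apply; last by move=> _ [t _ <-]; apply: vC; eexists.
by apply: continuous_compose vc; exact: segc_continuous.
Qed.

Lemma tr_triv' e (v : cube e -> T) y : continuous v -> range v `<=` C ->
  tr L v y * g (v y) = g (v (cube0 R e)).
Proof.
by move=> vc vC; rewrite -(tr_triv y vc vC) mulrA; case: (tr_pm L y vc) => ->; ring.
Qed.

Let comp_face e (v : cube e.+1 -> T) i t : continuous v -> continuous (v \o face i t).
Proof. by move=> vc; apply: continuous_compose => //; exact: face_continuous. Qed.

Let range_comp Y Z (v : Y -> T) (f : Z -> Y) B : range v `<=` B -> range (v \o f) `<=` B.
Proof. by move=> vB _ [z _ <-]; apply: vB; exists (f z). Qed.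

Lemma cup_cocycle e (v : cube e.+1 -> T) : continuous v -> range v `<=` C ->
  coboundary L (cup e) v = 0.
Proof.
case: e v => [|e] v vc vC; last exact: coboundary_coboundary.
rewrite coboundaryE // big_ord_recl big_ord0 addr0 big_bool /=.
rewrite -[fsgn _ false]/(fsgn _ (~~ true)) fsgnN mulNr -mulrBr.
rewrite [X in _ * X](_ : _ = 0) ?mulr0 // /pull /=.
have e0 (y : cube 0) : y = cube0 R 0 by apply: cube_ext => -[].
by rewrite !(tr_triv' _ vc vC) subrr.
Qed.

(** If j is the last index, the constant factors out of the coboundary and [cup_cocycle] applies; if
    not, all faces inherit the vanishing. *)
Lemma cup_const e (v : cube e -> T) j : (j < e)%N -> continuous v -> range v `<=` C ->
  (forall y z, theta j (v y) = theta j (v z)) -> cup e v = 0.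
Proof.
elim: e v => [//|e IH] v je vc vC th; rewrite cupS; move: je.
rewrite ltnS leq_eqVlt => /orP[/eqP|] je.
  subst j.
  rewrite coboundaryE //.
  transitivity (theta e (v (cube0 R e.+1)) * coboundary L (cup e) v); last first.
    by rewrite cup_cocycle // mulr0.
  rewrite coboundaryE // mulr_sumr; apply: eq_bigr => i _; rewrite mulr_sumr.
  apply: eq_bigr => b _; rewrite /pull /= (th _ (cube0 R e.+1)); ring.
rewrite coboundaryE // big1 // => i _; rewrite big1 // => b _.
rewrite /pull IH ?mulr0 //; [exact: comp_face|exact: range_comp|].
by move=> y z; exact: th.
Qed.

(** The new factor of [cup] varies in the last coordinate, whose faces have sign (-1)^j in dimension
    j + 1. *)
Definition shuffle_sgn e : int := \prod_(j < e) (-1) ^+ j.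

(** A face that fixes a coordinate i other than the last makes theta_i constant, so [cup_const]
    kills it. The two faces in the last coordinate contribute the jump of theta_e. *)
Lemma cup_box e (v : cube e -> T) (tau : nat -> R -> int) :
  continuous v -> range v `<=` C ->
  (forall (j : 'I_e) y, theta j (v y) = tau j (val y 0 j)) ->
  cup e v = shuffle_sgn e * (\prod_(j < e) (tau j 1 - tau j 0)) * g (v (cube0 R e)).
Proof.
elim: e v => [|e IH] v vc vC th; last rewrite cupS.
  by rewrite /shuffle_sgn !big_ord0 !mul1r.
rewrite coboundaryE // (bigD1 ord_max) //= [X in _ + X]big1 ?addr0; last first.
  move=> i im; rewrite big1 // => b _; have [j ij|E] := unliftP ord_max i; last first.
    by rewrite E eqxx in im.
  rewrite /pull (@cup_const _ _ j) ?mulr0 //; [exact: comp_face|exact: range_comp|].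
  move=> y z; have ji : (j : nat) = i by rewrite ij lift_max.
  by rewrite ji /= !th !face_same.
have F b : pull (face ord_max (bI R b)) (fun u => theta e (u (cube0 R e)) * cup e u) v =
   tau e b%:R * (shuffle_sgn e * \prod_(j < e) (tau j 1 - tau j 0)) * g (v (cube0 R e.+1)).
  rewrite /pull /= (IH (v \o face ord_max (bI R b))); first last.
  - move=> j y /=; have := th (lift ord_max j) (face ord_max (bI R b) y).
    by rewrite face_lift lift_max.
  - exact: range_comp.
  - exact: comp_face.
  have := th ord_max (face ord_max (bI R b) (cube0 R e)); rewrite /= face_same bIE => ->.
  rewrite -(tr_triv' (face ord_max (bI R b) (cube0 R e)) vc vC) /=; ring.
rewrite big_bool !F -[fsgn _ false]/(fsgn _ (~~ true)) fsgnN /fsgn /= addn0.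
rewrite /shuffle_sgn !big_ord_recr /=; ring.
Qed.

Let B := [set y | C y /\ 2^-1 < rho y].

Definition local_cochain : cochain d :=
  fun u => if `[< range u `<=` B >] then cup d u else 0.

Local Notation c0 := local_cochain.

Lemma local_cochainE u : range u `<=` B -> c0 u = cup d u.
Proof. by move=> h; rewrite /c0 ifT //; apply/asboolP. Qed.

Lemma local_cochain0 u : ~ range u `<=` B -> c0 u = 0.
Proof. by move=> h; rewrite /c0 ifF //; apply/negbTE/asboolPn. Qed.

Lemma range_cube0 e (u : cube e -> T) : range u (u (cube0 R e)).
Proof. by exists (cube0 R e). Qed.

Lemma local_cochain_rel : rel_cochain A c0.
Proof.
move=> u uc [uA|ud].
  apply: local_cochain0 => h; have [+ _] := h _ (range_cube0 u).
  by apply: CA; apply: uA; exact: range_cube0.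
rewrite /c0; case: ifP => // _; exact: cup_normalized.
Qed.

Lemma local_cochain_const j u : (j < d)%N -> continuous u ->
  (forall y z, C (u y) -> C (u z) -> theta j (u y) = theta j (u z)) -> c0 u = 0.
Proof.
move=> jd uc th; rewrite /c0; case: ifPn => // /asboolP uB.
have uC : range u `<=` C by move=> y /uB[].
apply: (@cup_const _ _ j) => // y z.
by apply: th; apply: uC; eexists.
Qed.

(** The three situations in which truncating to [B] is harmless: nothing is cut, or the product is 0
    anyway because some theta_j is constant, or everything is cut. Near the level 1/2 of [rho] the
    second one holds, by [x_boundary]. *)
Definition local_small (S : set T) : Prop :=
  [\/ S `<=` B,
      S `<=` C /\ exists2 j, (j < d)%N & forall y z, S y -> S z -> theta j y = theta j z |
      forall y, S y -> rho y < 2^-1].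

Lemma local_small_sub (S S' : set T) : S' `<=` S -> local_small S -> local_small S'.
Proof.
move=> SS' [h|[h [j jd th]]|h].
- by apply: Or31 => y /SS' /h.
- apply: Or32; split; first by move=> y /SS' /h.
  by exists j => // y z /SS' hy /SS' hz; exact: th.
- by apply: Or33 => y /SS' /h.
Qed.

Lemma local_cochain_cocycle (v : cube d.+1 -> T) : singular X v ->
  local_small (range v) -> coboundary L c0 v = 0.
Proof.
move=> [vc vX] sm.
have c0_0 : (forall i b, c0 (v \o face i (bI R b)) = 0) -> coboundary L c0 v = 0.
  move=> h; rewrite coboundaryE // big1 // => i _; rewrite big1 // => b _.
  by rewrite /pull h !mulr0.
case: sm => [vB|[vC [j jd th]]|vrho].
- rewrite -(@cup_cocycle _ v) //; last by move=> y /vB[].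
  rewrite !coboundaryE //; apply: eq_bigr => i _; apply: eq_bigr => b _.
  by rewrite /pull local_cochainE //; exact: range_comp.
- apply: c0_0 => i b; apply: (@local_cochain_const j) => //; first exact: comp_face.
  by move=> y z _ _; apply: th; eexists.
- apply: c0_0 => i b; apply: local_cochain0 => h.
  have [_] := h _ (range_cube0 _).
  have := vrho (v (face i (bI R b) (cube0 R d))); rewrite /= => /(_ _) h1 h2.
  have : rho (v (face i (bI R b) (cube0 R d))) < 2^-1 by apply: h1; eexists.
  by move/(lt_trans h2); rewrite ltxx.
Qed.

Lemma local_small_pieces e (u : cube e -> T) : singular X u ->
  exists M, forall m, (M <= m)%N -> forall s, size s = m ->
    local_small (range (u \o piece s)).
Proof.
move=> [uc uX]; apply: lebesgue_pieces; first exact: local_small_sub.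
move=> t.
have rc : {for t, continuous (rho \o u)}.
  by apply: continuous_comp; [exact: uc|exact: rho_cont].
have Xu y : X (u y) by apply: uX; exists y.
have near_gt (f : T -> R) r : {for t, continuous (f \o u)} -> r < f (u t) ->
    nbhs t [set y | r < f (u y)].
  by move=> fc h; apply: (fc [set z | r < z]); exact: lt_nbhsr.
have near_lt (f : T -> R) r : {for t, continuous (f \o u)} -> f (u t) < r ->
    nbhs t [set y | f (u y) < r].
  by move=> fc h; apply: (fc [set z | z < r]); exact: lt_nbhsl.
have [h|h|h] := ltrgtP (rho (u t)) 2^-1.
- exists [set y | rho (u y) < 2^-1]; first exact: near_lt.
  by apply: Or33 => _ [y hy <-].
- exists [set y | 2^-1 < rho (u y)]; first exact: near_gt.
  apply: Or31 => _ [y hy <-]; split=> //; apply: rho_C => //.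
  by apply: lt_trans hy; rewrite invr_gt0.
- have r0 : 0 < rho (u t) by rewrite h invr_gt0.
  have [j jd xj] := x_boundary (rho_C (Xu t) r0) h.
  have xc : {for t, continuous (x j \o u)}.
    by apply: continuous_comp; [exact: uc|apply: x_cont => //; exact: rho_C].
  have [s hs] : exists2 W, nbhs t W & forall y z, W y -> W z ->
      theta j (u y) = theta j (u z).
    move: xj; rewrite neq_lt => /orP[xj|xj].
      exists [set y | x j (u y) < 0]; first exact: near_lt.
      by move=> y z /= hy hz; rewrite /theta !ltNge !ltW.
    exists [set y | 0 < x j (u y)]; first exact: near_gt.
    by move=> y z /= hy hz; rewrite /theta hy hz.
  move=> th; exists ([set y | 0 < rho (u y)] `&` s).
    by apply: filterI => //; exact: near_gt.
  apply: Or32; split; first by move=> _ [y [hy _] <-]; exact: rho_C.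
  by exists j => // _ _ [y [_ hy] <-] [z [_ hz] <-]; exact: th.
Qed.

Section Count.
Variable e : nat -> bool.

Let xi : {ffun 'I_d -> bool} := [ffun j => e (val j)].

Lemma boolr_itv (b : bool) : 0 <= (b%:R : R) <= 1.
Proof. by case: b; rewrite lexx ler01. Qed.

Lemma corner_subproof j : 0 <= (\row_(l < d) (e l)%:R : 'rV[R]_d) 0 j <= 1.
Proof. by rewrite mxE; exact: boolr_itv. Qed.

Definition corner : cube d := mkcube corner_subproof.

Let cornerE j : val corner 0 j = (e j)%:R.
Proof. by rewrite mxE. Qed.

(** Over [C], theta_j is 0 on the facet t_j = e_j and 1 off it, so among the small cubes only the
    one at [corner] sees every theta_j vary. *)
Let cornered (v : cube d -> T) := forall t (j : 'I_d), C (v t) ->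
  (0 < x j (v t)) = if e j then val t 0 j < 1 else 0 < val t 0 j.

Let cornered_half v : cornered v -> cornered (v \o half xi).
Proof.
move=> vc t j Cv; rewrite (vc _ _ Cv) halfE /xi ffunE.
case: (e j) => /=; last by rewrite addr0 pmulr_lgt0 // invr_gt0.
by rewrite ltr_pdivrMr // mul1r -[X in _ < X]/(1 + 1) ltrD2r.
Qed.

Let corner_off v (eps : {ffun 'I_d -> bool}) m : continuous v -> cornered v -> eps != xi ->
  pull (half eps) (iter m sd c0) v = 0.
Proof.
move=> vc cv ne.
have [j ej] : exists j, eps j != xi j.
  apply/existsP; apply: contraNT ne => /existsPn h.
  by apply/eqP/ffunP => j; apply/eqP; rewrite -[_ == _]negbK.
apply: pull_zero; apply: iter_sd_zero => s _.
apply: (@local_cochain_const j) => //.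
  apply: continuous_compose; first exact: piece_continuous.
  by apply: continuous_compose => //; exact: half_continuous.
have E y : C (((v \o half eps) \o piece s) y) ->
    theta j (((v \o half eps) \o piece s) y) = 1.
  move=> Cy; rewrite /theta (cv _ _ Cy) halfE; move: ej; rewrite /xi ffunE.
  have := cubeP (piece s y) j.
  case: (e j); case: (eps j) => //= /andP[? ?] _; rewrite ifT //; lra.
by move=> y z Cy Cz; rewrite !E.
Qed.

Let corner_iter v m : continuous v -> cornered v ->
  iter m sd c0 v = pull (piece (nseq m xi)) c0 v.
Proof.
elim: m v => [|m IH] v vc cv; first by rewrite /pull tr_cube0 mul1r.
have hc : continuous (v \o half xi).
  by apply: continuous_compose => //; exact: half_continuous.
rewrite iterS /sd (bigD1 xi) //= big1 ?addr0; last first.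
  by move=> eps ne; exact: corner_off.
rewrite /pull IH //; last exact: cornered_half.
rewrite /pull mulrA [X in X * _]mulrC -tr_comp //; exact: half_continuous.
Qed.

Let half_corner : half xi corner = corner.
Proof. by apply: cube_ext => j; rewrite halfE cornerE /xi ffunE; case: (e j) => /=; lra. Qed.

Let piece_corner m : piece (nseq m xi) corner = corner.
Proof. by elim: m => [//|m IH] /=; rewrite IH half_corner. Qed.

Let cornered_piece v m : cornered v -> cornered (v \o piece (nseq m xi)).
Proof. by elim: m v => [//|m IH] v cv; have := IH _ (cornered_half cv). Qed.

Let near_B (v : cube d -> T) t : singular X v -> B (v t) -> nbhs t [set y | B (v y)].
Proof.
move=> [vc vX] [Ct rt].
have rc : {for t, continuous (rho \o v)}.
  by apply: continuous_comp; [exact: vc|exact: rho_cont].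
have : nbhs t [set y | 2^-1 < rho (v y)].
  by apply: (rc [set z | 2^-1 < z]); exact: lt_nbhsr.
apply: filterS => y /= ry; split=> //; apply: rho_C; first by apply: vX; exists y.
by apply: lt_trans ry; rewrite invr_gt0.
Qed.

Let orient : int := \prod_(j < d) (if e j then -1 else 1).

Let corner_count v : singular X v -> cornered v -> B (v corner) ->
  exists M, forall m, (M <= m)%N ->
    iter m sd c0 v = tr L v corner * (shuffle_sgn d * orient * g (v corner)).
Proof.
move=> vX cv Bv; have [vc _] := vX.
have [r r0 rB] := nbhs_cube (near_B vX Bv).
have [N hN] : exists N, forall m, (N <= m)%N -> 2^-1 ^+ m < r.
  have /cvgrPdist_lt /(_ r) : (2^-1 : R) ^+ n @[n --> \oo] --> 0.
    by apply: cvg_expr; rewrite ger0_norm ?invr_ge0 // invf_lt1 ?ltr1n.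
  case=> [//|N _ hN]; exists N => m Nm; have := hN m Nm.
  by rewrite /= sub0r normrN ger0_norm // exprn_ge0 // invr_ge0.
exists N => m Nm; rewrite corner_iter //.
set P := piece (nseq m xi).
have Pc : continuous P by exact: piece_continuous.
have vPc : continuous (v \o P) by exact: continuous_compose.
have rP : range (v \o P) `<=` B.
  move=> _ [t _ <-]; apply: rB => j; have := piece_dist (nseq m xi) corner t j.
  by rewrite piece_corner size_nseq => h; apply: le_lt_trans h (hN m Nm).
have rPC : range (v \o P) `<=` C by move=> y /rP[].
rewrite /pull local_cochainE //.
rewrite (@cup_box _ _ (fun j r => if e j then (if r < 1 then 1 else 0)
    else (if 0 < r then 1 else 0))) //; last first.
  move=> j t; rewrite /theta (cornered_piece cv); first by case: (e j).
  by apply: rPC; exists t.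
have -> : \prod_(j < d) ((if e j then (if 1 < 1 :> R then 1 else 0)
    else (if 0 < 1 :> R then 1 else 0)) - (if e j then (if 0 < 1 :> R then 1 else 0)
    else (if 0 < 0 :> R then 1 else 0))) = orient.
  by apply: eq_bigr => j _; rewrite !ltxx ltr01; case: (e j).
rewrite -(tr_triv' corner vPc rPC).
rewrite [in RHS](_ : tr L v corner = tr L (v \o P) corner * tr L v (P (cube0 R d))).
  by rewrite /= /P piece_corner; ring.
by rewrite -tr_comp // /P piece_corner.
Qed.

Lemma center_subproof j : 0 <= (const_mx 2^-1 : 'rV[R]_d) 0 j <= 1.
Proof. by rewrite mxE; lra. Qed.

Definition center : cube d := mkcube center_subproof.

Lemma centerE j : val center 0 j = 2^-1.
Proof. by rewrite mxE. Qed.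

Lemma center_count (u : cube d -> T) : singular X u -> B (u center) ->
  (forall t (j : 'I_d), C (u t) ->
     (0 < x j (u t)) = if e j then val t 0 j < 2^-1 else 2^-1 < val t 0 j) ->
  exists M, forall m, (M <= m)%N ->
    iter m sd c0 u = tr L u center * (shuffle_sgn d * orient * g (u center)).
Proof.
move=> uX Bu sgn; have [uc ur] := uX.
(* After one subdivision the center is a corner of every small cube. If [e j], theta_j is 1 exactly
   for t_j < 1/2, so the jump is seen in the lower half, at its upper end; otherwise in the upper
   half. In all other small cubes some theta_j is constantly 0. *)
pose xi' : {ffun 'I_d -> bool} := [ffun j => ~~ e (val j)].
have hcenter : half xi' corner = center.
  by apply: cube_ext => j; rewrite halfE cornerE centerE ffunE; case: (e j) => /=; lra.
have vc : continuous (u \o half xi').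
  by apply: continuous_compose => //; exact: half_continuous.
have [|t j Ct||M hM] := @corner_count (u \o half xi').
- by split=> // _ [t _ <-]; apply: ur; eexists.
- rewrite (sgn _ _ Ct) halfE ffunE; case: (e j) => /=.
    by rewrite addr0 ltr_pdivrMr // mulVf ?pnatr_eq0.
  by rewrite ltr_pdivlMr // mulVf ?pnatr_eq0 // ltrDr.
- by rewrite /= hcenter.
exists M.+1 => -[//|m] Mm; rewrite iterS /sd (bigD1 xi') //= [X in _ + X]big1 ?addr0.
  rewrite /pull hM // mulrA [X in X * _]mulrC -tr_comp ?hcenter //=.
    by rewrite hcenter.
  exact: half_continuous.
move=> eps ne.
have [j ej] : exists j, eps j != xi' j.
  apply/existsP; apply: contraNT ne => /existsPn h.
  by apply/eqP/ffunP => j; apply/eqP; rewrite -[_ == _]negbK.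
apply: pull_zero; apply: iter_sd_zero => s _.
apply: (@local_cochain_const j) => //.
  apply: continuous_compose; first exact: piece_continuous.
  by apply: continuous_compose => //; exact: half_continuous.
have E y : C (((u \o half eps) \o piece s) y) ->
    theta j (((u \o half eps) \o piece s) y) = 0.
  move=> Cy; rewrite /theta (sgn _ _ Cy) halfE; move: ej; rewrite ffunE.
  have := cubeP (piece s y) j.
  case: (e j); case: (eps j) => //= /andP[? ?] _; rewrite ifF //; lra.
by move=> y z Cy Cz; rewrite !E.
Qed.

End Count.

(** The value is a local degree at the center: the product of the directions of the coordinates,
    times a sign common to all cubes with the same center, transported to the base point. *)
Lemma cell_cocycle : exists c : cochain d, rel_cocycle L X A c /\
  forall (u : cube d -> T) (e : nat -> bool), singular X u ->
    faces_in A u ->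
    C (u center) -> 2^-1 < rho (u center) ->
    (forall t (j : 'I_d), C (u t) ->
       (0 < x j (u t)) = if e j then val t 0 j < 2^-1 else 2^-1 < val t 0 j) ->
    c u = tr L u center *
      (shuffle_sgn d * (\prod_(j < d) (if e j then -1 else 1)) * g (u center)).
Proof.
have [c [cc cu]] := small_extension local_cochain_rel local_small_sub
  local_cochain_cocycle local_small_pieces.
exists c; split=> // u e uX uA Cu ru sgn.
have [M1 h1] := cu u uX uA.
have [M2 h2] := @center_count e u uX (conj Cu ru) sgn.
by rewrite (h1 (maxn M1 M2)) ?leq_maxl // h2 // leq_maxr.
Qed.

End LocalCocycle.

(** * Frames, pivots and charts *)

Section GrassmannBasics.
Variables (R : realType) (k n : nat).
Local Notation Gr := (Gr R k n).
Implicit Types (A B : 'M[R]_(k, n)) (V : Gr) (v : 'rV[R]_n).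

Lemma rows_nth A (i : 'I_k) : (rows A)`_i = row i A.
Proof. by rewrite -tnth_nth tnth_mktuple. Qed.

Lemma mem_span_rows A v : (v \in <<rows A>>%VS) = (v <= A)%MS.
Proof.
apply/idP/idP => [/coord_span ->|/submxP[D ->]].
  by apply: summx_sub => i _; rewrite rows_nth; apply: scalemx_sub; exact: row_sub.
rewrite mulmx_sum_row; apply: memv_suml => i _; apply: memvZ; apply: memv_span.
by rewrite -rows_nth; apply: mem_nth; rewrite size_tuple.
Qed.

Lemma free_rows A : free (rows A) = row_free A.
Proof.
apply/freeP/idP => [h|fA c c0 i].
  rewrite -kermx_eq0; apply/eqP/row_matrixP => i; rewrite row0; apply/rowP => j.
  rewrite [RHS]mxE; apply: (h (fun j => row i (kermx A) 0 j)).
  under eq_bigr do rewrite rows_nth.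
  by rewrite -mulmx_sum_row -row_mul mulmx_ker row0.
have /(row_free_inj fA) : (\row_j c j) *m A = 0 *m A.
  rewrite mul0mx mulmx_sum_row -[RHS]c0.
  by apply: eq_bigr => j _; rewrite mxE rows_nth.
by move=> /rowP/(_ i); rewrite !mxE.
Qed.

Lemma dim_span_rows A : row_free A -> \dim <<rows A>> == k.
Proof. by rewrite -free_rows /free size_tuple. Qed.

(* V is only a default value, for A not of full rank. *)
Definition gsp V A : Gr := insubd V <<rows A>>%VS.

Lemma val_gsp V A : row_free A -> val (gsp V A) = <<rows A>>%VS.
Proof. by move=> fA; rewrite val_insubd dim_span_rows. Qed.

Lemma mem_gsp V A v : row_free A -> (v \in val (gsp V A)) = (v <= A)%MS.
Proof. by move=> fA; rewrite val_gsp // mem_span_rows. Qed.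

Lemma Gr_ext V V' : (forall v, (v \in val V) = (v \in val V')) -> V = V'.
Proof. by move=> h; apply: val_inj; apply/vspaceP. Qed.

Lemma frame_exists V : exists A, row_free A && (<<rows A>>%VS == val V).
Proof.
have dV : \dim (val V) = k by exact/eqP/(valP V).
pose A : 'M[R]_(k, n) := \matrix_i (vbasis (val V))`_i.
have rA : rows A = vbasis (val V) :> seq _.
  apply: (@eq_from_nth _ 0); first by rewrite !size_tuple dV.
  move=> i; rewrite size_tuple => ik; rewrite (rows_nth A (Ordinal ik)).
  by apply/rowP => j; rewrite !mxE.
exists A; rewrite -free_rows rA (basis_free (vbasisP _)) /=.
by apply/eqP; exact: (span_basis (vbasisP _)).
Qed.

Definition frame V : 'M[R]_(k, n) := xchoose (frame_exists V).

Lemma frame_free V : row_free (frame V).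
Proof. by have /andP[] := xchooseP (frame_exists V). Qed.

Lemma mem_frame V v : (v \in val V) = (v <= frame V)%MS.
Proof.
by have /andP[_ /eqP <-] := xchooseP (frame_exists V); rewrite mem_span_rows.
Qed.

Lemma gsp_frame V V' : gsp V' (frame V) = V.
Proof.
by apply: Gr_ext => v; rewrite mem_gsp ?frame_free // mem_frame.
Qed.

Lemma gsp_eqmx V V' A B : row_free A -> row_free B -> (A :=: B)%MS ->
  gsp V A = gsp V' B.
Proof. by move=> fA fB AB; apply: Gr_ext => v; rewrite !mem_gsp // AB. Qed.

Lemma gsp_default V V' A : row_free A -> gsp V A = gsp V' A.
Proof. by move=> fA; exact: gsp_eqmx. Qed.

Lemma gsp_unit V V' A (P : 'M[R]_k) : row_free A -> P \in unitmx ->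
  gsp V (P *m A) = gsp V' A.
Proof.
move=> fA uP; have e : (P *m A :=: A)%MS by apply: eqmxMfull; rewrite row_full_unit.
by apply: gsp_eqmx => //; rewrite -row_leq_rank e row_leq_rank.
Qed.

Lemma gsp_inj V V' A B : row_free A -> row_free B -> gsp V A = gsp V' B ->
  exists2 P : 'M[R]_k, P \in unitmx & A = P *m B.
Proof.
move=> fA fB e; have sAB : (A <= B)%MS.
  apply/row_subP => i; rewrite -(mem_gsp V' _ fB) -e mem_gsp //; exact: row_sub.
have /submxP[P AP] := sAB; exists P => //.
rewrite -row_free_unit -row_leq_rank; move: fA; rewrite AP -row_leq_rank => h.
exact: leq_trans h (mxrankM_maxl _ _).
Qed.

Lemma frame_gsp V A : row_free A ->
  exists2 P : 'M[R]_k, P \in unitmx & frame (gsp V A) = P *m A.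
Proof.
move=> fA; apply: (@gsp_inj V V) => //; first exact: frame_free.
by rewrite gsp_frame.
Qed.

Lemma row_freeMunit A (g : 'M[R]_n) : g \in unitmx -> row_free (A *m g) = row_free A.
Proof.
move=> ug; rewrite -!row_leq_rank mxrankMfree //.
by rewrite row_free_unit.
Qed.

Definition act (g : 'M[R]_n) V : Gr := gsp V (frame V *m g).

Lemma act_gsp (g : 'M[R]_n) V V' A : g \in unitmx -> row_free A ->
  act g (gsp V A) = gsp V' (A *m g).
Proof.
move=> ug fA; rewrite /act; have [P uP ->] := frame_gsp V fA.
by rewrite -mulmxA; apply: gsp_unit => //; rewrite row_freeMunit.
Qed.

Lemma mem_act (g : 'M[R]_n) V v : g \in unitmx ->
  (v *m g \in val (act g V)) = (v \in val V).
Proof.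
move=> ug; rewrite mem_gsp ?row_freeMunit ?frame_free // mem_frame.
apply/idP/idP => [/submxP[D e]|/submxP[D ->]]; last by rewrite -mulmxA submxMl.
by rewrite -[v](mulmxK ug) e -!mulmxA mulmxV // mulmx1 submxMl.
Qed.

Lemma act_mul (g h : 'M[R]_n) V : g \in unitmx -> h \in unitmx ->
  act h (act g V) = act (g *m h) V.
Proof.
by move=> ug uh; rewrite [act g V]/act (act_gsp V V) ?row_freeMunit ?frame_free // /act mulmxA.
Qed.

Lemma act1 V : act 1%:M V = V.
Proof. by rewrite /act mulmx1 gsp_frame. Qed.

Lemma span_frame_gsp V (A : @frames R k n) : span_frame A = gsp V (val A).
Proof.
have fA : row_free (val A) by rewrite -free_rows; exact: (valS A).
by apply: val_inj; rewrite val_gsp.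
Qed.

Lemma frames_row_free (A : @frames R k n) : row_free (val A).
Proof. by rewrite -free_rows; exact: (valS A). Qed.

Lemma span_frame_continuous : continuous (@span_frame R k n).
Proof.
apply/continuousP => U oU; exact: oU.
Qed.

Lemma gsp_continuous (Y : topologicalType) V (F : Y -> 'M[R]_(k, n)) y :
  (forall z, row_free (F z)) -> {for y, continuous F} ->
  {for y, continuous (fun z => gsp V (F z))}.
Proof.
move=> fF Fc; have hF z : free (rows (F z)) by rewrite free_rows.
pose F' z : @frames R k n := @mkS _ (@frames R k n) (F z) (hF z).
rewrite (_ : (fun z => _) = @span_frame R k n \o F'); last first.
  by apply/funext => z /=; rewrite (span_frame_gsp V).
apply: continuous_comp; last exact: span_frame_continuous.
exact: continuous_at_sub.
Qed.

(** In the quotient topology a set is open when its preimage among frames is. Openness of [U] is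
    proved along with continuity because [h] is controlled only on [U]. *)
Lemma Gr_continuous (Z : topologicalType) (h : Gr -> Z) (U : set Gr) :
  (forall A : @frames R k n, U (span_frame A) ->
     nbhs A (@span_frame R k n @^-1` U) /\
     {for A, continuous (h \o @span_frame R k n)}) ->
  forall V, U V -> nbhs V U /\ {for V, continuous h}.
Proof.
move=> H V UV.
have op (O : set Z) : open O -> open (U `&` h @^-1` O : set Gr).
  move=> oO; change (open (@span_frame R k n @^-1` (U `&` h @^-1` O))).
  rewrite openE => A [/= UA OA]; have [h1 h2] := H A UA.
  apply: filterI => //; apply: h2; exact: open_nbhs_nbhs.
split.
  apply: open_nbhs_nbhs; split=> //; have := op setT openT.
  by rewrite preimage_setT setIT.
move=> S; rewrite nbhsE => -[S' [oS' hV] S'S].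
have : nbhs V (U `&` h @^-1` S') by apply: open_nbhs_nbhs; split=> //; exact: op.
by apply: filterS => W [_ /= /S'S].
Qed.

Lemma flagP (m : nat) v :
  reflect (forall j : 'I_n, (m <= j)%N -> v 0 j = 0) (v \in flag R n m).
Proof.
apply: (iffP idP) => [h j mj|h].
  rewrite (coord_span (X := in_tuple _) h) summxE big1 // => i _; rewrite mxE.
  set X := [seq _ | _ <- _]; have iX : (i < size X)%N by [].
  have /mapP[l] := mem_nth 0 iX; rewrite mem_filter => /andP[lm _] ->.
  rewrite mxE eqxx /=; case: eqP => [jl|_]; last by rewrite mulr0.
  by move: lm; rewrite -jl ltnNge mj.
rewrite (row_sum_delta v); apply: memv_suml => j _.
have [mj|jm] := leqP m j; first by rewrite h // scale0r mem0v.
by apply/memvZ/memv_span/mapP; exists j => //; rewrite mem_filter jm mem_enum.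
Qed.

Definition lead v (i : 'I_n) := v 0 i != 0 /\ forall j : 'I_n, (i < j)%N -> v 0 j = 0.

Lemma lead_exists v : v != 0 -> exists i, lead v i.
Proof.
move=> v0; have [i0 vi0] : exists i, v 0 i != 0.
  apply/existsP; apply: contraNT v0 => /existsPn h.
  by apply/eqP/rowP => i; rewrite mxE; apply/eqP; have := h i; rewrite negbK.
have [i vi max] := @arg_maxnP _ i0 (fun i => v 0 i != 0) (fun i => val i) vi0.
exists i; split=> // j ij; apply/eqP; apply: contraTT ij => /max h.
by rewrite -leqNgt.
Qed.

(** Written as in [schubert_cell], so that lying in the cell of w is by definition an equation on
    [piv V]. *)
Definition piv V : {set 'I_n} :=
  [set i : 'I_n | (\dim (val V :&: flag R n i) < \dim (val V :&: flag R n i.+1))%N]%SET.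

Lemma flagS_sub V (i : nat) : (val V :&: flag R n i <= val V :&: flag R n i.+1)%VS.
Proof.
apply: capvS => //; apply/subvP => v /flagP h; apply/flagP => j ij.
exact/h/ltnW.
Qed.

Lemma pivP V i : reflect (exists2 v, v \in val V & lead v i) (i \in piv V).
Proof.
rewrite inE; apply: (iffP idP) => [h|[v vV [vi vl]]].
  have /subvPn[v] : ~~ (val V :&: flag R n i.+1 <= val V :&: flag R n i)%VS.
    by apply: contraTN h => /dimvS; rewrite leqNgt.
  rewrite !memv_cap => /andP[vV /flagP v1] /nandP[|v2]; first by rewrite vV.
  exists v => //; split=> [|j ij]; last exact: v1.
  apply: contra v2 => /eqP vi; apply/flagP => j; rewrite leq_eqVlt => /orP[/eqP ij|/v1 //].
  by rewrite -(val_inj ij).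
rewrite ltn_neqAle dimvS ?flagS_sub // andbT; apply/negP => /eqP e.
have /vspaceP/(_ v) : (val V :&: flag R n i = val V :&: flag R n i.+1)%VS.
  by apply/eqP; rewrite eqEdim flagS_sub e leqnn.
rewrite !memv_cap vV /=.
have -> : v \in flag R n i.+1 by apply/flagP => j /vl.
by move/flagP/(_ i (leqnn _)) => e'; rewrite e' eqxx in vi.
Qed.

(** The smaller intersection is the kernel of one linear form, the i-th coordinate, on the larger
    one. *)
Lemma dim_flagS V (i : 'I_n) :
  (\dim (val V :&: flag R n i.+1) <= (\dim (val V :&: flag R n i)).+1)%N.
Proof.
have s : (val V :&: flag R n i.+1 :&: lker (linfun (mulmxr (delta_mx i ord0 : 'cV[R]_n))) <=
    val V :&: flag R n i)%VS.
  apply/subvP => v; rewrite !memv_cap memv_ker lfunE /= => /andP[/andP[vV /flagP vf] /eqP v0].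
  rewrite vV; apply/flagP => j; rewrite leq_eqVlt => /orP[/eqP ij|/vf //].
  have : (v *m (delta_mx i ord0 : 'cV[R]_n)) 0 0 = 0 by rewrite v0 mxE.
  rewrite mxE (bigD1 i) //= mxE !eqxx mulr1 big1 ?addr0.
    by rewrite -(val_inj ij).
  by move=> l li; rewrite mxE (negbTE li) mulr0.
set f := linfun _ in s.
have := limg_ker_dim f (val V :&: flag R n i.+1); have := dimvS s.
have : (\dim (f @: (val V :&: flag R n i.+1)) <= 1)%N.
  by apply: leq_trans (dimvS (subvf _)) _; rewrite dimvf /dim /= muln1.
move=> h1 h2 e; have := leq_add h2 h1; rewrite e => h.
by apply: leq_trans h _; rewrite addn1.
Qed.

Lemma dim_flag0 V : \dim (val V :&: flag R n 0) = 0%N.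
Proof.
apply/eqP; rewrite dimv_eq0 -subv0; apply/subvP => v; rewrite memv_cap => /andP[_ /flagP h].
by rewrite memv0; apply/eqP/rowP => j; rewrite h // mxE.
Qed.

Lemma dim_flag_n V : \dim (val V :&: flag R n n) = k.
Proof.
rewrite (capv_idPl _); first exact/eqP/(valP V).
by apply/subvP => v _; apply/flagP => j; rewrite leqNgt ltn_ord.
Qed.

Lemma card_below (P : {set 'I_n}) (i : 'I_n) :
  #|[set j in P | (j < i.+1)%N]%SET| = (#|[set j in P | (j < i)%N]%SET| + (i \in P))%N.
Proof.
have [iP|iP] := boolP (i \in P); last first.
  rewrite addn0; congr #|pred_of_set _|; apply/setP => j; rewrite !inE ltnS leq_eqVlt.
  by have [/val_inj ->|_] := eqVneq (val j) i; rewrite ?(negbTE iP).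
transitivity #|(i |: [set j in P | (j < i)%N])%SET|; last first.
  by rewrite cardsU1 !inE ltnn andbF addnC.
congr #|pred_of_set _|; apply/setP => j; rewrite !inE ltnS leq_eqVlt.
have [->|ji] := eqVneq j i; first by rewrite iP eqxx.
by rewrite -[val j == i]/(j == i) (negbTE ji).
Qed.

Lemma dim_flagE V m : (m <= n)%N ->
  \dim (val V :&: flag R n m) = #|[set i in piv V | (i < m)%N]%SET|.
Proof.
elim: m => [_|m IH mn].
  by rewrite dim_flag0; apply/esym/eqP; rewrite cards_eq0; apply/eqP/setP => i; rewrite !inE ltn0 andbF.
pose i := Ordinal mn.
rewrite (card_below (piv V) i) -IH ?(ltnW mn) //.
have := dim_flagS V i; have := dimvS (flagS_sub V m).
have -> : (i \in piv V) = (\dim (val V :&: flag R n m) < \dim (val V :&: flag R n m.+1))%N.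
  by rewrite inE.
by rewrite /=; case: ltnP => /=; lia.
Qed.

Lemma card_piv V : #|piv V| = k.
Proof.
rewrite -(dim_flag_n V) dim_flagE //; congr #|pred_of_set _|.
by apply/setP => i; rewrite !inE ltn_ord andbT.
Qed.

End GrassmannBasics.

(** * Affine charts and the trivializations over them *)

Section Charts.
Variables (R : realType) (k n : nat) (L : local_system R (Gr R k n)).
Local Notation Gr := (Gr R k n).
Local Notation I := (unit_itv R).
Implicit Types (A : 'M[R]_(k, n)) (E : 'M[R]_(n, k)) (V : Gr).

(* The normalized frame M of V with M *m E = 1, or 0 if there is none. *)
Definition chart_mx E A : 'M[R]_(k, n) :=
  (\det (A *m E))^-1 *: (\adj (A *m E) *m A).

Definition chart E V : 'M[R]_(k, n) := chart_mx E (frame V).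

Definition chart_dom E : set Gr := [set V | \det (frame V *m E) != 0].

Lemma chart_mxM E A (P : 'M[R]_k) : P \in unitmx ->
  chart_mx E (P *m A) = chart_mx E A.
Proof.
move=> uP; rewrite /chart_mx -mulmxA det_mulmx.
have [->|d0] := eqVneq (\det (A *m E)) 0; first by rewrite mulr0 invr0 !scale0r.
have uAE : A *m E \in unitmx by rewrite unitmxE unitfE.
have uPAE : P *m (A *m E) \in unitmx by rewrite unitmx_mul uP.
have adjE (B : 'M[R]_k) : B \in unitmx -> \adj B = \det B *: invmx B.
  by move=> uB; rewrite /invmx uB scalerA mulrV ?scale1r // -unitmxE.
rewrite !adjE // -!scalemxAl !scalerA det_mulmx mulVr ?scale1r; last first.
  by rewrite unitrM -!unitmxE uP.
rewrite mulVr -?unitmxE // scale1r [LHS]mulmxA; congr (_ *m A).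
by rewrite -[LHS](mulmxK uAE) -[X in X *m _]mulmxA mulVmx // mul1mx.
Qed.

Lemma chart_gsp E V A : row_free A -> chart E (gsp V A) = chart_mx E A.
Proof.
by move=> fA; rewrite /chart; have [P uP ->] := frame_gsp V fA; rewrite chart_mxM.
Qed.

Lemma chart_dom_gsp E V A : row_free A ->
  chart_dom E (gsp V A) <-> \det (A *m E) != 0.
Proof.
move=> fA; rewrite /chart_dom /=; have [P uP ->] := frame_gsp V fA.
by rewrite -mulmxA det_mulmx mulf_eq0 negb_or; move: uP; rewrite unitmxE unitfE => ->.
Qed.

Lemma row_free_right_inv A (E : 'M[R]_(n, k)) : A *m E \in unitmx -> row_free A.
Proof.
rewrite -row_free_unit -!row_leq_rank => h; exact: leq_trans h (mxrankM_maxl _ _).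
Qed.

Lemma chart_mxE E A : \det (A *m E) != 0 ->
  chart_mx E A *m E = 1%:M /\ exists2 P : 'M[R]_k, P \in unitmx & chart_mx E A = P *m A.
Proof.
move=> d0; have uAE : A *m E \in unitmx by rewrite unitmxE unitfE.
have e : chart_mx E A = invmx (A *m E) *m A.
  by rewrite /chart_mx /invmx uAE -scalemxAl.
by rewrite e -mulmxA mulVmx //; split=> //; exists (invmx (A *m E)); rewrite ?unitmx_inv.
Qed.

Lemma chartK E V V' : chart_dom E V ->
  [/\ chart E V *m E = 1%:M, row_free (chart E V) & gsp V' (chart E V) = V].
Proof.
move=> /= d0; rewrite /chart; have [e [P uP eP]] := chart_mxE d0.
split=> //; first by apply: (@row_free_right_inv _ E); rewrite e unitmx1.
by rewrite eP (gsp_unit V' V') ?frame_free // gsp_frame.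
Qed.

Lemma chart_id E A : A *m E = 1%:M -> chart_mx E A = A.
Proof. by move=> e; rewrite /chart_mx e det1 invr1 scale1r adj1 mul1mx. Qed.

Lemma chart_mx_continuous E A : \det (A *m E) != 0 ->
  {for A, continuous (chart_mx E)}.
Proof.
move=> d0; apply: continuous_at_mx => i j.
have mc : {for A, continuous (fun B : 'M[R]_(k, n) => B *m E)}.
  by apply: continuous_mulmx; [exact: cvg_id|exact: cont_cst].
rewrite (_ : (fun z => _) = fun B : 'M[R]_(k, n) =>
    (\det (B *m E))^-1 * \sum_l (\adj (B *m E)) i l * B l j); last first.
  by apply/funext => B; rewrite !mxE.
apply: cont_mul; first by apply: cont_inv => //; exact: continuous_det.
apply: cont_sum => l _; apply: cont_mul; last exact: coord_continuous.
rewrite (_ : (fun z => _) = fun B : 'M[R]_(k, n) =>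
    (-1) ^+ (l + i) * \det (row' l (col' i (B *m E)))); last first.
  by apply/funext => B; rewrite mxE.
apply: cont_mul; first exact: cont_cst.
apply: continuous_det; apply: continuous_at_mx => a b.
rewrite (_ : (fun z => _) = fun B : 'M[R]_(k, n) => (B *m E) (lift l a) (lift i b)).
  exact: continuous_entry.
by apply/funext => B; rewrite !mxE.
Qed.

Lemma nbhs_det_neq0 (Y : topologicalType) (f : Y -> R) y : {for y, continuous f} ->
  f y != 0 -> nbhs y [set z | f z != 0].
Proof.
move=> fc fy0; have : nbhs (f y) [set z : R | z != 0].
  by apply: open_nbhs_nbhs; split=> //; exact: open_neq0.
exact: fc.
Qed.

Lemma chart_dom_nbhs E (A : @frames R k n) : chart_dom E (span_frame A) ->
  nbhs A (@span_frame R k n @^-1` chart_dom E).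
Proof.
have domE (B : @frames R k n) : chart_dom E (span_frame B) <-> \det (val B *m E) != 0.
  by rewrite (span_frame_gsp (span_frame A)) chart_dom_gsp //; exact: frames_row_free.
have vc : {for A, continuous (fun B : @frames R k n => val B)}.
  exact: continuous_set_val.
move=> dA; have : nbhs A [set B : @frames R k n | \det (val B *m E) != 0].
  apply: nbhs_det_neq0; last exact/domE.
  by apply: continuous_det; apply: continuous_mulmx => //; exact: cont_cst.
by apply: filterS => B /domE.
Qed.

Lemma chart_continuous E V : chart_dom E V -> {for V, continuous (chart E)}.
Proof.
move=> dV; suff h : forall V, chart_dom E V -> nbhs V (chart_dom E) /\
    {for V, continuous (chart E)} by have [] := h V dV.
apply: Gr_continuous => A dA; split; first exact: chart_dom_nbhs.
have vc : {for A, continuous (fun B : @frames R k n => val B)}.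
  exact: continuous_set_val.
rewrite (_ : _ \o _ = chart_mx E \o (fun B : @frames R k n => val B)).
  have h2 : {for val A, continuous (chart_mx E)}.
    apply: chart_mx_continuous; have fA := frames_row_free A.
    by move: dA; rewrite (span_frame_gsp V) chart_dom_gsp.
  exact: (@continuous_comp _ _ _ (fun B : @frames R k n => val B) (chart_mx E) A vc h2).
apply/funext => B /=; rewrite (span_frame_gsp V) chart_gsp //; exact: frames_row_free.
Qed.

Definition chart_sol E : set 'M[R]_(k, n) := [set M | M *m E = 1%:M].

Lemma chart_sol_convex E x y (t : R) : chart_sol E x -> chart_sol E y -> 0 <= t <= 1 ->
  chart_sol E ((1 - t) *: x + t *: y).
Proof.
move=> hx hy _; rewrite /chart_sol /= mulmxDl -!scalemxAl hx hy -scalerDl subrK.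
by rewrite scale1r.
Qed.

Lemma chart_sol_free E M : chart_sol E M -> row_free M.
Proof. by move=> h; apply: (@row_free_right_inv _ E); rewrite h unitmx1. Qed.

Lemma chart_sol_gsp E M V : chart_sol E M -> chart_dom E (gsp V M) /\ chart E (gsp V M) = M.
Proof.
move=> h; have fM := chart_sol_free h; rewrite chart_gsp // chart_id //.
by split=> //; apply/chart_dom_gsp => //; rewrite h det1 oner_neq0.
Qed.

Lemma gsp_sol_continuous E V : continuous (fun M : chart_sol E => gsp V (val M)).
Proof.
move=> M; apply: gsp_continuous; last exact: continuous_set_val.
by move=> N; exact: chart_sol_free (valS N).
Qed.

(** Transport from the point of [M0] to [V] along the segment in the affine space of normalized
    frames; 1 is a default off the chart. *)
Definition chart_triv E (M0 : chart_sol E) V : int :=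
  if pselect (chart_sol E (chart E V)) is left h then
    L ((fun M : chart_sol E => gsp V (val M)) \o
       segK (@chart_sol_convex E) M0 (mkS h))
  else 1.

Lemma chart_trivE E (M0 : chart_sol E) (M : chart_sol E) V V' : gsp V (val M) = V' ->
  chart_triv M0 V' =
  L ((fun M : chart_sol E => gsp V (val M)) \o segK (@chart_sol_convex E) M0 M).
Proof.
move=> <-; have hM := valS M; have [d e] := chart_sol_gsp V hM.
rewrite /chart_triv; case: pselect; last by rewrite e.
move=> h; congr (L _); apply/funext => t /=.
rewrite [chart E _](e : _ = sval M).
by apply: gsp_default; exact: (chart_sol_free (valS (segK (@chart_sol_convex E) M0 M t))).
Qed.

Lemma chart_triv_pm E (M0 : chart_sol E) V : chart_triv M0 V = 1 \/ chart_triv M0 V = -1.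
Proof.
rewrite /chart_triv; case: pselect => [h|_]; last by left.
apply: transport_pm; apply: continuous_compose; first exact: segK_continuous.
exact: gsp_sol_continuous.
Qed.

Lemma chart_triv_path E (M0 : chart_sol E) (p : I -> Gr) : continuous p ->
  range p `<=` chart_dom E ->
  L p * chart_triv M0 (p (I0 R)) = chart_triv M0 (p (I1 R)).
Proof.
move=> pc pU; have Up t : chart_dom E (p t) by apply: pU; exists t.
have h t : chart_sol E (chart E (p t)) by have [] := chartK (p t) (Up t).
pose q t : chart_sol E := mkS (h t).
have qc : continuous q.
  apply: continuous_sub => t /=.
  by apply: (@continuous_comp _ _ _ p (chart E)); [exact: pc|exact: chart_continuous].
pose V0 := p (I0 R).
have eq t : gsp V0 (val (q t)) = p t by have [] := chartK V0 (Up t).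
rewrite (chart_trivE M0 (eq (I0 R))) (chart_trivE M0 (eq (I1 R))).
have -> : p = (fun M : chart_sol E => gsp V0 (val M)) \o q.
  by apply/funext => t /=; rewrite eq.
symmetry; apply: (@transport_triangle _ _ L _ _ (@chart_sol_convex E)) => //.
- exact: gsp_sol_continuous.
- exact: segK_continuous.
- exact: segK_continuous.
- by rewrite !segK0.
- by rewrite segK1.
- by rewrite segK1.
Qed.

End Charts.

(** * Bott-Samelson cubes *)

Section PivotSets.
Variable n : nat.
Implicit Types P J : {set 'I_n}.

Definition wt P : nat := \sum_(p in P) p.

Definition below P (m : nat) : nat := #|[set p in P | (p < m)%N]%SET|.

(* The Bruhat order on k-subsets. *)
Definition lepiv J J' : Prop := forall m, (below J' m <= below J m)%N.

Lemma belowS P (i : 'I_n) : below P i.+1 = (below P i + (i \in P))%N.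
Proof. exact: card_below. Qed.

Lemma sum_below P : (\sum_(m < n.+1) below P m + wt P = #|P| * n)%N.
Proof.
have -> : (\sum_(m < n.+1) below P m = \sum_(p in P) (n - p))%N.
  transitivity (\sum_(m < n.+1) \sum_(p in P) (p < m : nat))%N.
    apply: eq_bigr => m _; rewrite /below -sum1_card.
    rewrite (eq_bigl (fun p => (p \in P) && (p < m)%N)); last by move=> p; rewrite !inE.
    by rewrite big_mkcondr; apply: eq_bigr => p _; case: ifP.
  rewrite exchange_big; apply: eq_bigr => p _ /=.
  transitivity (\sum_(0 <= m < n.+1) (p < m : nat))%N; first by rewrite big_mkord.
  rewrite (big_cat_nat _ (n := p.+1)) //=; last by rewrite ltnS ltnW.
  rewrite big_nat big1 ?add0n; last by move=> m /andP[_ mp]; rewrite ltnNge -ltnS mp.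
  rewrite big_nat (eq_bigr (fun=> 1%N)); last by move=> m /andP[-> _].
  by rewrite -big_nat sum_nat_const_nat muln1 subSS.
rewrite -big_split /= (eq_bigr (fun=> n)) ?sum_nat_const // => p _.
by rewrite subnK // ltnW.
Qed.

Lemma lepiv_wt J J' : #|J| = #|J'| -> lepiv J J' -> (wt J <= wt J')%N.
Proof.
move=> c h; have := sum_below J; have := sum_below J'; rewrite c => <-.
have : (\sum_(m < n.+1) below J' m <= \sum_(m < n.+1) below J m)%N.
  by apply: leq_sum => m _; exact: h.
lia.
Qed.

Lemma lepiv_eq J J' : #|J| = #|J'| -> lepiv J J' -> wt J = wt J' -> J = J'.
Proof.
move=> c h w; have e m : (m <= n)%N -> below J m = below J' m.
  move=> mn; apply/eqP; rewrite eq_sym eqn_leq h /= leqNgt; apply/negP => lt.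
  have : (\sum_(m < n.+1) below J' m < \sum_(m < n.+1) below J m)%N.
    rewrite [X in (X < _)%N](bigD1 (Ordinal (mn : (m < n.+1)%N))) //=.
    rewrite [X in (_ < X)%N](bigD1 (Ordinal (mn : (m < n.+1)%N))) //=.
    by rewrite -addSn leq_add // leq_sum // => l _; exact: h.
  have := sum_below J; have := sum_below J'; rewrite c w => <-; lia.
apply/setP => i; have := belowS J i; have := belowS J' i.
rewrite !e ?(ltnW (ltn_ord i)) // => -> /addnI.
by case: (i \in J); case: (i \in J').
Qed.

Section Swap.
Variables i j : 'I_n.
Hypothesis ij : j = i.+1 :> nat.

Lemma swap_neq : i != j.
Proof. by apply/eqP => e; move: ij; rewrite e; lia. Qed.

Definition swp P : {set 'I_n} := [set p | tperm i j p \in P]%SET.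

Lemma mem_swp P p : (p \in swp P) = (tperm i j p \in P).
Proof. by rewrite inE. Qed.

Lemma swpK P : swp (swp P) = P.
Proof. by apply/setP => p; rewrite !inE tpermK. Qed.

Lemma card_swp P : #|swp P| = #|P|.
Proof. exact: (card_preimset _ (@perm_inj _ (tperm i j))). Qed.

Lemma tperm_lt p m : m != j :> nat -> (tperm i j p < m)%N = (p < m)%N.
Proof. by move=> mj; case: tpermP => [->|->|//]; lia. Qed.

Lemma below_swp P m : m != j :> nat -> below (swp P) m = below P m.
Proof.
move=> mj; rewrite /below -[RHS](card_preimset _ (@perm_inj _ (tperm i j))).
by congr #|pred_of_set _|; apply/setP => p; rewrite !inE tperm_lt.
Qed.

(** The lifting property of the Bruhat order. The swap changes [below] at j only, and for [swp J]
    its value there drops to [below J i]. *)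
Lemma lepiv_swp J1 J : lepiv J1 J -> i \in J -> j \notin J ->
  lepiv J1 (swp J) /\ lepiv (swp J1) (swp J).
Proof.
move=> h iJ jJ.
have hj : below (swp J) j = below J i.
  rewrite ij belowS mem_swp tpermL (negbTE jJ) addn0 below_swp //.
  by rewrite ij; lia.
have mono P : (below P i <= below P j)%N by rewrite ij belowS leq_addr.
have ii : (i : nat) != j by rewrite ij; lia.
split=> m; have [->|mj] := eqVneq m j.
- by rewrite hj; apply: leq_trans (h i) _; exact: mono.
- by rewrite below_swp.
- by rewrite hj; apply: leq_trans (h i) _; rewrite -(below_swp _ ii); exact: mono.
- by rewrite !below_swp.
Qed.

Lemma wtE P : wt P = (wt (P :\ i :\ j) + (i \in P) * i + (j \in P) * j)%N.
Proof.
have D Q (a : 'I_n) : wt Q = (wt (Q :\ a) + (a \in Q) * a)%N.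
  have [aQ|aQ] := boolP (a \in Q); first by rewrite /wt (big_setD1 a) //= mul1n addnC.
  rewrite mul0n addn0; congr (wt _); apply/setP => p; rewrite !inE.
  by case: eqP => // ->; rewrite (negbTE aQ).
rewrite (D _ i) (D _ j) !inE eq_sym swap_neq /=; lia.
Qed.

Lemma swp_D P : swp P :\ i :\ j = P :\ i :\ j.
Proof.
apply/setP => p; rewrite !inE.
by have [//|pj] := eqVneq p j; have [//|pi] := eqVneq p i; rewrite tpermD // eq_sym.
Qed.

Lemma wt_swp P : (wt (swp P) + (i \in P) * i + (j \in P) * j =
  wt P + (i \in P) * j + (j \in P) * i)%N.
Proof.
rewrite (wtE (swp P)) (wtE P) swp_D !mem_swp tpermL tpermR.
by case: (i \in P); case: (j \in P); rewrite ?mul1n ?mul0n; lia. Qed.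

Lemma wt_swp_le P : (wt (swp P) <= (wt P).+1)%N.
Proof. have := wt_swp P; rewrite ij; case: (i \in P); case: (j \in P); lia. Qed.

Lemma wt_swp_up P : i \in P -> j \notin P -> wt (swp P) = (wt P).+1.
Proof. by move=> iP /negbTE jP; have := wt_swp P; rewrite iP jP ij; lia. Qed.

Lemma swap_cases P P' : #|P| = #|P'| ->
  (forall p, p != i -> p != j -> (p \in P) = (p \in P')) -> P' = P \/ P' = swp P.
Proof.
move=> c h.
have D (Q : {set 'I_n}) : #|Q| = ((i \in Q) + ((j \in Q) + #|Q :\ i :\ j|))%N.
  by rewrite (cardsD1 i) (cardsD1 j) !inE eq_sym swap_neq.
have e : P :\ i :\ j = P' :\ i :\ j.
  apply/setP => p; rewrite !inE; have [//|pj] := eqVneq p j.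
  by have [//|pi] := eqVneq p i; rewrite h.
move: c; rewrite D [in RHS]D e !addnA => /addIn c.
have [ei|ei] := eqVneq (i \in P) (i \in P').
  left; apply/setP => p; have [->|pi] := eqVneq p i; first by rewrite ei.
  have [->|pj] := eqVneq p j; last by rewrite h.
  by move: c; rewrite ei => /addnI; case: (j \in P); case: (j \in P').
right; apply/setP => p; rewrite mem_swp; case: tpermP => [->|->|/eqP pi /eqP pj].
- by move: c ei; case: (i \in P); case: (i \in P'); case: (j \in P); case: (j \in P').
- by move: c ei; case: (i \in P); case: (i \in P'); case: (j \in P); case: (j \in P').
- by rewrite h.
Qed.

End Swap.

Definition sg (eps : 'I_n -> bool) (p : 'I_n) : int := (-1) ^+ eps p.

(** These pairs index the free entries of a reduced echelon frame with pivots J, that is the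
    coordinates of the cell. *)
Definition invset J (x : 'I_n * 'I_n) : bool :=
  [&& x.1 \in J, x.2 \notin J & (x.2 < x.1)%N].

(* The determinant of the sign change eps on the cell of J. *)
Definition cellsgn J eps : int := \prod_(x | invset J x) (sg eps x.1 * sg eps x.2).

(** The transposition carries the inversions of J to those of [swp i j J] other than (j, i), which
    is new. *)
Lemma cellsgn_swp J eps (i j : 'I_n) : j = i.+1 :> nat -> i \in J -> j \notin J ->
  cellsgn (swp i j J) eps = sg eps i * sg eps j * cellsgn J (eps \o tperm i j).
Proof.
move=> ij iJ jJ; rewrite /cellsgn.
have ti : injective (fun x : 'I_n * 'I_n => (tperm i j x.1, tperm i j x.2)).
  by move=> [a b] [c d] [] /perm_inj -> /perm_inj ->.
rewrite (reindex_inj ti) /= (bigD1 (i, j)) /=; last first.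
  by rewrite /invset /= !mem_swp !tpermK tpermL tpermR iJ jJ ij ltnSn.
rewrite tpermL tpermR [sg eps j * _]mulrC; congr (_ * _); apply: eq_bigl => -[a b].
rewrite /invset /= !mem_swp !tpermK xpair_eqE.
have [aJ|] /= := boolP (a \in J); last by [].
have [bJ|bJ] /= := boolP (b \in J); first by [].
case: (tpermP i j a) => [ai|aj|/eqP ai /eqP aj].
- rewrite ai eqxx /=; case: (tpermP i j b) => [bi|bj|/eqP bi /eqP bj].
  + by move: bJ; rewrite bi iJ.
  + by rewrite bj eqxx /= andbF; apply/esym/negbTE; rewrite ij; lia.
  + rewrite bj andbT; have := bi; have := bj; rewrite -!val_eqE /=; lia.
- by move: jJ; rewrite -aj aJ.
- rewrite (negbTE ai) /= andbT; case: (tpermP i j b) => [bi|->|//].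
  + by move: bJ; rewrite bi iJ.
  + by move: ai aj; rewrite -!val_eqE /=; lia.
Qed.

End PivotSets.

(** * Half turns and sign changes *)

Section PlaneMatrices.
Variables (R : realType) (n : nat) (i j : 'I_n).
Hypothesis ij : j = i.+1 :> nat.
Implicit Types (v : 'rV[R]_n).

Let nij : i != j. Proof. exact: swap_neq. Qed.

Lemma eq_mulmx_row (A B : 'M[R]_n) : (forall v, v *m A = v *m B) -> A = B.
Proof. by move=> h; apply/row_matrixP => r; rewrite !rowE h. Qed.

Definition pl (a b c d : R) : 'M[R]_n := \matrix_(r, s)
  if r == i then (if s == i then a else if s == j then b else 0)
  else if r == j then (if s == i then c else if s == j then d else 0)
  else (r == s)%:R.

Lemma mul_pl v a b c d s : (v *m pl a b c d) 0 s =
  if s == i then v 0 i * a + v 0 j * c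
  else if s == j then v 0 i * b + v 0 j * d else v 0 s.
Proof.
rewrite mxE (bigD1 i) // (bigD1 j) /=; last by rewrite eq_sym nij.
rewrite !mxE !eqxx [j == i]eq_sym (negbTE nij) /=.
have rest : \sum_(r < n | (r != i) && (r != j)) v 0 r * pl a b c d r s =
    if (s == i) || (s == j) then 0 else v 0 s.
  transitivity (\sum_(r < n | (r != i) && (r != j)) v 0 r * (r == s)%:R).
    by apply: eq_bigr => r /andP[ri rj]; rewrite mxE (negbTE ri) (negbTE rj).
  have [|ns] := boolP ((s == i) || (s == j)).
    move=> sij; rewrite big1 // => r /andP[ri rj].
    have [rs|_] := eqVneq r s; last by rewrite mulr0.
    by move: sij; rewrite -rs (negbTE ri) (negbTE rj).
  rewrite (bigD1 s) /=; last by rewrite -negb_or.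
  rewrite eqxx mulr1 big1 ?addr0 // => r /andP[_ rs].
  by rewrite (negbTE rs) mulr0.
rewrite rest; case: (s == i) => /=; first by rewrite addr0.
by case: (s == j) => /=; rewrite ?addr0 // !mulr0 !add0r.
Qed.

Lemma pl_mul a b c d a' b' c' d' : pl a b c d *m pl a' b' c' d' =
  pl (a * a' + b * c') (a * b' + b * d') (c * a' + d * c') (c * b' + d * d').
Proof.
apply: eq_mulmx_row => v; apply/rowP => s; rewrite mulmxA !mul_pl eqxx.
rewrite [j == i]eq_sym (negbTE nij) eqxx; case: (s == i); first by ring.
by case: (s == j); first by ring.
Qed.

Lemma pl1 : pl 1 0 0 1 = 1%:M.
Proof.
apply: eq_mulmx_row => v; apply/rowP => s; rewrite mul_pl mulmx1.
case: eqP => [->|_]; first by ring.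
by case: eqP => [->|_]; first by ring.
Qed.

Lemma pl_unit a b c d : a * d - b * c != 0 -> pl a b c d \in unitmx.
Proof.
move=> D0; pose D := a * d - b * c.
have /mulmx1_unit[] // : pl a b c d *m pl (d / D) (- b / D) (- c / D) (a / D) = 1%:M.
by rewrite pl_mul -pl1; congr pl; rewrite /D; field.
Qed.

Lemma lead_pl v a b c d p : p != i -> p != j -> lead v p -> lead (v *m pl a b c d) p.
Proof.
rewrite -!val_eqE /= => pi pj [vp vl]; split.
  by rewrite mul_pl -!val_eqE /= (negbTE pi) (negbTE pj).
move=> q pq; rewrite mul_pl.
case: eqP => [qi|_]; first by rewrite !vl ?mul0r ?addr0 //; move: pq; rewrite ?qi ?ij; lia.
case: eqP => [qj|_]; last exact: vl.
have pi' : (p < i)%N by move: pq; rewrite qj ij; lia.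
by rewrite !vl ?mul0r ?addr0 // ij; lia.
Qed.

(** The matrix and its inverse preserve leading positions other than i and j; as both pivot sets
    have k elements, [swap_cases] leaves two possibilities. *)
Lemma piv_pl k (V : Gr R k n) a b c d : a * d - b * c != 0 ->
  piv (act (pl a b c d) V) = piv V \/ piv (act (pl a b c d) V) = swp i j (piv V).
Proof.
move=> D0; have u := pl_unit D0.
apply: swap_cases => //; first by rewrite !card_piv.
pose D := a * d - b * c.
have inv : pl a b c d *m pl (d / D) (- b / D) (- c / D) (a / D) = 1%:M.
  by rewrite pl_mul -pl1; congr pl; rewrite /D; field.
move=> p pi pj; apply/pivP/pivP => -[v vV vp].
  by exists (v *m pl a b c d); [rewrite mem_act|exact: lead_pl].
exists (v *m pl (d / D) (- b / D) (- c / D) (a / D)); last exact: lead_pl.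
rewrite -(mem_act _ _ u) -mulmxA; have [_ u'] := mulmx1_unit inv.
by rewrite (mulmx1C inv) mulmx1.
Qed.

(** With [ds], a piecewise linear substitute for the cosine and sine of pi t: the pair runs through
    the upper half of the l^1 unit circle from (1, 0) to (-1, 0). *)
Definition dc (t : R) : R := 1 - 2 * t.
Definition ds (t : R) : R := 2 * Num.min t (1 - t).

Lemma dc_half t : 0 <= t <= 1 -> [/\ 0 <= ds t, `|dc t| + ds t = 1 & dc t ^+ 2 + ds t ^+ 2 != 0].
Proof.
move=> /andP[t0 t1]; rewrite /dc /ds.
have [h|h] := leP t (1 - t).
  rewrite ger0_norm; last by lra.
  split; [lra|lra|rewrite gt_eqF //; nra].
rewrite ler0_norm; last by lra.
split; [lra|lra|rewrite gt_eqF //; nra].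
Qed.

Lemma ds_gt0 t : 0 < t < 1 -> 0 < ds t.
Proof. by move=> /andP[t0 t1]; rewrite /ds mulr_gt0 // lt_min t0 /=; lra. Qed.

Lemma dsC t : ds (1 - t) = ds t.
Proof. by rewrite /ds minC; congr (2 * Num.min _ _); lra. Qed.

Definition rot t := pl (dc t) (ds t) (- ds t) (dc t).

Lemma rot_unit t : 0 <= t <= 1 -> rot t \in unitmx.
Proof.
move=> /dc_half[_ _ h]; apply: pl_unit; apply: contraNneq h => h; apply/eqP.
by rewrite -[RHS]h; ring.
Qed.

(* The inverse of [rot t] as a function of the quotient dc t / ds t. *)
Definition unrot (x : R) :=
  let c := x / (`|x| + 1) in let s := (`|x| + 1)^-1 in let q := c ^+ 2 + s ^+ 2 in
  pl (c / q) (- s / q) (s / q) (c / q).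

Lemma unrot_q (x : R) : (x / (`|x| + 1)) ^+ 2 + (`|x| + 1)^-1 ^+ 2 != 0.
Proof.
have h : 0 < `|x| + 1 by have := normr_ge0 x; lra.
rewrite gt_eqF // ltr_wpDl ?sqr_ge0 // exprn_gt0 // invr_gt0 //.
Qed.

Lemma unrot_unit x : unrot x \in unitmx.
Proof.
rewrite /unrot; move: (unrot_q x); move: ((`|x| + 1)^-1) => s q0.
apply: pl_unit; rewrite (_ : _ - _ = ((x * s) ^+ 2 + s ^+ 2)^-1); first exact: invr_neq0.
by field.
Qed.

Lemma piv_rot k (V : Gr R k n) t : 0 <= t <= 1 ->
  piv (act (rot t) V) = piv V \/ piv (act (rot t) V) = swp i j (piv V).
Proof.
move=> /dc_half[_ _ h]; apply: piv_pl; apply: contraNneq h => h.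
by apply/eqP; rewrite -[RHS]h; ring.
Qed.

Lemma continuous_pl (Y : topologicalType) (a b c d : Y -> R) y :
  {for y, continuous a} -> {for y, continuous b} -> {for y, continuous c} ->
  {for y, continuous d} -> {for y, continuous (fun z => pl (a z) (b z) (c z) (d z))}.
Proof.
move=> ac bc cc dc; apply: continuous_at_mx => r s.
rewrite (_ : (fun z => _) = fun z =>
  if r == i then (if s == i then a z else if s == j then b z else 0)
  else if r == j then (if s == i then c z else if s == j then d z else 0)
  else (r == s)%:R); last by apply/funext => z; rewrite mxE.
by case: (r == i); [|case: (r == j)]; try (case: (s == i); [|case: (s == j)]) => //;
  exact: cont_cst.
Qed.

Lemma continuous_rot (Y : topologicalType) (f : Y -> R) y :
  {for y, continuous f} -> {for y, continuous (fun z => rot (f z))}.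
Proof.
move=> fc.
have dcc : {for y, continuous (fun z => dc (f z))}.
  apply: cont_add; first exact: cont_cst.
  by apply: cont_opp; apply: cont_mul => //; exact: cont_cst.
have dsc : {for y, continuous (fun z => ds (f z))}.
  apply: cont_mul; first exact: cont_cst.
  apply: continuous_minr => //; apply: cont_add; first exact: cont_cst.
  exact: cont_opp.
by apply: continuous_pl => //; exact: cont_opp.
Qed.

Lemma continuous_unrot (Y : topologicalType) (f : Y -> R) y :
  {for y, continuous f} -> {for y, continuous (fun z => unrot (f z))}.
Proof.
move=> fc; have h : `|f y| + 1 != 0 by rewrite gt_eqF //; have := normr_ge0 (f y); lra.
have sc : {for y, continuous (fun z => (`|f z| + 1)^-1)}.
  apply: cont_inv => //; apply: cont_add; last exact: cont_cst.
  exact: cont_norm.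
have cc : {for y, continuous (fun z => f z / (`|f z| + 1))} by exact: cont_mul.
have qc : {for y, continuous (fun z =>
    ((f z / (`|f z| + 1)) ^+ 2 + (`|f z| + 1)^-1 ^+ 2)^-1)}.
  apply: cont_inv; first exact: unrot_q.
  by apply: cont_add; [exact: (cont_mul cc cc)|exact: (cont_mul sc sc)].
by apply: continuous_pl; apply: cont_mul => //; exact: cont_opp.
Qed.

Lemma piv_unrot k (V : Gr R k n) x :
  piv (act (unrot x) V) = piv V \/ piv (act (unrot x) V) = swp i j (piv V).
Proof.
apply: piv_pl; move: (unrot_q x); move: ((`|x| + 1)^-1) => s q0.
rewrite (_ : _ - _ = ((x * s) ^+ 2 + s ^+ 2)^-1); first exact: invr_neq0.
by field.
Qed.

Lemma rot_unrot t : 0 < t < 1 -> rot t *m unrot (dc t / ds t) = 1%:M.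
Proof.
move=> ht; have s0 := ds_gt0 ht; have [|_ cs q0] := @dc_half t; first by lra.
have s1 : ds t != 0 by rewrite gt_eqF.
have e : `|dc t / ds t| + 1 = (ds t)^-1.
  rewrite normrM (gtr0_norm (x := _^-1)) ?invr_gt0 //.
  rewrite -[X in _ + X](divff s1) -mulrDl cs mul1r //.
rewrite /rot /unrot e invrK divfK // pl_mul -pl1.
by congr pl; field.
Qed.

Lemma unrot_rot x : exists2 t, 0 < t < 1 & dc t / ds t = x.
Proof.
have h : 0 < `|x| + 1 by have := normr_ge0 x; lra.
(* The point of the upper l^1 half circle with quotient x has first coordinate x / (|x| + 1), and t
   solves [dc t] equal to this. *)
exists ((1 - x / (`|x| + 1)) / 2).
  have : - 1 < x / (`|x| + 1) < 1.
    rewrite ltr_pdivlMr // ltr_pdivrMr //; have := ler_norm x; have := ler_norm (- x).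
    by rewrite normrN; lra.
  by lra.
have e : dc ((1 - x / (`|x| + 1)) / 2) = x / (`|x| + 1) by rewrite /dc; field; rewrite gt_eqF.
suff e' : ds ((1 - x / (`|x| + 1)) / 2) = (`|x| + 1)^-1.
  by rewrite e e'; field; rewrite ?gt_eqF // invr_neq0 ?gt_eqF.
rewrite /ds; have [x0|x0] := leP 0 x.
  rewrite min_l ?ger0_norm //; first by field; have := ler_norm x; rewrite ger0_norm // gt_eqF; lra.
  have : 0 <= x / (`|x| + 1) by rewrite divr_ge0 // ltW.
  by rewrite ger0_norm //; lra.
rewrite min_r ?ltr0_norm //; first by field; rewrite gt_eqF; lra.
have : x / (`|x| + 1) < 0 by rewrite pmulr_llt0 // invr_gt0.
by rewrite ltr0_norm //; lra.
Qed.

Definition sgmx (eps : 'I_n -> bool) : 'M[R]_n := diag_mx (\row_p (-1) ^+ eps p).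

Lemma mul_sgmx v eps s : (v *m sgmx eps) 0 s = v 0 s * (-1) ^+ eps s.
Proof. by rewrite mul_mx_diag !mxE. Qed.

Lemma sgmx_unit eps : sgmx eps \in unitmx.
Proof.
have /mulmx1_unit[] // : sgmx eps *m sgmx eps = 1%:M.
apply: eq_mulmx_row => v; apply/rowP => s; rewrite mulmxA mulmx1 !mul_sgmx.
by rewrite -mulrA -signr_addb addbb mulr1.
Qed.

(** Opposite signs at i and j reverse the sense of the half turn; this is what reflects the new cube
    variable in [step_flip]. *)
Lemma rot_sgmx t eps : rot t *m sgmx eps =
  sgmx (eps \o tperm i j) *m rot (if eps i == eps j then t else 1 - t).
Proof.
apply: eq_mulmx_row => v; apply/rowP => s.
rewrite !mulmxA mul_sgmx !mul_pl !mul_sgmx /= tpermL tpermR.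
have dcN : dc (1 - t) = - dc t by rewrite /dc; ring.
have [->|si] := eqVneq s i.
  by case: (eps i); case: (eps j); rewrite /= ?dcN ?dsC ?expr0 ?expr1; ring.
have [->|sj] := eqVneq s j.
  by case: (eps i); case: (eps j); rewrite /= ?dcN ?dsC ?expr0 ?expr1; ring.
by rewrite tpermD // eq_sym.
Qed.

Lemma piv_sgmx k (V : Gr R k n) eps : piv (act (sgmx eps) V) = piv V.
Proof.
have ss : sgmx eps *m sgmx eps = 1%:M.
  apply: eq_mulmx_row => v; apply/rowP => s; rewrite mulmxA mulmx1 !mul_sgmx.
  by rewrite -mulrA -signr_addb addbb mulr1.
have l v p : lead v p -> lead (v *m sgmx eps) p.
  move=> [vp vl]; split; first by rewrite mul_sgmx mulf_neq0 // signr_eq0.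
  by move=> q pq; rewrite mul_sgmx vl // mul0r.
apply/setP => p; apply/pivP/pivP => -[v vV vp].
  exists (v *m sgmx eps); last exact: l.
  by rewrite -(mem_act _ _ (sgmx_unit eps)) -mulmxA ss mulmx1.
by exists (v *m sgmx eps); [rewrite mem_act ?sgmx_unit|exact: l].
Qed.

Lemma rot0 : rot 0 = 1%:M.
Proof.
rewrite /rot /dc /ds mulr0 subr0 min_l // mulr0 oppr0; exact: pl1.
Qed.

Lemma rot1 : rot 1 = sgmx (fun p => (p == i) || (p == j)).
Proof.
apply: eq_mulmx_row => v; apply/rowP => s; rewrite mul_pl mul_sgmx.
have -> : dc 1 = -1 by rewrite /dc; ring.
have -> : ds 1 = 0 by rewrite /ds subrr min_r ?mulr0.
have [->|si] := eqVneq s i; first by rewrite expr1; ring.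
have [->|sj] := eqVneq s j; first by rewrite expr1; ring.
by rewrite mulr1.
Qed.

End PlaneMatrices.

(** * Cubes parametrizing the closed cells, by induction on dimension *)

Section CellCubes.
Variables (R : realType) (k n : nat) (V0 : Gr R k n).
Local Notation Gr := (Gr R k n).
Local Notation cube := (cube R).
Local Notation I := (unit_itv R).
Implicit Types (V : Gr) (J : {set 'I_n}).

Definition cell J : set Gr := [set V | piv V = J].

Definition is_coord J V := forall v, v \in val V <-> forall p, p \notin J -> v 0 p = 0.

Definition interior d (t : cube d) := forall l, 0 < val t 0 l < 1.

Lemma flip_subproof d (r : nat -> bool) (t : cube d) l :
  0 <= (\row_l (if r (l : 'I_d) then 1 - val t 0 l else val t 0 l) : 'rV[R]_d) 0 l <= 1.
Proof. by rewrite mxE; move: (cubeP t l); case: (r l) => /andP[? ?]; lra. Qed.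

Definition flip d (r : nat -> bool) (t : cube d) : cube d := mkcube (flip_subproof r t).

Lemma flipE d r (t : cube d) l :
  val (flip r t) 0 l = if r l then 1 - val t 0 l else val t 0 l.
Proof. by rewrite mxE. Qed.

(** The data carried through the induction. [cc_coord] matters on the cell only and by its sign
    only: it tells on which side of 1/2 the cube variable lies, decreasing when the variable crosses
    1/2. With [cc_onto], the center is then the only point of the cell where all coordinates vanish.
    [cc_flip] computes the determinant of a sign change as a product of reflections of cube
    variables. *)
Record cellcube (J : {set 'I_n}) (d : nat) := CellCube {
  cc_mx : cube d -> 'M[R]_(k, n);
  cc_coord : nat -> Gr -> R;
  cc_free : forall t : cube d, row_free (cc_mx t);
  cc_cont : continuous cc_mx;
  cc_boundary : forall t : cube d, (exists l, val t 0 l = 0 \/ val t 0 l = 1) ->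
    (wt (piv (gsp V0 (cc_mx t))) < wt J)%N;
  cc_below : forall t : cube d, lepiv (piv (gsp V0 (cc_mx t))) J;
  cc_interior : forall t : cube d, interior t -> cell J (gsp V0 (cc_mx t));
  cc_onto : forall V, cell J V -> exists2 t : cube d, interior t & gsp V0 (cc_mx t) = V;
  cc_coord_cont : forall V l, cell J V -> (l < d)%N -> {for V, continuous (cc_coord l)};
  cc_sign : forall (t : cube d) (l : 'I_d), interior t ->
    (0 < cc_coord l (gsp V0 (cc_mx t))) = (val t 0 l < 2^-1) /\
    (cc_coord l (gsp V0 (cc_mx t)) = 0 -> val t 0 l = 2^-1);
  cc_center : is_coord J (gsp V0 (cc_mx (center R d)));
  cc_flip : forall eps, exists r : nat -> bool,
    (forall t : cube d, act (sgmx R eps) (gsp V0 (cc_mx t)) = gsp V0 (cc_mx (flip r t))) /\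
    \prod_(l < d) (if r l then -1 else 1) = cellsgn J eps
}.

Lemma is_coord_unique J V V' : is_coord J V -> is_coord J V' -> V = V'.
Proof.
move=> h h'; apply: Gr_ext => v; apply/idP/idP.
  by move=> /(h v) hv; apply/(h' v).
by move=> /(h' v) hv; apply/(h v).
Qed.

Definition selmx J (hJ : #|J| = k) : 'M[R]_(n, k) :=
  \matrix_(p, a) (p == enum_val (cast_ord (esym hJ) a))%:R.

Lemma mul_selmx J (hJ : #|J| = k) m (A : 'M[R]_(m, n)) b a :
  (A *m selmx hJ) b a = A b (enum_val (cast_ord (esym hJ) a)).
Proof.
rewrite mxE (bigD1 (enum_val (cast_ord (esym hJ) a))) //= mxE eqxx mulr1 big1 ?addr0 //.
by move=> p pa; rewrite mxE (negbTE pa) mulr0.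
Qed.

Lemma selP J (hJ : #|J| = k) p : p \in J ->
  exists a, p = enum_val (cast_ord (esym hJ) a).
Proof.
move=> pJ; exists (cast_ord hJ (enum_rank_in pJ p)).
by rewrite cast_ordK enum_rankK_in.
Qed.

Lemma mul_selmx0 J (hJ : #|J| = k) (v : 'rV[R]_n) :
  v *m selmx hJ = 0 <-> forall p, p \in J -> v 0 p = 0.
Proof.
split=> [/rowP h p pJ|h].
  by have [a ->] := selP hJ pJ; rewrite -(mul_selmx hJ) h mxE.
by apply/rowP => a; rewrite mul_selmx mxE; apply: h; exact: enum_valP.
Qed.

Lemma selmx_tr J (hJ : #|J| = k) : (selmx hJ)^T *m selmx hJ = 1%:M.
Proof.
apply/matrixP => a b; rewrite mul_selmx !mxE.
by rewrite (inj_eq enum_val_inj) (inj_eq (@cast_ord_inj _ _ _)) eq_sym.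
Qed.

Lemma chart_domP J (hJ : #|J| = k) V : chart_dom (selmx hJ) V <->
  forall v, v \in val V -> (forall p, p \in J -> v 0 p = 0) -> v = 0.
Proof.
split=> [d v vV vJ|h].
  move: vV; rewrite mem_frame => /submxP[D vD].
  have u : frame V *m selmx hJ \in unitmx by rewrite unitmxE unitfE.
  have : v *m selmx hJ = 0 by apply/mul_selmx0.
  rewrite vD -mulmxA => e; have /(congr1 (fun x => x *m invmx (frame V *m selmx hJ))) := e.
  by rewrite mulmxK // mul0mx => ->; rewrite mul0mx.
rewrite /chart_dom /= -unitfE -unitmxE -row_free_unit -kermx_eq0.
apply/eqP/row_matrixP => a; rewrite row0.
have : row a (kermx (frame V *m selmx hJ)) *m frame V = 0.
  apply: h; first by rewrite mem_frame submxMl.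
  by apply/(mul_selmx0 hJ); rewrite -mulmxA -row_mul mulmx_ker row0.
by move=> e; apply: (row_free_inj (frame_free V)); rewrite e mul0mx.
Qed.

(** The last nonzero entry of a nonzero vector of V is at a pivot, so the vector cannot vanish on
    J. *)
Lemma cell_chart_dom J (hJ : #|J| = k) V : cell J V -> chart_dom (selmx hJ) V.
Proof.
move=> pV; apply/chart_domP => v vV vJ; apply/eqP; apply: contraT => /lead_exists[p vp].
have pP : p \in piv V by apply/pivP; exists v.
by move: vp => [+ _]; rewrite vJ ?eqxx // -pV.
Qed.

(** Projection to the coordinates in J is injective on V and sends the m-th flag step into a span of
    [below J m] basis vectors. *)
Lemma chart_dom_lepiv J (hJ : #|J| = k) V : chart_dom (selmx hJ) V -> lepiv J (piv V).
Proof.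
move=> /chart_domP dV m.
have [nm|mn] := ltnP n m.
  have e (P : {set 'I_n}) : below P m = #|P|.
    congr #|pred_of_set _|; apply/setP => p; rewrite !inE.
    by rewrite (ltn_trans (ltn_ord p) nm) andbT.
  by rewrite !e card_piv hJ.
rewrite {1}/below -dim_flagE //.
pose B : 'M[R]_n := \matrix_(p, q) ((p == q) && (p \in J))%:R.
have mulB (v : 'rV[R]_n) q : (v *m B) 0 q = if q \in J then v 0 q else 0.
  rewrite mxE (bigD1 q) //= mxE eqxx /= big1 ?addr0.
    by case: (q \in J); rewrite ?mulr1 ?mulr0.
  by move=> p pq; rewrite mxE (negbTE pq) mulr0.
pose f := linfun (mulmxr B : 'rV[R]_n -> 'rV[R]_n).
have ker : (val V :&: flag R n m :&: lker f = 0)%VS.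
  apply/eqP; rewrite -subv0; apply/subvP => v; rewrite !memv_cap memv_ker lfunE /=.
  move=> /andP[/andP[vV _] /eqP vB]; rewrite memv0; apply/eqP; apply: dV => // p pJ.
  by have := mulB v p; rewrite vB pJ mxE.
rewrite -(limg_dim_eq ker).
pose X := [seq (delta_mx 0 p : 'rV[R]_n) | p <- enum [set p in J | (p < m)%N]%SET].
have sub : (f @: (val V :&: flag R n m) <= <<X>>)%VS.
  apply/subvP => _ /memv_imgP[v + ->]; rewrite memv_cap => /andP[_ /flagP vf].
  rewrite lfunE /= (row_sum_delta (v *m B)); apply: memv_suml => p _; rewrite mulB.
  have [pJ|_] := ifP; last by rewrite scale0r mem0v.
  have [pm|pm] := ltnP p m; last by rewrite vf // scale0r mem0v.
  by apply/memvZ/memv_span/mapP; exists p => //; rewrite mem_enum !inE pJ.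
apply: leq_trans (dimvS sub) _; apply: leq_trans (dim_span X) _.
by rewrite size_map -cardE.
Qed.

(** A set above J in the Bruhat order and of no larger weight is J. So the chart cuts exactly the
    cell out of its skeleton, which makes the cell open there. *)
Lemma chart_dom_cell J (hJ : #|J| = k) V : (wt (piv V) <= wt J)%N ->
  chart_dom (selmx hJ) V -> cell J V.
Proof.
move=> w /chart_dom_lepiv h; have c : #|J| = #|piv V| by rewrite card_piv.
apply/esym/lepiv_eq => //; apply/eqP; rewrite eqn_leq w andbT; exact: lepiv_wt.
Qed.

Section Step.
Variables (i j : 'I_n).
Hypothesis ij : j = i.+1 :> nat.
Variable J : {set 'I_n}.
Hypothesis iJ : i \in J.
Hypothesis jJ : j \notin J.
Hypothesis hJ' : #|swp i j J| = k.

Let J' := swp i j J.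

Let jJ' : j \in J'. Proof. by rewrite mem_swp tpermR. Qed.
Let iJ' : i \notin J'. Proof. by rewrite mem_swp tpermL. Qed.

Lemma slope_exists : exists a, j == enum_val (cast_ord (esym hJ') a).
Proof. by have [a e] := selP hJ' jJ'; exists a; apply/eqP. Qed.

(* For V in the cell of J', the quotient v_i / v_j of any v in V whose last
   nonzero entry is v_j. *)
Definition slope V : R := chart (selmx hJ') V (xchoose slope_exists) i.

Lemma slopeE V v : cell J' V -> v \in val V -> lead v j -> slope V = v 0 i / v 0 j.
Proof.
move=> VJ vV [vj vl]; rewrite /slope; set a := xchoose _.
have ja : j = enum_val (cast_ord (esym hJ') a) by exact/eqP/(xchooseP slope_exists).
have dV := cell_chart_dom hJ' VJ.
have [e fC gC] := chartK V dV.
pose u := row a (chart (selmx hJ') V).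
have uV : u \in val V by rewrite -gC mem_gsp // row_sub.
have uE b : u 0 (enum_val (cast_ord (esym hJ') b)) = (a == b)%:R.
  by rewrite mxE -mul_selmx e mxE.
pose z := (v 0 j)^-1 *: v - u.
have zE p : z 0 p = (v 0 j)^-1 * v 0 p - u 0 p.
  by rewrite /z mxE [X in X + _]mxE [X in _ + X]mxE.
have zV : z \in val V by rewrite memvB // memvZ.
have zj p : p \in J' -> (j <= p)%N -> z 0 p = 0.
  move=> pJ'; have [b pb] := selP hJ' pJ'.
  rewrite zE {3}pb uE.
  have [ab|ab] := eqVneq a b; first by rewrite pb -ab -ja mulVf // subrr.
  rewrite subr0 leq_eqVlt => /orP[/eqP/val_inj jp|/vl ->]; last by rewrite mulr0.
  by move: ab; rewrite -(inj_eq (@cast_ord_inj _ _ (esym hJ'))) -(inj_eq enum_val_inj) -ja -pb jp eqxx.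
(* The difference [z] lies in V and vanishes at every pivot from j on, so its leading position is a
   pivot before j. It is not i, which is no pivot, so it is before i; the i-th entries therefore
   agree. *)
have z0 (p : 'I_n) : (i <= p)%N -> z 0 p = 0.
  move=> ip; have [->|zn] := eqVneq z 0; first by rewrite mxE.
  have [q [zq ql]] := lead_exists zn.
  have qJ' : q \in J' by rewrite -VJ; apply/pivP; exists z.
  have qj : (q < j)%N by rewrite ltnNge; apply: contra zq => h; rewrite zj.
  apply: ql; apply: leq_trans ip; rewrite ltn_neqAle -ltnS -ij qj andbT.
  by apply: contraNneq iJ' => /val_inj <-.
have := z0 i (leqnn _); rewrite zE => /eqP; rewrite subr_eq0 => /eqP.
by rewrite mulrC => ->; rewrite [RHS]mxE.
Qed.

Lemma slope_continuous V : chart_dom (selmx hJ') V -> {for V, continuous slope}.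
Proof.
move=> /chart_continuous h.
exact: (@continuous_entry _ _ _ _ (chart (selmx hJ')) (xchoose slope_exists) i V h).
Qed.

(** The vector with leading position i turns into one with leading position j, since [ds t] is
    nonzero away from the ends; its last two entries give the slope. *)
Lemma act_rot_cell V t : cell J V -> 0 < t < 1 ->
  cell J' (act (rot i j t) V) /\ slope (act (rot i j t) V) = dc t / ds t.
Proof.
move=> VJ ht; have ur : rot i j t \in unitmx by apply: (rot_unit ij); lra.
have /pivP[v vV [vi vl]] : i \in piv V by rewrite VJ.
have s0 : ds t != 0 by rewrite gt_eqF // ds_gt0.
have vj : v 0 j = 0 by apply: vl; rewrite ij.
have nij := swap_neq ij; have nji : (j == i) = false by rewrite eq_sym (negbTE nij).
have ew : forall s, (v *m rot i j t) 0 s = if s == i then v 0 i * dc t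
    else if s == j then v 0 i * ds t else v 0 s.
  by move=> s; rewrite (mul_pl ij) vj !mul0r !addr0.
have lw : lead (v *m rot i j t) j.
  split; first by rewrite ew nji eqxx mulf_neq0.
  move=> q jq; rewrite ew; case: eqP => [qi|_]; first by move: jq; rewrite qi ij ltnNge leqnSn.
  case: eqP => [qj|_]; first by move: jq; rewrite qj ltnn.
  by apply: vl; apply: ltn_trans jq; rewrite ij.
have wV : v *m rot i j t \in val (act (rot i j t) V) by rewrite mem_act.
have c : cell J' (act (rot i j t) V).
  have [|e|//] := @piv_pl R n i j ij k V (dc t) (ds t) (- ds t) (dc t).
  - have [|_ _ h] := @dc_half R t; first by lra.
    apply: contraNneq h => h; apply/eqP; rewrite -[RHS]h; ring.
  - have : j \in piv (act (rot i j t) V) by apply/pivP; exists (v *m rot i j t).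
    by rewrite e VJ (negbTE jJ).
  - by rewrite /cell /= => ->; rewrite VJ.
split=> //; rewrite (slopeE c wV lw) !ew eqxx nji eqxx.
by rewrite -mulf_div divff // mul1r.
Qed.

Lemma act_unrot_cell V : cell J' V -> cell J (act (unrot i j (slope V)) V).
Proof.
move=> VJ; have uu := unrot_unit ij (slope V).
have [t ht e] := unrot_rot (slope V).
have /pivP[v vV lv] : j \in piv V by rewrite VJ.
have sl := slopeE VJ vV lv; have [vj vl] := lv.
have nij := swap_neq ij; have nji : (j == i) = false by rewrite eq_sym (negbTE nij).
have s0 : ds t != 0 by rewrite gt_eqF // ds_gt0.
have iP : i \in piv (act (unrot i j (slope V)) V).
  apply/pivP; exists (v *m unrot i j (slope V)); first by rewrite mem_act.
  have vi : v 0 i = slope V * v 0 j by rewrite sl divfK.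
  have := unrot_q (slope V); have : (`|slope V| + 1)^-1 != 0.
    by rewrite invr_neq0 // gt_eqF //; have := normr_ge0 (slope V); lra.
  rewrite /unrot; move: ((`|slope V| + 1)^-1) => s sn q0; split.
    rewrite (mul_pl ij) eqxx vi (_ : _ + _ = v 0 j / s); first by rewrite mulf_neq0 ?invr_neq0.
    by field; rewrite sn.
  move=> q iq; rewrite (mul_pl ij).
  case: eqP => [qi|_]; first by move: iq; rewrite qi ltnn.
  case: eqP => [qj|nqj]; first by rewrite vi; field.
  apply: vl; rewrite ltn_neqAle {2}ij iq andbT.
  by apply/eqP => /val_inj jq; apply: nqj.
have [e'|e'] := piv_unrot ij V (slope V); last by rewrite /cell /= e' VJ swpK.
by move: iP; rewrite e' VJ (negbTE iJ').
Qed.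

Variables (d : nat) (c : cellcube J d).

Definition tail (t : cube d.+1) : cube d :=
  mkcube (fun l => (eq_ind_r (fun x => is_true (0 <= x <= 1))
    (cubeP t (lift ord0 l)) (mxE _ (fun _ l => val t 0 (lift ord0 l)) 0 l) :
    0 <= (\row_l val t 0 (lift ord0 l) : 'rV[R]_d) 0 l <= 1)).

Lemma tailE t l : val (tail t) 0 l = val t 0 (lift ord0 l).
Proof. by rewrite mxE. Qed.

Lemma tail_face s x : tail (face ord0 s x) = x.
Proof. by apply: cube_ext => l; rewrite tailE face_lift. Qed.

Definition step_mx (t : cube d.+1) : 'M[R]_(k, n) :=
  cc_mx c (tail t) *m rot i j (val t 0 ord0).

(** The slope determines the half turn that was applied, so the older coordinates are read after
    undoing it. *)
Definition step_coord (l : nat) V : R :=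
  if l is l'.+1 then cc_coord c l' (act (unrot i j (slope V)) V) else slope V.

Let u t := gsp V0 (cc_mx c t).

Lemma step_free t : row_free (step_mx t).
Proof. by rewrite row_freeMunit ?cc_free // (rot_unit ij) // cubeP. Qed.

Lemma step_act t : gsp V0 (step_mx t) = act (rot i j (val t 0 ord0)) (u (tail t)).
Proof. by rewrite (act_gsp V0 V0) ?cc_free // (rot_unit ij) // cubeP. Qed.

Lemma step_cont : continuous step_mx.
Proof.
apply: cont_all => t; apply: continuous_mulmx.
  apply: (@continuous_comp _ _ _ tail (cc_mx c)); last exact: cc_cont.
  apply: continuous_cube => l; rewrite (_ : (fun z => _) = fun z : cube d.+1 =>
    val z 0 (lift ord0 l)); first exact: continuous_coord.
  by apply/funext => z; exact: tailE.
by apply: continuous_rot; exact: continuous_coord.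
Qed.

Let cJ : #|J| = k. Proof. by rewrite -(card_swp i j). Qed.

Let wtJ' : wt J' = (wt J).+1. Proof. exact: wt_swp_up. Qed.

Let u_wt t : (wt (piv (u t)) <= wt J)%N.
Proof. by apply: lepiv_wt; [rewrite card_piv cJ|exact: cc_below]. Qed.

(** At the two ends of the half turn the pivots are those of the smaller cube, of weight at most
    [wt J]. On the other faces the smaller cube is at its boundary, of weight below [wt J], and a
    swap adds at most one. *)
Lemma step_boundary (t : cube d.+1) : (exists l, val t 0 l = 0 \/ val t 0 l = 1) ->
  (wt (piv (gsp V0 (step_mx t))) < wt J')%N.
Proof.
move=> [l]; have [l' ->|->] := unliftP ord0 l => tl; rewrite step_act wtJ' ltnS.
  have h : (wt (piv (u (tail t))) < wt J)%N.
    by apply: cc_boundary; exists l'; rewrite tailE.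
  have [->|->] := piv_rot ij (u (tail t)) (cubeP t ord0); first exact: ltnW.
  exact: leq_trans (wt_swp_le ij _) h.
case: tl => ->; first by rewrite (rot0 R ij) act1.
by rewrite (rot1 R ij) piv_sgmx.
Qed.

Lemma step_below t : lepiv (piv (gsp V0 (step_mx t))) J'.
Proof.
have [h1 h2] := lepiv_swp ij (cc_below c (tail t)) iJ jJ.
by rewrite step_act; have [->|->] := piv_rot ij (u (tail t)) (cubeP t ord0).
Qed.

Let tail_interior t : interior t -> interior (tail t).
Proof. by move=> h l; rewrite tailE. Qed.

Lemma step_interior t : interior t -> cell J' (gsp V0 (step_mx t)).
Proof.
move=> ti; rewrite step_act.
by have [] := act_rot_cell (cc_interior c (tail_interior ti)) (ti ord0).
Qed.

Lemma step_onto V : cell J' V -> exists2 t, interior t & gsp V0 (step_mx t) = V.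
Proof.
move=> VJ; have [t' t'i e'] := cc_onto c (act_unrot_cell VJ).
have [t0 ht e0] := unrot_rot (slope V).
have h0 : 0 <= t0 <= 1 by lra.
exists (face ord0 (mkI h0) t').
  by move=> l; have [l' ->|->] := unliftP ord0 l; rewrite ?face_lift ?face_same.
rewrite step_act face_same tail_face /u e' act_mul ?(unrot_unit ij) //; last first.
  by rewrite (rot_unit ij).
by rewrite -e0 (mulmx1C (rot_unrot ij ht)) act1.
Qed.

Lemma step_sign t (l : 'I_d.+1) : interior t ->
  (0 < step_coord l (gsp V0 (step_mx t))) = (val t 0 l < 2^-1) /\
  (step_coord l (gsp V0 (step_mx t)) = 0 -> val t 0 l = 2^-1).
Proof.
move=> ti; have uJ : cell J (u (tail t)).
  by apply: cc_interior; exact: tail_interior.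
have [_ sl] := act_rot_cell uJ (ti ord0).
have [l' ->|->] := unliftP ord0 l; rewrite step_act /step_coord /= sl.
  rewrite act_mul ?(unrot_unit ij) ?(rot_unit ij) ?cubeP //.
  rewrite (rot_unrot ij (ti ord0)) act1 -tailE.
  by apply: cc_sign; exact: tail_interior.
have s0 := ds_gt0 (ti ord0); split.
  rewrite pmulr_lgt0 ?invr_gt0 // /dc; apply/idP/idP; lra.
move/eqP; rewrite mulf_eq0 invr_eq0 (gt_eqF s0) orbF /dc => /eqP; lra.
Qed.

Lemma unrot_act_continuous V : cell J' V ->
  {for V, continuous (fun W => act (unrot i j (slope W)) W)}.
Proof.
move=> /(cell_chart_dom hJ') dV.
suff h : forall V, chart_dom (selmx hJ') V -> nbhs V (chart_dom (selmx hJ')) /\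
    {for V, continuous (fun W => act (unrot i j (slope W)) W)} by have [] := h V dV.
apply: Gr_continuous => A dA; split; first exact: chart_dom_nbhs.
rewrite (_ : _ \o _ = fun B : @frames R k n =>
  gsp V0 (val B *m unrot i j (slope (span_frame B)))); last first.
  apply/funext => B /=; rewrite (span_frame_gsp V0) (act_gsp V0 V0) ?(unrot_unit ij) //.
  exact: frames_row_free.
apply: gsp_continuous.
  by move=> B; rewrite row_freeMunit ?(unrot_unit ij) //; exact: frames_row_free.
apply: continuous_mulmx; first exact: continuous_set_val.
apply: continuous_unrot.
apply: (@continuous_comp _ _ _ (@span_frame R k n) slope).
  exact: span_frame_continuous.
exact: slope_continuous.
Qed.

Lemma step_coord_cont V l : cell J' V -> (l < d.+1)%N ->
  {for V, continuous (step_coord l)}.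
Proof.
move=> VJ; case: l => [_|l ld].
  by apply: slope_continuous; exact: cell_chart_dom.
apply: (@continuous_comp _ _ _ (fun W => act (unrot i j (slope W)) W) (cc_coord c l)).
  exact: unrot_act_continuous.
by apply: cc_coord_cont => //; exact: act_unrot_cell.
Qed.

Lemma step_center : is_coord J' (gsp V0 (step_mx (center R d.+1))).
Proof.
have ct : tail (center R d.+1) = center R d.
  by apply: cube_ext => l; rewrite tailE !centerE.
rewrite step_act ct centerE => v.
have h01 : 0 <= (2^-1 : R) <= 1 by lra.
have e : rot i j (2^-1 : R) = pl i j 0 1 (-1) 0.
  by rewrite /rot /dc /ds min_l; [congr pl; lra|lra].
have inv : rot i j 2^-1 *m pl i j 0 (-1) 1 0 = 1%:M :> 'M[R]_n.
  by rewrite e (pl_mul ij) -(pl1 R ij); congr pl; ring.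
have ve : v = (v *m pl i j 0 (-1) 1 0) *m rot i j 2^-1.
  by rewrite -mulmxA (mulmx1C inv) mulmx1.
have uc := cc_center c (v *m pl i j 0 (-1) 1 0).
rewrite {1}ve mem_act ?(rot_unit ij) //.
have nij := swap_neq ij; have nji : (j == i) = false by rewrite eq_sym (negbTE nij).
split.
  move=> /uc h p; rewrite mem_swp; case: tpermP => [-> _|->|/eqP pi /eqP pj pJ].
  - by have := h j jJ; rewrite (mul_pl ij) nji eqxx mulr0 addr0 mulrN1 => /eqP; rewrite oppr_eq0 => /eqP.
  - by rewrite iJ.
  - by have := h p pJ; rewrite (mul_pl ij) (negbTE pi) (negbTE pj).
move=> h; apply/uc => p pJ; rewrite (mul_pl ij).
case: eqP => [pi|/eqP pi]; first by rewrite pi iJ in pJ.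
case: eqP => [_|/eqP pj]; last by apply: h; rewrite mem_swp tpermD // eq_sym.
by rewrite (h i iJ') mul0r mulr0 addr0.
Qed.

Lemma step_flip eps : exists r : nat -> bool,
  (forall t, act (sgmx R eps) (gsp V0 (step_mx t)) = gsp V0 (step_mx (flip r t))) /\
  \prod_(l < d.+1) (if r l then -1 else 1) = cellsgn J' eps.
Proof.
have [r [rE rs]] := cc_flip c (eps \o tperm i j).
exists (fun l => if l is l'.+1 then r l' else eps i != eps j); split=> [t|].
  have tf : tail (flip (fun l => if l is l'.+1 then r l' else eps i != eps j) t) =
      flip r (tail t) by apply: cube_ext => l; rewrite tailE !flipE tailE.
  rewrite !step_act tf flipE /= act_mul ?sgmx_unit ?(rot_unit ij) ?cubeP //.
  rewrite (rot_sgmx ij) -act_mul ?sgmx_unit //; last first.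
    by apply: (rot_unit ij); have := cubeP t ord0; case: ifP => _; lra.
  by rewrite /u rE; case: (eps i == eps j).
rewrite big_ord_recl /= rs (cellsgn_swp eps ij iJ jJ); congr (_ * _).
by rewrite /sg; case: (eps i); case: (eps j).
Qed.

Definition cellcube_step : cellcube J' d.+1 :=
  @CellCube J' d.+1 step_mx step_coord step_free step_cont step_boundary step_below
    step_interior step_onto step_coord_cont step_sign step_center step_flip.

End Step.

Lemma is_coord_gsp J (hJ : #|J| = k) : is_coord J (gsp V0 (selmx hJ)^T).
Proof.
have fs : row_free (selmx hJ)^T.
  by apply: (@row_free_right_inv _ _ _ _ (selmx hJ)); rewrite selmx_tr unitmx1.
move=> v; rewrite mem_gsp //; split=> [/submxP[D ->] p pJ|h].
  rewrite mxE big1 // => a _; rewrite !mxE; case: eqP => [e|]; last by rewrite mulr0.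
  by move: pJ; rewrite e enum_valP.
apply/submxP; exists (v *m selmx hJ); apply/rowP => p.
have [pJ|pJ] := boolP (p \in J).
  have [a pa] := selP hJ pJ; rewrite {2}pa.
  by rewrite -(mul_selmx hJ (_ *m _)) -!mulmxA selmx_tr mulmx1 mul_selmx -pa.
rewrite h // mxE big1 // => a _.
rewrite [X in _ * X]mxE [X in _ * X]mxE (_ : (p == _) = false) ?mulr0 //.
by apply/negbTE; apply: contraNneq pJ => ->; exact: enum_valP.
Qed.

Lemma is_coord_piv J V : #|J| = k -> is_coord J V -> piv V = J.
Proof.
move=> hJ h; apply/esym/eqP; rewrite eqEcard card_piv hJ leqnn andbT.
apply/fintype.subsetP => p pJ; apply/pivP; exists (delta_mx 0 p).
  by apply/h => q qJ; rewrite mxE eqxx /=; case: eqP => // qp; rewrite qp pJ in qJ.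
split; first by rewrite mxE !eqxx oner_neq0.
by move=> q pq; rewrite mxE eqxx /=; case: eqP => // qp; rewrite qp ltnn in pq.
Qed.

Lemma is_coord_sgmx J V eps : is_coord J V -> act (sgmx R eps) V = V.
Proof.
move=> h; apply: (is_coord_unique (J := J)) => // v.
have ss : sgmx R eps *m sgmx R eps = 1%:M.
  apply: eq_mulmx_row => w; apply/rowP => s; rewrite mulmxA mulmx1 !mul_sgmx.
  by rewrite -mulrA -signr_addb addbb mulr1.
have ve : v = (v *m sgmx R eps) *m sgmx R eps by rewrite -mulmxA ss mulmx1.
rewrite {1}ve mem_act ?sgmx_unit //; have := h (v *m sgmx R eps); split.
  move=> /H e p /e /eqP; rewrite mul_sgmx mulf_eq0 signr_eq0 orbF => /eqP //.
by move=> e; apply/H => p pJ; rewrite mul_sgmx e // mul0r.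
Qed.

Lemma below_setT m : (m <= n)%N -> below [set: 'I_n] m = m.
Proof.
elim: m => [_|m IH mn].
  by apply/eqP; rewrite cards_eq0; apply/eqP/setP => p; rewrite !inE.
by rewrite (belowS _ (Ordinal mn)) IH ?(ltnW mn) // inE addn1.
Qed.

Let kn : (k <= n)%N.
Proof. by rewrite -(card_piv V0) -[X in (_ <= X)%N](card_ord n) max_card. Qed.

Definition base_set : {set 'I_n} := [set p : 'I_n | (p < k)%N]%SET.

Lemma card_base_set : #|base_set| = k.
Proof.
by rewrite -[RHS](below_setT kn); congr #|pred_of_set _|; apply/setP => p; rewrite !inE.
Qed.

Lemma base_set_le J : #|J| = k -> lepiv base_set J.
Proof.
move=> hJ m; have [mk|km] := leqP m k.
  have -> : below base_set m = m.
    rewrite -[RHS](below_setT (leq_trans mk kn)); congr #|pred_of_set _|.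
    by apply/setP => p; rewrite !inE /=; case: (ltnP p m) => pm; rewrite ?andbF // (leq_trans pm mk).
  rewrite -[X in (_ <= X)%N](below_setT (leq_trans mk kn)).
  by apply: subset_leq_card; apply/fintype.subsetP => p; rewrite !inE => /andP[_ ->].
have -> : below base_set m = k.
  rewrite -[RHS]card_base_set; congr #|pred_of_set _|; apply/setP => p; rewrite !inE.
  by case: ltnP => //= pk; rewrite (ltn_trans pk km).
by rewrite -hJ; apply: subset_leq_card; apply/fintype.subsetP => p; rewrite !inE => /andP[].
Qed.

(** All leading positions are among the first k, so all later entries vanish and the cell is a
    single point. *)
Lemma base_cell V : cell base_set V -> is_coord base_set V.
Proof.
move=> VJ; have h v p : v \in val V -> p \notin base_set -> v 0 p = 0.
  move=> vV pJ; have [->|/lead_exists[q vq]] := eqVneq v 0; first by rewrite mxE.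
  have : q \in piv V by apply/pivP; exists v.
  rewrite VJ inE => qk; apply: vq.2; apply: leq_trans qk _.
  by move: pJ; rewrite inE -leqNgt.
have W := is_coord_gsp card_base_set.
suff -> : V = gsp V0 (selmx card_base_set)^T by [].
apply: val_inj; apply/eqP; rewrite eqEdim.
rewrite (eqP (valP (gsp V0 _))) (eqP (valP V)) leqnn andbT.
by apply/subvP => v vV; apply/(W v) => p; exact: h.
Qed.

Definition cellcube_base : cellcube base_set 0.
Proof.
have fs : row_free (selmx card_base_set)^T.
  by apply: (@row_free_right_inv _ _ _ _ (selmx card_base_set)); rewrite selmx_tr unitmx1.
have W := is_coord_gsp card_base_set; have pW := is_coord_piv card_base_set W.
apply: (@CellCube base_set 0 (fun=> (selmx card_base_set)^T) (fun _ _ => 0)) => //.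
- by apply: cont_all => t; exact: cont_cst.
- by move=> t [[]].
- by move=> t; rewrite pW.
- move=> V VJ; exists (cube0 R 0); first by case.
  exact: is_coord_unique W (base_cell VJ).
- by move=> t [].
- move=> eps; exists (fun=> false); rewrite big_ord0; split.
    by move=> t; exact: is_coord_sgmx W.
  rewrite /cellsgn big_pred0 // => -[p q]; rewrite /invset !inE /=.
  by apply/negP => /and3P[pk qk qp]; move: qk; rewrite (ltn_trans qp pk).
Defined.

(** Otherwise J would contain everything below each of its elements; having an element q >= k, it
    would have more than k elements. *)
Lemma adjacent_exists J : #|J| = k -> J != base_set ->
  exists i j : 'I_n, [/\ j = i.+1 :> nat, j \in J & i \notin J].
Proof.
move=> hJ ne; apply: contrapT => /forallNP h.
have down m q : (q \in J) -> (q - m >= 0)%N -> forall p : 'I_n, (p + m = q)%N -> p \in J.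
  elim: m q => [|m IH] q qJ _ p pq.
    by rewrite (_ : p = q) //; apply: val_inj; rewrite /= -pq addn0.
  have p1n : (p.+1 < n)%N by apply: leq_ltn_trans (ltn_ord q); rewrite -pq; lia.
  have p1J : Ordinal p1n \in J by apply: (IH q) => //=; rewrite -pq; lia.
  apply: contrapT => /negP pJ; have /forallNP /(_ (Ordinal p1n)) := h p; apply.
  by split.
have : ~~ (J \subset base_set).
  by apply: contra ne => s; rewrite eqEcard s card_base_set hJ leqnn.
move=> /subsetPn[q qJ]; rewrite inE -leqNgt => kq.
have : (below [set: 'I_n] q.+1 <= #|J|)%N.
  apply: subset_leq_card; apply/fintype.subsetP => p; rewrite !inE /= ltnS => pq.
  by apply: (down (q - p)%N q) => //; rewrite subnKC.
by rewrite below_setT // hJ ltnNge kq.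
Qed.

Lemma cellcube_exists d J : #|J| = k -> wt J = (wt base_set + d)%N ->
  inhabited (cellcube J d).
Proof.
elim: d J => [|d IH] J hJ wJ.
  rewrite addn0 in wJ; rewrite -(lepiv_eq _ (base_set_le hJ)) ?card_base_set //.
  exact: (inhabits cellcube_base).
have ne : J != base_set by apply/eqP => e; move: wJ; rewrite e; lia.
have [i [j [ij jJ iJ]]] := adjacent_exists hJ ne.
have iS : i \in swp i j J by rewrite mem_swp tpermL.
have jS : j \notin swp i j J by rewrite mem_swp tpermR.
have cS : #|swp i j J| = k by rewrite card_swp.
have [|c] := IH _ cS.
  by have := wt_swp_up ij iS jS; rewrite swpK wJ addnS => -[].
have cJ : #|swp i j (swp i j J)| = k by rewrite swpK.
by have := cellcube_step ij iS jS cJ c; rewrite swpK.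
Qed.

End CellCubes.

(** * Transport around a pencil *)

Section GenericPoints.
Variable R : realType.

Lemma nonroot_exists (qs : seq {poly R}) : (forall q, q \in qs -> q != 0) ->
  exists t : R, forall q, q \in qs -> q.[t] != 0.
Proof.
move=> h; pose p := \prod_(q <- qs) q.
have p0 : p != 0 by rewrite prodf_seq_neq0; apply/allP.
have [t pt] : exists t, p.[t] != 0.
  apply: contrapT => /forallNP all0.
  pose rs := [seq i%:R : R | i <- iota 0 (size p)].
  have : (size rs < size p)%N.
    apply: max_poly_roots => //; last first.
      by rewrite map_inj_uniq ?iota_uniq // => x y /eqP; rewrite eqr_nat => /eqP.
    by apply/allP => x _; apply/rootP; have /negP := all0 x; rewrite negbK => /eqP.
  by rewrite size_map size_iota ltnn.
exists t => q qs_q; apply: contra pt => /eqP qt.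
by rewrite /p horner_prod (big_rem q) //= qt mul0r.
Qed.

Definition rowmix p n (N N' : 'M[R]_(p, n)) (t : 'I_p -> R) : 'M[R]_(p, n) :=
  \matrix_(a, b) ((1 - t a) * N a b + t a * N' a b).

Lemma row_rowmix p n (N N' : 'M[R]_(p, n)) t a :
  row a (rowmix N N' t) = (1 - t a) *: row a N + t a *: row a N'.
Proof. by apply/rowP => j; rewrite !mxE. Qed.

Lemma rowmix_cst p n (N N' : 'M[R]_(p, n)) x :
  rowmix N N' (fun=> x) = (1 - x) *: N + x *: N'.
Proof. by apply/matrixP => a b; rewrite !mxE. Qed.

(* t is affine in the new variable, so the determinant is a polynomial in it. *)
Lemma rowmix_poly p n (N N' : 'M[R]_(p, n)) (E : 'M[R]_(n, p)) (u v : 'I_p -> R) :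
  exists q : {poly R}, forall x,
    q.[x] = \det (rowmix N N' (fun a => u a + x * v a) *m E).
Proof.
pose A : 'M[{poly R}]_p := \matrix_(a, b) \sum_c
  ((1 - ((u a)%:P + 'X * (v a)%:P)) * (N a c)%:P + ((u a)%:P + 'X * (v a)%:P) * (N' a c)%:P) * (E c b)%:P.
exists (\det A) => x.
rewrite -[LHS]/(horner_eval x (\det A)) -det_map_mx; congr (\det _).
apply/matrixP => a b; rewrite !mxE rmorph_sum /=; apply: eq_bigr => c _.
by rewrite /horner_eval !mxE !hornerE.
Qed.

(** The rows go one after another from parameter 0 to a generic x, then one after another from x to
    1. Each intermediate determinant is a polynomial in x, nonzero because it gives det (N E) at 0
    on the first leg and det (N' E) at 1 on the second; so some x avoids all roots. A direct passage
    from 0 to 1 row by row could meet a vanishing determinant. *)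
Lemma row_moves p n (E : 'M[R]_(n, p)) (N N' : 'M[R]_(p, n))
    (rl : 'M[R]_(p, n) -> 'M[R]_(p, n) -> Prop) :
  \det (N *m E) != 0 -> \det (N' *m E) != 0 ->
  (forall A, rl A A) -> (forall A B C, rl A B -> rl B C -> rl A C) ->
  (forall t1 t2 a, (forall b, b != a -> t1 b = t2 b) ->
     \det (rowmix N N' t1 *m E) != 0 -> \det (rowmix N N' t2 *m E) != 0 ->
     rl (rowmix N N' t1) (rowmix N N' t2)) ->
  rl N N'.
Proof.
move=> d0 d1 refl trans step.
have [q1 q1E] : exists q1 : nat -> {poly R}, forall m x, (q1 m).[x] =
    \det (rowmix N N' (fun a => if (a < m)%N then x else 0) *m E).
  have h m : exists q : {poly R}, forall x, q.[x] =
      \det (rowmix N N' (fun a => if (a < m)%N then x else 0) *m E).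
    have [q qE] := rowmix_poly N N' E (fun=> 0) (fun a => if (a < m)%N then 1 else 0).
    exists q => x; rewrite qE; congr (\det (rowmix N N' _ *m E)).
    by apply/funext => a; case: ifP => _; ring.
  by exists (fun m => projT1 (cid (h m))) => m; case: (cid (h m)).
have [q2 q2E] : exists q2 : nat -> {poly R}, forall m x, (q2 m).[x] =
    \det (rowmix N N' (fun a => if (a < m)%N then 1 else x) *m E).
  have h m : exists q : {poly R}, forall x, q.[x] =
      \det (rowmix N N' (fun a => if (a < m)%N then 1 else x) *m E).
    have [q qE] := rowmix_poly N N' E (fun a => if (a < m)%N then 1 else 0)
      (fun a => if (a < m)%N then 0 else 1).
    exists q => x; rewrite qE; congr (\det (rowmix N N' _ *m E)).
    by apply/funext => a; case: ifP => _; ring.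
  by exists (fun m => projT1 (cid (h m))) => m; case: (cid (h m)).
have mix0 : rowmix N N' (fun=> 0) = N by rewrite rowmix_cst subr0 scale1r scale0r addr0.
have mix1 : rowmix N N' (fun=> 1) = N' by rewrite rowmix_cst subrr scale0r scale1r add0r.
have [|x xE] := @nonroot_exists ([seq q1 m | m <- iota 0 p.+1] ++ [seq q2 m | m <- iota 0 p.+1]).
  move=> q; rewrite mem_cat => /orP[] /mapP[m _ ->].
    apply: contraNneq d0 => e; have := q1E m 0; rewrite e horner0 => /esym.
    by rewrite (_ : (fun a => _) = fun=> 0) ?mix0 => [->//|]; apply/funext => a; case: ifP.
  apply: contraNneq d1 => e; have := q2E m 1; rewrite e horner0 => /esym.
  by rewrite (_ : (fun a => _) = fun=> 1) ?mix1 => [->//|]; apply/funext => a; case: ifP.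
have nz1 m : (m <= p)%N -> \det (rowmix N N' (fun a => if (a < m)%N then x else 0) *m E) != 0.
  by move=> mp; rewrite -q1E; apply: xE; rewrite mem_cat map_f // mem_iota ltnS.
have nz2 m : (m <= p)%N -> \det (rowmix N N' (fun a => if (a < m)%N then 1 else x) *m E) != 0.
  by move=> mp; rewrite -q2E; apply: xE; rewrite mem_cat map_f ?orbT // mem_iota ltnS.
have chain (f : nat -> 'I_p -> R) :
    (forall m, (m <= p)%N -> \det (rowmix N N' (f m) *m E) != 0) ->
    (forall (m : nat) (b : 'I_p), m != b :> nat -> f m b = f m.+1 b) ->
    rl (rowmix N N' (f 0%N)) (rowmix N N' (f p)).
  move=> fnz fb; suff H m : (m <= p)%N -> rl (rowmix N N' (f 0%N)) (rowmix N N' (f m)) by exact: H.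
  elim: m => [//|m IH] mp; apply: trans (IH (ltnW mp)) _.
  apply: (step _ _ (Ordinal mp)); [|exact: fnz _ (ltnW mp)|exact: fnz].
  by move=> b bm; apply: fb; rewrite eq_sym.
have a0 (y z : R) : (fun a : 'I_p => if (a < 0)%N then y else z) = fun=> z.
  by apply/funext => a; rewrite ltn0.
have ap (y z : R) : (fun a : 'I_p => if (a < p)%N then y else z) = fun=> y.
  by apply/funext => a; rewrite ltn_ord.
have lt (m : nat) (b : 'I_p) : m != b :> nat -> (b < m)%N = (b < m.+1)%N.
  by move=> mb; rewrite [RHS]ltnS [RHS]leq_eqVlt eq_sym (negbTE mb).
have e1 := chain _ nz1 (fun m b h => congr1 (fun z : bool => if z then x else 0) (lt m b h)).
have e2 := chain _ nz2 (fun m b h => congr1 (fun z : bool => if z then 1 else x) (lt m b h)).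
rewrite (a0 x 0) (ap x 0) mix0 in e1; rewrite (a0 1 x) (ap 1 x) mix1 in e2.
exact: trans e1 e2.
Qed.

Lemma line_generic p n (N N' : 'M[R]_(p, n)) (Es : seq 'M[R]_(n, p)) :
  (forall E, E \in Es -> \det (N *m E) != 0 \/ \det (N' *m E) != 0) ->
  exists x, forall E, E \in Es -> \det (((1 - x) *: N + x *: N') *m E) != 0.
Proof.
move=> h.
have H E : exists q : {poly R}, forall x, q.[x] = \det (((1 - x) *: N + x *: N') *m E).
  have [q qE] := rowmix_poly N N' E (fun=> 0) (fun=> 1); exists q => x.
  by rewrite qE -rowmix_cst; congr (\det (rowmix N N' _ *m E)); apply/funext => a; ring.
pose q E := projT1 (cid (H E)).
have qE E x : (q E).[x] = \det (((1 - x) *: N + x *: N') *m E).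
  by rewrite /q; case: (cid (H E)).
have [|x xE] := @nonroot_exists [seq q E | E <- Es].
  move=> _ /mapP[E EE ->]; apply/eqP => q0; case: (h E EE) => /negP; apply.
    have := qE E 0; rewrite q0 horner0 subr0 scale1r scale0r addr0 => <- //.
  have := qE E 1; rewrite q0 horner0 subrr scale1r scale0r add0r => <- //.
by exists x => E EE; rewrite -qE; apply: xE; exact: map_f.
Qed.

(** A generic point of the line through a right inverse of N and one of N'; transposition turns this
    into [line_generic]. *)
Lemma common_right_chart p n (N N' : 'M[R]_(p, n)) : row_free N -> row_free N' ->
  exists E : 'M[R]_(n, p), \det (N *m E) != 0 /\ \det (N' *m E) != 0.
Proof.
move=> /row_freeP[E1 e1] /row_freeP[E2 e2].
have [|x xE] := @line_generic p n E1^T E2^T [:: N^T; N'^T].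
  move=> E; rewrite !inE => /orP[] /eqP ->; rewrite -!trmx_mul ?e1 ?e2 trmx1 det1.
    by left; exact: oner_neq0.
  by right; exact: oner_neq0.
exists (((1 - x) *: E1^T + x *: E2^T)^T).
have T (A : 'M[R]_(p, n)) : \det (A *m ((1 - x) *: E1^T + x *: E2^T)^T) =
    \det (((1 - x) *: E1^T + x *: E2^T) *m A^T).
  by rewrite -det_tr trmx_mul trmxK.
by rewrite !T; split; apply: xE; rewrite !inE eqxx ?orbT.
Qed.

End GenericPoints.

Section LocalTrivializations.
Variables (R : realType) (T : topologicalType) (L : local_system R T) (g : T -> int).
Local Notation I := (unit_itv R).

(** A path is a 1-cube, which [lebesgue_pieces] cuts into pieces inside the given neighborhoods; the
    relation for the two halves implies it for the whole. *)
Lemma trivialization_glue :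
  (forall x : T, exists2 U : set T, nbhs x U & forall p : I -> T, continuous p -> range p `<=` U ->
     L p * g (p (I0 R)) = g (p (I1 R))) ->
  forall p : I -> T, continuous p -> L p * g (p (I0 R)) = g (p (I1 R)).
Proof.
move=> loc p pc.
pose e (t : I) : cube R 1 := edge ord0 t.
have ec : continuous e by exact: edge_continuous.
pose c (x : cube R 1) : I := mkI (cubeP x ord0).
have cc : continuous c by apply: continuous_sub; exact: continuous_coord.
have ce t : c (e t) = t by apply: val_inj; rewrite -[LHS]/(val (e t) 0 ord0) edgeE eqxx.
pose good (u : cube R 1 -> T) := L (u \o e) * g (u (e (I0 R))) = g (u (e (I1 R))).
have j0 (j : 'I_1) : j == ord0 by rewrite ord1.
have split (u : cube R 1 -> T) : continuous u ->
    (forall h, good (u \o half h)) -> good u.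
  move=> uc hu; have h0 := hu [ffun=> false]; have h1 := hu [ffun=> true]; rewrite /good.
  have hc h : continuous (u \o half h \o e).
    by apply: continuous_compose => //; apply: continuous_compose => //; exact: half_continuous.
  have eh (h : bool) (s t : I) : val s = (val t + h%:R) / 2 -> e s = half [ffun=> h] (e t).
    move=> st; apply: cube_ext => j; by rewrite halfE !edgeE ffunE j0 st.
  have cat : is_concat (u \o half [ffun=> false] \o e) (u \o half [ffun=> true] \o e) (u \o e).
    move=> s t; split=> st; rewrite /comp; congr u.
      by apply: (eh false); rewrite addr0.
    by apply: (eh true); rewrite addrC.
  rewrite (transport_concat L (hc _) (hc _) (continuous_compose ec uc) cat).
  have E0 : e (I0 R) = half [ffun=> false] (e (I0 R)).
    by apply: (eh false); rewrite -[val (I0 R)]/(0 : R) addr0 mul0r.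
  have E1 : e (I1 R) = half [ffun=> true] (e (I1 R)).
    by apply: (eh true); rewrite -[val (I1 R)]/(1 : R) /=; field.
  have Em : half [ffun=> false] (e (I1 R)) = half [ffun=> true] (e (I0 R)).
    apply: cube_ext => j; rewrite !halfE !ffunE !edgeE -[val (I0 R)]/(0 : R) -[val (I1 R)]/(1 : R).
    by rewrite j0 /=; lra.
  move: h0 h1; rewrite /good /comp -E0 -E1 => h0 <-; rewrite -mulrA h0 Em //.
pose small (B : set T) := forall p : I -> T, continuous p -> range p `<=` B ->
  L p * g (p (I0 R)) = g (p (I1 R)).
have [//|x|M hM] := @lebesgue_pieces R T small 1 (p \o c).
- by move=> B B' sub h q qc /subset_trans; move=> /(_ _ sub); exact: h.
- have [U nU hU] := loc ((p \o c) x).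
  exists ((p \o c) @^-1` U); first exact: (continuous_compose cc pc).
  by move=> q qc qs; apply: hU => //; apply: subset_trans qs _; exact: image_preimage_subset.
have {}hM := hM M (leqnn M).
suff : good (p \o c) by rewrite /good /comp !ce (_ : (fun x => p (c (e x))) = p) //; apply/funext => t; rewrite ce.
have : continuous (p \o c) by exact: continuous_compose.
move: (p \o c) hM => u; elim: M u => [|M IH] u hM uc.
  apply: (hM [::]) => //; first exact: (continuous_compose ec uc).
  by move=> _ [t _ <-]; exists (e t).
apply: split => // h; apply: IH; last by apply: continuous_compose => //; exact: half_continuous.
by move=> s sM; apply: (hM (h :: s)); rewrite /= sM.
Qed.

End LocalTrivializations.

(** * Pencils of subspaces: transport -1 for a non-constant system *)

Section Pencils.
Variables (R : realType) (k' n : nat).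
Local Notation k := k'.+1.
Local Notation Gr := (Gr R k n).
Local Notation I := (unit_itv R).
Variables (V0 : Gr) (L : local_system R Gr).
Implicit Types (N : 'M[R]_(k.+1, n)) (A M : 'M[R]_(k, n)).

(** The first row makes a half turn through the last row of N to its own opposite, and the remaining
    rows span the axis of the pencil. The subspace returns to its start, the frame does not. *)
Definition pencil_mx N (t : R) : 'M[R]_(k, n) := \matrix_b
  if b == ord0 then dc t *: row (lift ord_max (ord0 : 'I_k)) N + ds t *: row ord_max N
  else row (lift ord_max b) N.

Lemma pencil_row N t b : row b (pencil_mx N t) =
  if b == ord0 then dc t *: row (lift ord_max (ord0 : 'I_k)) N + ds t *: row ord_max N
  else row (lift ord_max b) N.
Proof. by rewrite rowK. Qed.

Lemma row_free_inj0 m (A : 'M[R]_(m, n)) :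
  (forall v : 'rV[R]_m, v *m A = 0 -> v = 0) -> row_free A.
Proof.
move=> h; rewrite -kermx_eq0; apply/eqP/row_matrixP => a; rewrite row0; apply: h.
by rewrite -row_mul mulmx_ker row0.
Qed.

Lemma pencil_free N t : row_free N -> 0 <= t <= 1 -> row_free (pencil_mx N t).
Proof.
move=> fN ht; have [_ _ q0] := dc_half ht; apply: row_free_inj0 => v vM.
pose w : 'rV[R]_k.+1 := \row_c
  if unlift ord_max c is Some b then (if b == ord0 then v 0 ord0 * dc t else v 0 b)
  else v 0 ord0 * ds t.
have wN : w *m N = v *m pencil_mx N t.
  rewrite !mulmx_sum_row (bigD1_ord ord_max) //= [in RHS](bigD1 ord0) //=.
  rewrite pencil_row eqxx scalerDr !scalerA mxE unlift_none.
  rewrite (bigD1 ord0) //= mxE liftK eqxx addrCA -!addrA; congr (_ + (_ + _)).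
  apply: eq_bigr => b b0; rewrite pencil_row (negbTE b0) mxE liftK (negbTE b0) //.
have w0 : w = 0 by apply: (row_free_inj fN); rewrite wN vM mul0mx.
apply/rowP => b; rewrite mxE; have := congr1 (fun x : 'rV__ => x 0 (lift ord_max b)) w0.
rewrite !mxE liftK; case: eqP => [-> e1|//].
have := congr1 (fun x : 'rV__ => x 0 ord_max) w0; rewrite !mxE unlift_none => e2.
apply/eqP; apply: contraNT q0 => v0.
move/eqP: e1; rewrite mulf_eq0 (negbTE v0) => /eqP ->.
by move/eqP: e2; rewrite mulf_eq0 (negbTE v0) => /eqP ->; rewrite expr0n addr0.
Qed.

(* For N of full rank this loop generates the fundamental group of Gr(k, n). *)
Definition pencil N (t : I) : Gr := gsp V0 (pencil_mx N (val t)).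

Lemma pencil_mx_continuous (Y : topologicalType) (f : Y -> 'M[R]_(k.+1, n)) (g : Y -> R) y :
  {for y, continuous f} -> {for y, continuous g} ->
  {for y, continuous (fun z => pencil_mx (f z) (g z))}.
Proof.
move=> fc gc; apply: continuous_at_mx => a b.
have fe c : {for y, continuous (fun z => f z c b)} by exact: continuous_entry.
have dcc : {for y, continuous (fun z => dc (g z))}.
  apply: cont_add; first exact: cont_cst.
  by apply: cont_opp; apply: cont_mul => //; exact: cont_cst.
have dsc : {for y, continuous (fun z => ds (g z))}.
  apply: cont_mul; first exact: cont_cst.
  apply: continuous_minr => //; apply: cont_add; first exact: cont_cst.
  exact: cont_opp.
rewrite (_ : (fun z => _) = fun z => if a == ord0 then
   dc (g z) * f z (lift ord_max (ord0 : 'I_k)) b + ds (g z) * f z ord_max b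
   else f z (lift ord_max a) b); last first.
  by apply/funext => z; rewrite mxE; case: ifP => _; rewrite !mxE.
by case: (a == ord0) => //; apply: cont_add; apply: cont_mul.
Qed.

Lemma free_continuous (Y : topologicalType) (f : Y -> 'M[R]_(k, n)) :
  (forall y, row_free (f y)) -> continuous f -> continuous (fun y => gsp V0 (f y)).
Proof. by move=> ff fc; apply: cont_all => y; apply: gsp_continuous => //; exact: fc. Qed.

Lemma pencil_continuous N : row_free N -> continuous (pencil N).
Proof.
move=> fN; apply: free_continuous => [t|]; first by rewrite pencil_free // unit_itvP.
apply: cont_all => t; apply: pencil_mx_continuous; first exact: cont_cst.
exact: continuous_set_val.
Qed.

Definition lam N : int := L (pencil N).

Lemma lam_pm N : row_free N -> lam N = 1 \/ lam N = -1.
Proof. by move=> fN; apply: transport_pm; exact: pencil_continuous. Qed.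

Lemma unit_itv_convex (x y t : R^o) : unit_itv R x -> unit_itv R y -> 0 <= t <= 1 ->
  unit_itv R ((1 - t) *: x + t *: y).
Proof. by rewrite /unit_itv /= => /andP[? ?] /andP[? ?] /andP[? ?]; apply/andP; split; rewrite /GRing.scale /=; nra. Qed.

Lemma opp_itv (t : I) : 0 <= 1 - val t <= 1.
Proof. by have /andP[? ?] := unit_itvP t; lra. Qed.

Definition rev_itv (t : I) : I := mkI (opp_itv t).

(** A path followed by its reverse can be contracted inside the interval, and 1 and -1 are their own
    inverses. *)
Lemma transport_rev (T : topologicalType) (L' : local_system R T) (p : I -> T) : continuous p ->
  L' (p \o rev_itv) = L' p.
Proof.
move=> pc; have rc : continuous rev_itv.
  apply: continuous_sub; apply: cont_all => t; apply: cont_add; first exact: cont_cst.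
  by apply: cont_opp; exact: continuous_set_val.
have r0 : rev_itv (I0 R) = I1 R by apply: val_inj; rewrite /= subr0.
have r1 : rev_itv (I1 R) = I0 R by apply: val_inj; rewrite /= subrr.
have := @transport_triangle R T L' R^o (unit_itv R) unit_itv_convex p pc id rev_itv (fun=> I0 R).
have e0 : L' (p \o fun=> I0 R) = 1 := transport_cst L' (p (I0 R)).
rewrite e0 => h.
have {}h : 1 = L' (p \o rev_itv) * L' p.
  apply: h => //.
  - by move=> x; exact: cvg_id.
  - by apply: cont_all => x; exact: cont_cst.
have := transport_pm L' pc.
have := transport_pm L' (continuous_compose rc pc).
by move=> [] p1 [] p2; move: h; rewrite p1 p2.
Qed.

(** The diagonal of the square compares the two broken lines along its boundary. The two sides
    traced by the base point have the same image, and their transport cancels since integers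
    commute. *)
Lemma transport_free_homotopy (H : cube R 2 -> Gr) : continuous H ->
  (forall s : I, H (face ord_max (I0 R) (face ord0 s (cube0 R 0))) =
             H (face ord_max (I1 R) (face ord0 s (cube0 R 0)))) ->
  L (fun t => H (face ord0 (I0 R) (edge ord0 t))) =
  L (fun t => H (face ord0 (I1 R) (edge ord0 t))).
Proof.
move=> Hc He.
pose b (t : I) : cube R 2 := face ord0 (I0 R) (edge ord0 t).
pose d (t : I) : cube R 2 := face ord0 (I1 R) (edge ord0 t).
pose l (s : I) : cube R 2 := face ord_max (I0 R) (edge ord0 s).
pose r (s : I) : cube R 2 := face ord_max (I1 R) (edge ord0 s).
have fc i t : continuous (fun s => face i t (edge ord0 s) : cube R 2).
  exact: (continuous_compose (@edge_continuous R 1 ord0) (@face_continuous R 1 i t)).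
have ee s : edge ord0 s = face ord0 s (cube0 R 0).
  apply: cube_ext => j; have -> : j = ord0 by apply: val_inj; case: j => -[].
  by rewrite edgeE face_same eqxx.
have corner x y : face ord0 (bI R x) (edge ord0 (bI R y)) =
    face ord_max (bI R y) (edge ord0 (bI R x)) :> cube R 2.
  apply: cube_ext => j.
  have [j' ->|->] := unliftP ord0 j.
    have -> : lift ord0 j' = ord_max :> 'I_2 by apply: val_inj; rewrite /= ord1.
    rewrite face_same -[ord_max in LHS](_ : lift ord0 (ord0 : 'I_1) = ord_max); last exact: val_inj.
    by rewrite face_lift edgeE.
  rewrite face_same (_ : ord0 = lift ord_max (ord0 : 'I_1)) ?face_lift ?edgeE //; exact: val_inj.
have tri := @transport_triangle _ _ L _ _ (@cube_convex R 2) H Hc.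
pose dg := segc (b (I0 R)) (d (I1 R)).
have dgc : continuous dg by exact: segc_continuous.
have e1 : L (H \o dg) = L (H \o d) * L (H \o l).
  apply: tri => //; rewrite /dg ?segc0 ?segc1 //.
  - exact: (fc ord_max (I0 R)).
  - exact: (fc ord0 (I1 R)).
  - exact/esym/(corner false false).
  - exact/esym/(corner true false).
have e2 : L (H \o dg) = L (H \o r) * L (H \o b).
  apply: tri => //; rewrite /dg ?segc0 ?segc1 //.
  - exact: (fc ord0 (I0 R)).
  - exact: (fc ord_max (I1 R)).
  - exact: (corner false true).
  - exact/esym/(corner true true).
have lr : H \o l = H \o r by apply/funext => s /=; rewrite /l /r ee He.
have hl := transport_sqr L (continuous_compose (fc ord_max (I1 R)) Hc).
rewrite -[LHS]/(L (H \o b)) -[RHS]/(L (H \o d)).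
rewrite -[LHS]mul1r -hl -mulrA -e2 e1 lr.
by rewrite -[RHS]mul1r -hl; ring.
Qed.

Lemma det_line p (A B : 'M[R]_p) a x : (forall b, b != a -> row b A = row b B) ->
  \det ((1 - x) *: A + x *: B) = (1 - x) * \det A + x * \det B.
Proof.
move=> h; have nl b : lift a b != a by rewrite eq_sym neq_lift.
apply: (@determinant_multilinear _ _ _ _ _ a).
- by apply/rowP => c; rewrite !mxE.
- apply/matrixP => b c; rewrite !mxE.
  have /(congr1 (fun v : 'rV__ => v 0 c)) := h (lift a b) (nl b).
  by rewrite !mxE => ->; ring.
- apply/matrixP => b c; rewrite !mxE.
  have /(congr1 (fun v : 'rV__ => v 0 c)) := h (lift a b) (nl b).
  by rewrite !mxE => ->; ring.
Qed.

Definition negrow m p (c : 'I_m) (A : 'M[R]_(m, p)) : 'M[R]_(m, p) :=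
  sgmx R (fun a => a == c) *m A.

Lemma row_negrow m p (c a : 'I_m) (A : 'M[R]_(m, p)) :
  row a (negrow c A) = (-1) ^+ (a == c) *: row a A.
Proof. by apply/rowP => j; rewrite /negrow mul_diag_mx !mxE. Qed.

Lemma gsp_negrow c M : row_free M -> gsp V0 (negrow c M) = gsp V0 M.
Proof. by move=> fM; apply: gsp_unit => //; exact: sgmx_unit. Qed.

Lemma det_sgmx1 m (c : 'I_m) : \det (sgmx R (fun a => a == c)) = -1.
Proof.
rewrite det_diag (bigD1 c) //= mxE eqxx expr1 big1 ?mulr1 // => a /negbTE h.
by rewrite mxE h expr0.
Qed.

(** Negating one of the two turning rows reverses the loop, and negating a row of the axis changes
    no subspace. *)
Lemma lam_negrow N c : row_free N -> lam (negrow c N) = lam N.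
Proof.
move=> fN; have fp t : row_free (pencil_mx N (val (t : I))) by rewrite pencil_free // unit_itvP.
have lift0 (b : 'I_k) : (lift ord_max b == ord_max) = false by rewrite eq_sym (negbTE (neq_lift _ _)).
have dc1 t : dc (1 - t) = - dc t :> R by rewrite /dc; ring.
have rev : L (pencil N \o rev_itv) = lam N by apply: transport_rev; exact: pencil_continuous.
have [b ->|->] := unliftP ord_max c; last first.
  rewrite -rev /lam; congr (L _); apply/funext => t; rewrite /pencil /comp -(gsp_negrow ord0 (fp (rev_itv t))).
  congr gsp; apply/row_matrixP => a; rewrite row_negrow !pencil_row !row_negrow lift0 eqxx.
  rewrite (_ : val (rev_itv t) = 1 - val t) // dsC dc1 expr0 expr1 !scale1r lift0 expr0 scale1r.
  by have [_|a0] := eqVneq a ord0; rewrite ?expr0 ?expr1 ?scale1r // !(scaleN1r, scaleNr, scalerN) opprD opprK.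
have [->|b0] := eqVneq b ord0.
  rewrite -rev /lam; congr (L _); apply/funext => t; rewrite /pencil /comp; congr gsp.
  apply/row_matrixP => a; rewrite !pencil_row !row_negrow eqxx [ord_max == _]eq_sym lift0.
  rewrite (_ : val (rev_itv t) = 1 - val t) // dsC dc1 expr0 expr1 !scale1r (inj_eq lift_inj).
  by have [_|a0] := eqVneq a ord0; rewrite ?expr0 ?scale1r // scaleN1r scalerN scaleNr.
rewrite /lam; congr (L _); apply/funext => t; rewrite /pencil -(gsp_negrow b (fp t)); congr gsp.
apply/row_matrixP => a; rewrite row_negrow !pencil_row !row_negrow [ord_max == _]eq_sym lift0 !(inj_eq lift_inj).
rewrite [ord0 == _]eq_sym (negbTE b0) !expr0 !scale1r.
by have [->|a0] := eqVneq a ord0; rewrite // eq_sym (negbTE b0) expr0 scale1r.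
Qed.

(** The determinant is affine in the one moving row, so with equal signs at the ends it never
    vanishes between them. The segment keeps full rank and gives a free homotopy of loops. *)
Lemma lam_homotopy N N' (E : 'M[R]_(n, k.+1)) b :
  (forall c, c != b -> row c N = row c N') -> 0 < \det (N *m E) * \det (N' *m E) ->
  lam N = lam N'.
Proof.
move=> h pos; pose NN s : 'M[R]_(k.+1, n) := (1 - s) *: N + s *: N'.
have frN s : 0 <= s <= 1 -> row_free (NN s).
  move=> /andP[s0 s1]; apply: (@row_free_right_inv _ _ _ _ E); rewrite unitmxE unitfE mulmxDl -!scalemxAl.
  rewrite (@det_line _ _ _ b) => [|c cb]; last by rewrite !row_mul h.
  apply: contraTneq pos => e; rewrite -leNgt; move: e.
  set x := \det _; set y := \det _ => e.
  have [s0'|s0'] := eqVneq s 0; first by move: e; rewrite s0'; nra.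
  have {s0'} : 0 < s by rewrite lt_neqAle eq_sym s0'.
  move=> sp; have : s * (x * y) = - (1 - s) * x ^+ 2 by move: e => /(congr1 (fun z => z * x)); lra.
  have := sqr_ge0 x; nra.
pose H (x : cube R 2) := gsp V0 (pencil_mx (NN (val x 0 ord0)) (val x 0 ord_max)).
have Hc : continuous H.
  apply: free_continuous => [x|]; first by rewrite pencil_free ?frN ?cubeP.
  apply: cont_all => x; apply: pencil_mx_continuous; last exact: continuous_coord.
  apply: continuous_at_mx => i j.
  rewrite (_ : (fun z => _) = fun z : cube R 2 => (1 - val z 0 ord0) * N i j + val z 0 ord0 * N' i j); last first.
    by apply/funext => z; rewrite !mxE.
  apply: cont_add; apply: cont_mul; do ?exact: cont_cst; last exact: continuous_coord.
  apply: cont_add; first exact: cont_cst.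
  by apply: cont_opp; exact: continuous_coord.
have cE s t : val (face ord0 s (edge (ord0 : 'I_1) t)) 0 ord0 = val s.
  exact: face_same.
have lm : lift ord0 (ord0 : 'I_1) = ord_max by exact: val_inj.
have cM s t : val (face ord0 s (edge (ord0 : 'I_1) t)) 0 ord_max = val t.
  by rewrite -lm face_lift edgeE eqxx.
have lm0 : lift ord_max (ord0 : 'I_1) = ord0 by exact: val_inj.
have := transport_free_homotopy Hc.
rewrite /H (_ : (fun t : I => _) = pencil N); last first.
  apply/funext => t; rewrite cE cM /NN -[val (I0 R)]/(0 : R) subr0 scale1r scale0r addr0 //.
rewrite (_ : (fun t : I => gsp V0 (pencil_mx (NN (val (face ord0 (I1 R) _) 0 ord0)) _)) = pencil N'); last first.
  apply/funext => t; rewrite cE cM /NN -[val (I1 R)]/(1 : R) subrr scale1r scale0r add0r //.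
have vE (b' s : I) : val (face ord_max b' (face ord0 s (cube0 R 0))) 0 ord0 = val s.
  by have := face_lift ord_max b' (face ord0 s (cube0 R 0)) ord0; rewrite lm0 => ->; exact: face_same.
apply=> s; rewrite !face_same !vE.
set s' := val s; have f' t : 0 <= t <= 1 -> row_free (pencil_mx (NN s') t).
  by move=> ht; rewrite pencil_free ?frN ?unit_itvP.
rewrite -(@gsp_negrow ord0); last by apply: f'; exact: unit_itvP.
congr gsp; apply/row_matrixP => a; rewrite row_negrow !pencil_row.
have [_|a0] := eqVneq a ord0; rewrite ?expr0 ?scale1r //.
have e1 : dc (val (I1 R)) = - 1 :> R by rewrite /dc -[val (I1 R)]/(1 : R); ring.
have e0 : dc (val (I0 R)) = 1 :> R by rewrite /dc -[val (I0 R)]/(0 : R); ring.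
have e2 : ds (val (I1 R)) = 0 :> R.
  by rewrite /ds -[val (I1 R)]/(1 : R) subrr (min_idPr _) ?mulr0.
have e3 : ds (val (I0 R)) = 0 :> R.
  by rewrite /ds -[val (I0 R)]/(0 : R) subr0 (min_idPl _) ?mulr0.
by rewrite e0 e1 e2 e3 !scale0r !addr0 expr1 scale1r.
Qed.

(** Rows are moved one at a time with a common E; when the determinant changes sign, the moved row
    is negated first, at no cost by [lam_negrow]. *)
Lemma lam_cst N N' : row_free N -> row_free N' -> lam N = lam N'.
Proof.
move=> fN fN'; have [E [d d']] := common_right_chart fN fN'.
pose rl (A B : 'M[R]_(k.+1, n)) := lam A = lam B; rewrite -/(rl N N').
apply: (row_moves d d') => [//|A B C|]; first by rewrite /rl => -> ->.
move=> t1 t2 a t12; set A := rowmix _ _ _; set B := rowmix _ _ _ => dA dB.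
have AB c : c != a -> row c A = row c B by move=> ca; apply/rowP => j; rewrite !mxE t12.
have fB : row_free B by apply: (@row_free_right_inv _ _ _ _ E); rewrite unitmxE unitfE.
have [pos|neg] := ltP 0 (\det (A *m E) * \det (B *m E)); first exact: lam_homotopy AB pos.
rewrite /rl -(lam_negrow a fB); apply: (@lam_homotopy _ _ E a).
  by move=> c ca; rewrite row_negrow (negbTE ca) expr0 scale1r AB.
by rewrite /negrow -mulmxA [\det (_ *m (B *m E))]det_mulmx det_sgmx1 mulN1r mulrN oppr_gt0 lt_neqAle neg mulf_neq0.
Qed.

Definition turn_mx A (a : 'I_k) (r : 'rV[R]_n) (t : R) : 'M[R]_(k, n) :=
  \matrix_b if b == a then dc t *: row a A + ds t *: r else row b A.

(** Row a is exchanged with the first row, the one that a pencil turns, and r becomes the last. *)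
Definition ext_mx A (a : 'I_k) (r : 'rV[R]_n) : 'M[R]_(k.+1, n) :=
  \matrix_c if unlift ord_max c is Some b then row (tperm ord0 a b) A else r.

Lemma pencil_ext A a r t :
  pencil_mx (ext_mx A a r) t = perm_mx (tperm ord0 a) *m turn_mx A a r t.
Proof.
apply/row_matrixP => b; rewrite -row_permE.
have -> : row b (row_perm (tperm ord0 a) (turn_mx A a r t)) = row (tperm ord0 a b) (turn_mx A a r t).
  by apply/rowP => j; rewrite !mxE.
rewrite pencil_row !rowK unlift_none !liftK tpermL.
have [->|b0] := eqVneq b ord0; first by rewrite tpermL eqxx.
by rewrite -[X in _ == X](tpermL ord0 a) (inj_eq perm_inj) (negbTE b0).
Qed.

Lemma ext_free A a r : row_free A -> ~~ (r <= A)%MS -> row_free (ext_mx A a r).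
Proof.
move=> fA rA; apply: row_free_inj0 => v.
pose w : 'rV[R]_k := \row_b v 0 (lift ord_max b).
have -> : v *m ext_mx A a r = v 0 ord_max *: r + w *m (perm_mx (tperm ord0 a) *m A).
  rewrite !mulmx_sum_row (bigD1_ord ord_max) //= rowK unlift_none; congr (_ + _).
  by apply: eq_bigr => b _; rewrite rowK liftK mxE -row_permE; congr (_ *: _); apply/rowP => j; rewrite !mxE.
have sub : (w *m (perm_mx (tperm ord0 a) *m A) <= A)%MS by rewrite mulmxA submxMl.
have [v0|v0] := eqVneq (v 0 ord_max) 0; last first.
  move=> /eqP; rewrite addr_eq0 => /eqP e; case/negP: rA.
  by rewrite -[r]scale1r -(mulVf v0) -scalerA scalemx_sub // e eqmx_opp.
rewrite v0 scale0r add0r mulmxA => e.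
have wp : w *m perm_mx (tperm ord0 a) = 0 by apply: (row_free_inj fA); rewrite e mul0mx.
have w0 : w = 0.
  have u : (perm_mx (tperm ord0 a) : 'M[R]_k) \in unitmx by rewrite unitmx_perm.
  by rewrite -[w](mulmxK u) wp mul0mx.
apply/rowP => c; rewrite mxE; have [b ->|->] := unliftP ord_max c; last exact: v0.
by have := congr1 (fun x : 'rV__ => x 0 b) w0; rewrite !mxE.
Qed.

Lemma turn_free A a r t : row_free A -> ~~ (r <= A)%MS -> 0 <= t <= 1 -> row_free (turn_mx A a r t).
Proof.
move=> fA rA ht; have := pencil_free (ext_free a fA rA) ht; rewrite pencil_ext -!row_leq_rank.
by rewrite eqmxMfull // row_full_unit unitmx_perm.
Qed.

Lemma turn_transport A a r : row_free A -> ~~ (r <= A)%MS ->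
  L (fun t : I => gsp V0 (turn_mx A a r (val t))) = lam (ext_mx A a r).
Proof.
move=> fA rA; rewrite /lam; congr (L _); apply/funext => t; rewrite /pencil pencil_ext.
by rewrite (gsp_unit _ V0) ?unitmx_perm // turn_free // unit_itvP.
Qed.

Lemma turn_continuous A a r : row_free A -> ~~ (r <= A)%MS ->
  continuous (fun t : I => gsp V0 (turn_mx A a r (val t))).
Proof.
move=> fA rA; rewrite (_ : (fun t => _) = pencil (ext_mx A a r)).
  by apply: pencil_continuous; exact: ext_free.
apply/funext => t; rewrite /pencil pencil_ext.
by rewrite (gsp_unit _ V0) ?unitmx_perm // turn_free // unit_itvP.
Qed.

Definition gap (A B : 'M[R]_(k, n)) a s : 'M[R]_(k, n) :=
  \matrix_b if b == a then - (1 - s) *: row a A + s *: row a B else row b A.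

Lemma sol_line E A B s : chart_sol E A -> chart_sol E B -> chart_sol E ((1 - s) *: A + s *: B).
Proof.
rewrite /chart_sol /= => eA eB; rewrite mulmxDl -!scalemxAl eA eB -scalerDl subrK.
by rewrite scale1r.
Qed.

(* The two paths are complementary arcs of the pencil of row a A and row a B. *)
Lemma arcs_transport A B a : (forall N, row_free N -> lam N = 1) ->
  row_free A -> ~~ (row a B <= A)%MS -> (forall b, b != a -> row b A = row b B) ->
  (forall s, 0 <= s <= 1 -> row_free ((1 - s) *: A + s *: B)) ->
  (forall s, 0 <= s <= 1 -> row_free (gap A B a s)) ->
  L (fun t : I => gsp V0 ((1 - val t) *: A + val t *: B)) =
  L (fun t : I => gsp V0 (gap A B a (val t))).
Proof.
move=> lam1 fA rA AB f1 f2.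
set p := fun t : I => gsp V0 _; set q := fun t : I => gsp V0 (gap A B a _).
have pc : continuous p.
  apply: free_continuous => [t|]; first by apply: f1; exact: unit_itvP.
  apply: cont_all => t; apply: continuous_at_mx => i j.
  rewrite (_ : (fun z => _) = fun z : I => (1 - val z) * A i j + val z * B i j); last first.
    by apply/funext => z; rewrite !mxE.
  apply: cont_add; apply: cont_mul; do ?exact: cont_cst; last exact: continuous_set_val.
  by apply: cont_add; [exact: cont_cst|apply: cont_opp; exact: continuous_set_val].
have qc : continuous q.
  apply: free_continuous => [t|]; first by apply: f2; exact: unit_itvP.
  apply: cont_all => t; apply: continuous_at_mx => i j.
  rewrite (_ : (fun z => _) = fun z : I => if i == a then - (1 - val z) * A a j + val z * B a j else A i j); last first.
    by apply/funext => z; rewrite mxE; case: ifP => _; rewrite !mxE.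
  case: (i == a); last exact: cont_cst.
  apply: cont_add; apply: cont_mul; do ?exact: cont_cst; last exact: continuous_set_val.
  by apply: cont_opp; apply: cont_add; [exact: cont_cst|apply: cont_opp; exact: continuous_set_val].
have rc : continuous rev_itv.
  apply: continuous_sub; apply: cont_all => t; apply: cont_add; first exact: cont_cst.
  by apply: cont_opp; exact: continuous_set_val.
have qrc : continuous (q \o rev_itv) by exact: continuous_compose.
have := transport_concat L pc qrc (@turn_continuous A a _ fA rA).
rewrite turn_transport // lam1 ?ext_free // transport_rev // => h.
have {}h : 1 = L q * L p.
  apply: h => s t; split=> st; rewrite /p /q /comp; congr gsp; apply/row_matrixP => b.
    rewrite rowK; have /andP[t0 t1] := unit_itvP t.
    have e1 : dc (val s) = 1 - val t by rewrite st /dc; field.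
    have e2 : ds (val s) = val t.
      rewrite /ds (min_idPl _); first by rewrite st; field.
      by rewrite st; lra.
    have rE : row b ((1 - val t) *: A + val t *: B) = (1 - val t) *: row b A + val t *: row b B.
      by apply/rowP => j; rewrite !mxE.
    rewrite rE e1 e2; have [->//|ba] := eqVneq b a.
    by rewrite (AB b ba) -scalerDl subrK scale1r.
  rewrite !rowK; have /andP[t0 t1] := unit_itvP t.
  rewrite (_ : val (rev_itv t) = 1 - val t) //.
  have e1 : dc (val s) = - (1 - (1 - val t)) by rewrite st /dc; field.
  have e2 : ds (val s) = 1 - val t.
    rewrite /ds (min_idPr _); first by rewrite st; field.
    by rewrite st; lra.
  by rewrite e1 e2.
have [] := transport_pm L pc; have [] := transport_pm L qc => e1 e2.
all: by move: h; rewrite e1 e2.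
Qed.

(** The segment from A to B stays in the first chart. If the second determinant keeps its sign, the
    segment stays in the second chart too; if not, the arc through [negrow a A] does, and by
    [arcs_transport] it has the same transport. *)
Lemma sol_step (E1 E2 : 'M[R]_(n, k)) (M1 : chart_sol E1) (M2 : chart_sol E2) A B a :
  (forall N, row_free N -> lam N = 1) -> chart_sol E1 A -> chart_sol E1 B ->
  (forall b, b != a -> row b A = row b B) ->
  \det (A *m E2) != 0 -> \det (B *m E2) != 0 ->
  chart_triv L M1 (gsp V0 A) * chart_triv L M2 (gsp V0 A) =
  chart_triv L M1 (gsp V0 B) * chart_triv L M2 (gsp V0 B).
Proof.
move=> lam1 sA sB AB dA dB; have fA := chart_sol_free sA.
set p := fun t : I => gsp V0 ((1 - val t) *: A + val t *: B).
have p0 : p (I0 R) = gsp V0 A by rewrite /p -[val (I0 R)]/(0 : R) subr0 scale1r scale0r addr0.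
have p1 : p (I1 R) = gsp V0 B by rewrite /p -[val (I1 R)]/(1 : R) subrr scale1r scale0r add0r.
have sl s : chart_sol E1 ((1 - s) *: A + s *: B) by exact: sol_line.
have pc : continuous p.
  apply: free_continuous => [t|]; first exact: chart_sol_free (sl _).
  apply: cont_all => t; apply: continuous_at_mx => i j.
  rewrite (_ : (fun z => _) = fun z : I => (1 - val z) * A i j + val z * B i j); last first.
    by apply/funext => z; rewrite !mxE.
  apply: cont_add; apply: cont_mul; do ?exact: cont_cst; last exact: continuous_set_val.
  by apply: cont_add; [exact: cont_cst|apply: cont_opp; exact: continuous_set_val].
have h1 : L p * chart_triv L M1 (gsp V0 A) = chart_triv L M1 (gsp V0 B).
  rewrite -p0 -p1; apply: chart_triv_path => // _ [t _ <-].
  by have [] := chart_sol_gsp V0 (sl (val t)).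
suff h2 : L p * chart_triv L M2 (gsp V0 A) = chart_triv L M2 (gsp V0 B).
  by rewrite -h1 -h2 mulrACA (transport_sqr L pc) mul1r.
have dl s : \det (((1 - s) *: A + s *: B) *m E2) = (1 - s) * \det (A *m E2) + s * \det (B *m E2).
  rewrite mulmxDl -!scalemxAl (@det_line _ _ _ a) // => b ba.
  by rewrite !row_mul AB.
have nz x y s : 0 < x * y -> 0 <= s <= 1 -> (1 - s) * x + s * y != 0 :> R.
  move=> xy /andP[s0 s1]; apply/eqP => e.
  have [s0'|s0'] := eqVneq s 0; first by move: e; rewrite s0'; nra.
  have {s0'} sp : 0 < s by rewrite lt_neqAle eq_sym s0'.
  have : s * (x * y) = - (1 - s) * x ^+ 2 by move: e => /(congr1 (fun z => z * x)); lra.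
  have := sqr_ge0 x; nra.
have [pos|neg] := ltP 0 (\det (A *m E2) * \det (B *m E2)).
  rewrite -p0 -p1; apply: chart_triv_path => // _ [t _ <-].
  apply/chart_dom_gsp; first exact: chart_sol_free (sl _).
  by rewrite dl nz // unit_itvP.
have {}neg : 0 < - \det (A *m E2) * \det (B *m E2).
  by rewrite mulNr oppr_gt0 lt_neqAle neg mulf_neq0.
(* Otherwise B = P A; the normalization by [E1] gives det P = 1, and the determinant against [E2]
   could not change sign. *)
have rA : ~~ (row a B <= A)%MS.
  apply/negP => /submxP[D rD].
  pose P : 'M[R]_k := \matrix_b if b == a then D else row b 1%:M.
  have BP : B = P *m A.
    apply/row_matrixP => b; rewrite row_mul rowK; case: eqVneq => [-> //|ba].
    by rewrite -row_mul mul1mx AB.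
  have := congr1 (fun M => \det (M *m E1)) BP; rewrite /= sB -mulmxA sA mulmx1 det1 => e.
  by move: neg; rewrite {1}BP -mulmxA det_mulmx -e mul1r; have := sqr_ge0 (\det (A *m E2)); nra.
have gE s : gap A B a s = (1 - s) *: negrow a A + s *: B.
  apply/row_matrixP => b; rewrite rowK.
  have -> : row b ((1 - s) *: negrow a A + s *: B) = (1 - s) *: row b (negrow a A) + s *: row b B.
    by apply/rowP => j; rewrite !mxE.
  rewrite row_negrow; have [->|ba] := eqVneq b a; first by rewrite expr1 scalerA mulrN1.
  by rewrite expr0 scale1r AB // -scalerDl subrK scale1r.
have dg s : \det (gap A B a s *m E2) = (1 - s) * - \det (A *m E2) + s * \det (B *m E2).
  rewrite gE mulmxDl -!scalemxAl (@det_line _ _ _ a) => [|b ba].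
    by rewrite /negrow -mulmxA [\det (_ *m (A *m E2))]det_mulmx det_sgmx1 mulN1r.
  by rewrite [LHS]row_mul [RHS]row_mul row_negrow (negbTE ba) expr0 scale1r AB.
have fg s : 0 <= s <= 1 -> row_free (gap A B a s).
  by move=> hs; apply: (@row_free_right_inv _ _ _ _ E2); rewrite unitmxE unitfE dg nz.
rewrite /p (arcs_transport lam1 fA rA) // => [|s _]; last exact: chart_sol_free (sl _).
set q := fun t : I => gsp V0 _.
have q0 : q (I0 R) = gsp V0 A.
  rewrite /q -[val (I0 R)]/(0 : R) gE subr0 scale1r scale0r addr0.
  exact: gsp_negrow.
have q1 : q (I1 R) = gsp V0 B.
  by rewrite /q -[val (I1 R)]/(1 : R) gE subrr scale1r scale0r add0r.
have qc : continuous q.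
  apply: free_continuous => [t|]; first by apply: fg; exact: unit_itvP.
  apply: cont_all => t; apply: continuous_at_mx => i j.
  rewrite (_ : (fun z => _) = fun z : I => (1 - val z) * negrow a A i j + val z * B i j); last first.
    by apply/funext => z; rewrite gE !mxE.
  apply: cont_add; apply: cont_mul; do ?exact: cont_cst; last exact: continuous_set_val.
  by apply: cont_add; [exact: cont_cst|apply: cont_opp; exact: continuous_set_val].
rewrite -q0 -q1; apply: chart_triv_path => // _ [t _ <-].
by apply/chart_dom_gsp; rewrite ?dg ?nz ?fg // unit_itvP.
Qed.

Lemma rowmix_sol E A B t : chart_sol E A -> chart_sol E B -> chart_sol E (rowmix A B t).
Proof.
rewrite /chart_sol /= => eA eB; apply/row_matrixP => b; rewrite row_mul row_rowmix.
by rewrite mulmxDl -!scalemxAl -!row_mul eA eB -scalerDl subrK scale1r.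
Qed.

(** The intersection of two charts may be disconnected; [row_moves] nevertheless links any two of
    its points by moves to which [sol_step] applies. *)
Lemma sol_agree (E1 E2 : 'M[R]_(n, k)) (M1 : chart_sol E1) (M2 : chart_sol E2) V V' :
  (forall N, row_free N -> lam N = 1) ->
  chart_dom E1 V -> chart_dom E2 V -> chart_dom E1 V' -> chart_dom E2 V' ->
  chart_triv L M1 V * chart_triv L M2 V = chart_triv L M1 V' * chart_triv L M2 V'.
Proof.
move=> lam1 V1 V2 V1' V2'.
have [e f g] := chartK V0 V1; have [e' f' g'] := chartK V0 V1'.
move: (chart E1 V) (chart E1 V') e f g e' f' g' => A B e f g e' f' g'.
have d2 : \det (A *m E2) != 0.
  by apply: (iffLR (chart_dom_gsp E2 V0 f)); rewrite g.
have d2' : \det (B *m E2) != 0.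
  by apply: (iffLR (chart_dom_gsp E2 V0 f')); rewrite g'.
rewrite -g -g'.
pose F (C : 'M[R]_(k, n)) := chart_triv L M1 (gsp V0 C) * chart_triv L M2 (gsp V0 C).
pose rl (C D : 'M[R]_(k, n)) := F C = F D; rewrite -/(rl _ _).
apply: (row_moves d2 d2') => [//|C D C'|]; first by rewrite /rl => -> ->.
move=> t1 t2 a t12 dA dB; apply: (sol_step (a := a) M1 M2 lam1 (rowmix_sol t1 e e') (rowmix_sol t2 e e') _ dA dB).
by move=> b ba; rewrite !row_rowmix t12.
Qed.

Lemma chart_domS V : exists E : 'M[R]_(n, k), chart_dom E V.
Proof.
have /row_freeP[E e] := frame_free V; exists E.
by rewrite /chart_dom /= e det1 oner_neq0.
Qed.

Lemma chart_dom_open (E : 'M[R]_(n, k)) (V : Gr) : chart_dom E V -> nbhs V (chart_dom E).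
Proof.
have H (A : @frames R k n) : chart_dom E (span_frame A) -> nbhs A (@span_frame R k n @^-1` chart_dom E) /\
    {for A, continuous ((id : Gr -> Gr) \o @span_frame R k n)}.
  by move=> dA; split; [exact: chart_dom_nbhs|exact: span_frame_continuous].
by move=> dV; have [] := Gr_continuous H dV.
Qed.

(** Common points of three charts are what makes the signs comparing the charts satisfy the cocycle
    condition. *)
Lemma chart_dom_triple (E1 E2 E3 : 'M[R]_(n, k)) V1 V2 V3 :
  chart_dom E1 V1 -> chart_dom E2 V2 -> chart_dom E3 V3 ->
  exists V, [/\ chart_dom E1 V, chart_dom E2 V & chart_dom E3 V].
Proof.
move=> d1 d2 d3.
have [|x xE] := @line_generic R k n (frame V1) (frame V2) [:: E1; E2].
  by move=> E; rewrite !inE => /orP[] /eqP ->; [left|right].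
set A := _ + _ in xE; have [|y yE] := @line_generic R k n A (frame V3) [:: E1; E2; E3].
  move=> E; rewrite !inE => /or3P[] /eqP ->; [left|left|right] => //.
    by apply: xE; rewrite inE eqxx.
  by apply: xE; rewrite !inE eqxx orbT.
set B := _ + _ in yE; have fB : row_free B.
  apply: (@row_free_right_inv _ _ _ _ E1); rewrite unitmxE unitfE.
  by apply: yE; rewrite inE eqxx.
by exists (gsp V0 B); split; apply/chart_dom_gsp => //; apply: yE; rewrite !inE eqxx ?orbT.
Qed.

Lemma nonconstant_pencil : ~ constant_system L -> exists2 N, row_free N & lam N != 1.
Proof.
move=> nc; apply: contrapT => h; apply: nc.
have lam1 N : row_free N -> lam N = 1.
  by move=> fN; apply/eqP; apply: contrapT => /negP l; apply: h; exists N.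
have [E dE] := choice chart_domS.
have [T [Tpm Ta Tp]] : exists T : Gr -> Gr -> int, [/\
    forall V W, T V W = 1 \/ T V W = -1,
    forall V V' X Y : Gr, chart_dom (E V) X -> chart_dom (E V') X -> chart_dom (E V) Y ->
      chart_dom (E V') Y -> T V X * T V' X = T V Y * T V' Y &
    forall V (p : I -> Gr), continuous p -> range p `<=` chart_dom (E V) ->
      L p * T V (p (I0 R)) = T V (p (I1 R))].
  have sE V : chart_sol (E V) (chart (E V) V) by have [] := chartK V0 (dE V).
  exists (fun V => chart_triv L (mkS (sE V))); split.
  - by move=> V W; exact: chart_triv_pm.
  - by move=> V V' X Y a1 a2 b1 b2; exact: (sol_agree (mkS (sE V)) (mkS (sE V')) lam1 a1 a2 b1 b2).
  - by move=> V p pc pd; exact: (chart_triv_path L (mkS (sE V)) pc pd).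
have Tsq V W : T V W * T V W = 1 by case: (Tpm V W) => ->.
have /choice[W dW] V : exists W, chart_dom (E V0) W /\ chart_dom (E V) W.
  by have [W [? ? _]] := chart_dom_triple (dE V0) (dE V) (dE V); exists W.
(* [c V] is the sign by which the chart at V differs from the chart at [V0]. By [gE] the corrected
   trivializations agree on overlaps, so [g] coincides with one of them on a whole chart around each
   point. *)
pose c V := T V0 (W V) * T V (W V); pose g V := c V * T V V.
have gE V V' : chart_dom (E V) V' -> g V' = c V * T V V'.
  move=> dV; have [Z [Z0 Z1 Z2]] := chart_dom_triple (dE V0) (dE V) (dE V').
  have [W0 W1] := dW V; have [W0' W1'] := dW V'.
  have e1 : c V = T V0 Z * T V Z := Ta _ _ _ _ W0 W1 Z0 Z1.
  have e2 : c V' = T V0 Z * T V' Z := Ta _ _ _ _ W0' W1' Z0 Z2.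
  have e3 : T V Z * T V' Z = T V V' * T V' V' := Ta _ _ _ _ Z1 Z2 dV (dE V').
  rewrite /g e1 e2.
  transitivity (T V0 Z * T V' Z * T V' V' * (T V Z * T V Z)); first by rewrite Tsq mulr1.
  transitivity (T V0 Z * T V Z * (T V Z * T V' Z) * T V' V'); first by ring.
  rewrite e3; transitivity (T V0 Z * T V Z * T V V' * (T V' V' * T V' V')); first by ring.
  by rewrite Tsq mulr1.
exists g; split.
  move=> V; rewrite /g /c.
  by case: (Tpm V0 (W V)) => ->; case: (Tpm V (W V)) => ->; case: (Tpm V V) => ->.
apply: trivialization_glue => V; exists (chart_dom (E V)); first exact/chart_dom_open/dE.
move=> p pc pd; rewrite !(gE V); try by apply: pd; exists (I0 R).
  by rewrite mulrCA Tp.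
by apply: pd; exists (I1 R).
Qed.

Lemma nonconstant_turn A a r : ~ constant_system L -> row_free A -> ~~ (r <= A)%MS ->
  L (fun t : I => gsp V0 (turn_mx A a r (val t))) = -1.
Proof.
move=> /nonconstant_pencil[N fN l1] fA rA; rewrite turn_transport //.
have fe := ext_free a fA rA; rewrite (lam_cst fe fN).
by case: (lam_pm fN) l1 => ->.
Qed.

End Pencils.

(** * Minimal coset representatives *)

Section Covers.
Variable n : nat.
Implicit Types J : {set 'I_n}.

(** By [sum_below] the differences of the two functions [below] add up to 1, so they differ at a
    single m0, by one. The membership of m0 - 1 and of m0 is thereby exchanged, and no other. *)
Lemma lepiv_cover J1 J2 : #|J1| = #|J2| -> lepiv J1 J2 -> wt J2 = (wt J1).+1 ->
  exists i j : 'I_n, [/\ j = i.+1 :> nat, i \in J1, j \notin J1 & J2 = swp i j J1].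
Proof.
move=> c12 le12 w12.
have [m0 [m0n m0E m0U]] : exists m0 : 'I_n.+1, [/\ True, below J1 m0 = (below J2 m0).+1 &
    forall m : 'I_n.+1, m != m0 -> below J1 m = below J2 m].
  have s1 := sum_below J1; have s2 := sum_below J2.
  have tot : (\sum_(m < n.+1) (below J1 m - below J2 m) = 1)%N.
    rewrite sumnB => [|m _]; last exact: le12.
    move: s1 s2; rewrite c12 w12; set S1 := (\sum_(m < n.+1) below J1 m)%N.
    by set S2 := (\sum_(m < n.+1) below J2 m)%N; move: (#|J2| * n)%N (wt J1) S1 S2; lia.
  have [m0 m0E] : exists m0 : 'I_n.+1, (below J1 m0 - below J2 m0 != 0)%N.
    apply/existsP; apply: contraT => /existsPn h; move: tot; rewrite big1 // => m _.
    by apply/eqP; have := h m; rewrite negbK.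
  move: tot; rewrite (bigD1 m0) //= => tot; exists m0; split=> //.
    by have := le12 m0; lia.
  move=> m mm0; have := le12 m; move: tot; rewrite (bigD1 m) //=; lia.
have m0_gt0 : (0 < m0)%N.
  rewrite lt0n; apply/eqP => e; move: m0E; rewrite e /below.
  by rewrite (_ : [set p in J1 | _]%SET = finset.set0) ?cards0 //; apply/setP => p; rewrite !inE ltn0 andbF.
have m0_ltn : (m0 < n)%N.
  have := ltn_ord m0; rewrite ltnS leq_eqVlt => /orP[/eqP e|//]; move: m0E; rewrite e.
  have bn J : below J n = #|J|.
    by rewrite /below; congr #|pred_of_set _|; apply/setP => p; rewrite !inE ltn_ord andbT.
  by rewrite !bn c12; lia.
have im : (m0.-1 < n)%N by lia.
pose i := Ordinal im; pose j := Ordinal m0_ltn.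
have iE : i.+1 = m0 by rewrite /= prednK.
have U (m : nat) : (m <= n)%N -> m != m0 -> below J1 m = below J2 m.
  by move=> mn mm; apply: (m0U (Ordinal (mn : (m < n.+1)%N))).
have step (p : 'I_n) (J : {set 'I_n}) : below J p.+1 = (below J p + (p \in J))%N by exact: belowS.
have hi : (i \in J1) /\ (i \notin J2).
  have := step i J1; have := step i J2; rewrite iE m0E U /=; [|lia|lia].
  by case: (i \in J1); case: (i \in J2); lia.
have hj : (j \notin J1) /\ (j \in J2).
  have := step j J1; have := step j J2; rewrite [below J1 j.+1]U /=; [|lia|lia].
  by rewrite m0E; case: (j \in J1); case: (j \in J2); lia.
have ij : j = i.+1 :> nat by rewrite iE.
exists i, j; split=> //; [by case: hi|by case: hj|].
have [] // := swap_cases ij c12.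
  move=> p pi pj; have := step p J1; have := step p J2.
  have := ltn_ord p; move: pi pj; rewrite -!val_eqE /= => pi pj pn.
  rewrite !U /=; [|lia|lia|lia|lia].
  by case: (p \in J1); case: (p \in J2); lia.
by move=> e; move: hi; rewrite e => -[->].
Qed.

Lemma card_ltn_ord m : (m <= n)%N -> #|[set q : 'I_n | (q < m)%N]%SET| = m.
Proof.
move=> h; have wi : injective (widen_ord h) by move=> x y /(congr1 val) /= /val_inj.
rewrite -[RHS](card_ord m) -(card_imset predT wi).
apply: eq_card => q; rewrite inE; apply/idP/imsetP => [qp|[r _ ->]].
  by exists (Ordinal qp) => //; exact: val_inj.
by rewrite /= ltn_ord.
Qed.

Lemma below_mono J m m' : (m <= m')%N -> (below J m <= below J m')%N.
Proof.
move=> mm; apply/subset_leq_card/fintype.subsetP => q; rewrite !inE => /andP[-> qm].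
exact: leq_trans qm mm.
Qed.

Lemma below_inj J (p q : 'I_n) : p \in J -> q \in J -> below J p = below J q -> p = q.
Proof.
wlog : p q / (p < q)%N => [h pJ qJ e|pq pJ _ e].
  have [pq|pq|/val_inj //] := ltngtP p q; first exact: h.
  by apply/esym; exact: h.
by have := below_mono J pq; rewrite belowS pJ e addn1 ltnn.
Qed.

Lemma below_compl J (p : 'I_n) : #|[set q : 'I_n | (q \notin J) && (q < p)%N]%SET| = (p - below J p)%N.
Proof.
transitivity (#|[set q : 'I_n | (q < p)%N]%SET| - below J p)%N; last by rewrite card_ltn_ord // ltnW.
rewrite -(cardsID J [set q : 'I_n | (q < p)%N]).
have -> : #|([set q : 'I_n | (q < p)%N] :&: J)%SET| = below J p.
  by apply: eq_card => q; rewrite !inE andbC.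
by rewrite addKn; apply: eq_card => q; rewrite !inE.
Qed.

(** The sign -1 occurs once for each non-pivot below i and once for each pivot above j. These
    numbers are the column and the row, from 0, of the box added by the swap. *)
Lemma cellsgn_pair J (i j : 'I_n) : j = i.+1 :> nat -> i \in J -> j \notin J ->
  cellsgn J (fun p => (p == i) || (p == j)) = (-1) ^+ ((#|J| - (below J i).+1) + (i - below J i)).
Proof.
move=> ij iJ jJ; have nij := swap_neq ij.
rewrite /cellsgn big_split /= addnC exprD; congr (_ * _).
  rewrite (bigID (fun x => x.1 == i)) /= [X in _ * X]big1 ?mulr1 => [|x /andP[/and3P[xJ _ _] xi]]; last first.
    rewrite /sg (negbTE xi) /= (_ : (x.1 == j) = false) //.
    by apply: contraNF jJ => /eqP <-.
  rewrite (eq_bigr (fun=> -1)) => [|x /andP[_ /eqP ->]]; last by rewrite /sg eqxx.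
  rewrite prodr_const -below_compl; congr (_ ^+ _).
  rewrite -(card_imset _ (_ : injective (fun q : 'I_n => (i, q)))); last by move=> ? ? [].
  apply: eq_card => -[x y]; rewrite -[LHS]/(invset J (x, y) && (x == i)); apply/andP/imsetP => [[/and3P[_ yJ yx] /eqP xi]|[q]].
    by exists y; [rewrite inE yJ -xi|rewrite -xi].
  by rewrite inE => /andP[qJ qi] [-> ->]; rewrite /invset /= iJ qJ qi.
rewrite (bigID (fun x => x.2 == j)) /= [X in _ * X]big1 ?mulr1 => [|x /andP[/and3P[_ xJ _] xj]]; last first.
  rewrite /sg (negbTE xj) orbF (_ : (x.2 == i) = false) //.
  by apply: contraNF xJ => /eqP ->.
rewrite (eq_bigr (fun=> -1)) => [|x /andP[_ /eqP ->]]; last by rewrite /sg eqxx orbT.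
rewrite prodr_const; congr (_ ^+ _).
have -> : (#|J| - (below J i).+1 = #|[set p in J | (j < p)%N]%SET|)%N.
  have bj : below J j = (below J i).+1 by rewrite ij belowS iJ addn1.
  rewrite -bj -(cardsID [set p : 'I_n | (p < j)%N] J).
  have -> : #|(J :&: [set p : 'I_n | (p < j)%N])%SET| = below J j.
    by apply: eq_card => q; rewrite !inE.
  rewrite addKn; apply: eq_card => q; rewrite !inE -leqNgt leq_eqVlt andbC.
  case qJ : (q \in J) => //=; rewrite (_ : (j == q :> nat) = false) //.
  by apply: contraNF jJ => /eqP /val_inj ->.
rewrite -(card_imset _ (_ : injective (fun q : 'I_n => (q, j)))); last by move=> ? ? [].
apply: eq_card => -[x y]; rewrite -[LHS]/(invset J (x, y) && (y == j)); apply/andP/imsetP => [[/and3P[xJ _ yx] /eqP yj]|[q]].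
  by exists x; [rewrite inE xJ -yj|rewrite -yj].
by rewrite inE => /andP[qJ qi] [-> ->]; rewrite /invset /= qJ jJ qi.
Qed.

End Covers.

(** * Coset representatives as pivot sets *)

Section Minreps.
Variables n k : nat.
Implicit Types w : minrep n k.

Definition Jset w : {set 'I_n} := [set val w j | j : 'I_n & (j < k)%N]%SET.

Lemma minrep_lt w (p q : 'I_n) : (p < q)%N -> (q < k)%N || (k <= p)%N -> (val w p < val w q)%N.
Proof.
move=> pq h; have /forallP/(_ p)/forallP/(_ q)/implyP := valP w.
by apply; rewrite pq h.
Qed.

Lemma minrep_ltE w (p q : 'I_n) : (p < k)%N = (q < k)%N ->
  (val w p < val w q)%N = (p < q)%N.
Proof.
move=> h; have lt (a b : 'I_n) : (a < k)%N = (b < k)%N -> (a < b)%N -> (val w a < val w b)%N.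
  move=> ab l; apply: minrep_lt l _; rewrite -ab; case: ltnP => //.
have [pq|pq|/val_inj ->] := ltngtP p q; last by rewrite ltnn.
- by rewrite lt.
- by apply/negbTE; rewrite -leqNgt ltnW // lt.
Qed.

Lemma mem_Jset w p : (val w p \in Jset w) = (p < k)%N.
Proof. by rewrite mem_imset ?inE //; exact: perm_inj. Qed.

Lemma below_block w (b : bool) (P : {set 'I_n}) p :
  (forall q, (val w q \in P) = ((q < k)%N == b)) -> val w p \in P ->
  below P (val w p) = #|[set q : 'I_n | ((q < k)%N == b) && (q < p)%N]%SET|.
Proof.
move=> h pP; rewrite /below -(card_preimset _ (@perm_inj _ (val w))).
apply: eq_card => q; rewrite !inE h; have [qb|//] := eqVneq.
by rewrite minrep_ltE // qb; move: pP; rewrite h => /eqP ->.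
Qed.

(** A representative is increasing on each of its two blocks, so the rank of [w p] inside [Jset w]
    or its complement is determined by p. *)
Lemma Jset_inj w w' : Jset w = Jset w' -> w = w'.
Proof.
move=> e; apply: val_inj; apply/permP => p.
have h0 (v : minrep n k) q : (val v q \in Jset v) = ((q < k)%N == true) by rewrite mem_Jset eqb_id.
have h1 (v : minrep n k) q : (val v q \in ~: Jset v)%SET = ((q < k)%N == false).
  by rewrite inE mem_Jset; case: (_ < _)%N.
have [pk|pk] := boolP (p < k)%N.
  apply: (@below_inj _ (Jset w)); rewrite ?mem_Jset // ?e ?mem_Jset // -{1}e.
  by rewrite (below_block (h0 w)) ?(below_block (h0 w')) ?mem_Jset.
have m (v : minrep n k) : val v p \in (~: Jset v)%SET by rewrite inE mem_Jset.
apply: (@below_inj _ (~: Jset w)%SET); rewrite ?m // ?e ?m // -{1}e.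
by rewrite (below_block (h1 w)) ?(below_block (h1 w')) ?m.
Qed.

Lemma below_Jset w (p : 'I_n) : (p < k)%N -> below (Jset w) (val w p) = p.
Proof.
move=> pk; have h (q : 'I_n) : (val w q \in Jset w) = ((q < k)%N == true) by rewrite mem_Jset eqb_id.
rewrite (below_block h) ?mem_Jset //.
rewrite -[RHS](@card_ltn_ord n p) ?(ltnW (ltn_ord p)) //; apply: eq_card => q; rewrite !inE eqb_id.
by apply: andb_idl => /ltn_trans; apply.
Qed.

Hypothesis kn : (k <= n)%N.

Lemma card_Jset w : #|Jset w| = k.
Proof. by rewrite card_imset; [exact: card_ltn_ord|exact: perm_inj]. Qed.

Lemma minrep_exists (J : {set 'I_n}) : #|J| = k -> exists w, Jset w = J.
Proof.
move=> cJ; pose s := enum J ++ enum (~: J)%SET.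
have sJ : size (enum J) = k by rewrite -cardE.
have ss : size s = n by rewrite size_cat -!cardE cardsC card_ord.
have us : uniq s.
  rewrite cat_uniq !enum_uniq /= andbT; apply/hasPn => x; rewrite !mem_enum inE.
  by apply.
pose f (p : 'I_n) := nth p s p.
have fE x (p : 'I_n) : f p = nth x s p by apply: set_nth_default; rewrite ss.
have finj : injective f.
  move=> p q; rewrite (fE p q) => /eqP; rewrite nth_uniq ?ss // => /eqP e; exact: val_inj.
have srt (P : {set 'I_n}) : sorted (fun p q : 'I_n => (p < q)%N) (enum P).
  rewrite /enum_mem sorted_filter //; first by move=> ? ? ?; exact: ltn_trans.
  by have := iota_ltn_sorted 0 n; rewrite -val_enum_ord sorted_map enumT.
have slt (P : {set 'I_n}) x (p q : nat) : (p < q)%N -> (q < size (enum P))%N ->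
    (nth x (enum P) p < nth x (enum P) q)%N.
  move=> pq qs; apply: (sorted_ltn_nth _ x (srt P)) => //; rewrite ?inE //.
    by move=> ? ? ?; exact: ltn_trans.
  exact: ltn_trans pq qs.
have wP : is_minrep k (perm finj).
  apply/forallP => p; apply/forallP => q; apply/implyP => /andP[pq h]; rewrite !permE (fE p q) /f.
  rewrite !nth_cat sJ; have [qk|qk] := ltnP q k.
    by rewrite (ltn_trans pq qk) slt // sJ.
  have kp : (k <= p)%N by move: h; rewrite ltnNge qk.
  rewrite (ltnNge p) kp /= slt //; first lia.
  by move: ss (ltn_ord q); rewrite size_cat sJ; lia.
pose w : minrep n k := exist (fun x : 'S_n => is_true (is_minrep k x)) _ wP; exists w; apply/eqP; rewrite eqEcard (card_Jset w) cJ leqnn andbT.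
apply/fintype.subsetP => x /imsetP[p]; rewrite inE => pk ->.
by rewrite permE /f nth_cat sJ pk -mem_enum mem_nth // sJ.
Qed.

(** For p < k the values below [w p] come from the p earlier positions and from the inversions at p;
    positions from k on start no inversion. *)
Lemma ell_wt w : (ell w + wt (base_set k n) = wt (Jset w))%N.
Proof.
pose N (p : 'I_n) := #|[set q : 'I_n | (p < q)%N && (val w q < val w p)%N]%SET|.
have -> : ell w = (\sum_p N p)%N.
  rewrite /ell -sum1_card.
  transitivity (\sum_(p : 'I_n) \sum_(q : 'I_n | (p < q)%N && (val w q < val w p)%N) 1)%N.
    by rewrite pair_big_dep; apply: eq_bigl => -[p q]; rewrite !inE.
  by apply: eq_bigr => p _; rewrite sum1_card; apply: eq_card => q; rewrite !inE.
have N0 (p : 'I_n) : (k <= p)%N -> N p = 0%N.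
  move=> kp; apply/eqP; rewrite cards_eq0; apply/eqP/setP => q; rewrite !inE.
  by apply/negbTE/negP => /andP[pq]; rewrite ltnNge ltnW // minrep_lt // kp orbT.
have N1 (p : 'I_n) : (p < k)%N -> (N p + p = val w p)%N.
  move=> pk; rewrite -[RHS](@card_ltn_ord n) ?(ltnW (ltn_ord _)) //.
  rewrite -(card_preimset _ (@perm_inj _ (val w))) -(cardsID [set q : 'I_n | (q < p)%N]) addnC.
  congr (_ + _)%N.
    rewrite -[LHS](@card_ltn_ord n) ?(ltnW (ltn_ord p)) //; apply: eq_card => q; rewrite !inE.
    by rewrite andb_idl // => qp; rewrite minrep_lt // pk.
  apply: eq_card => q; rewrite !inE -leqNgt [in RHS]leq_eqVlt.
  by case: eqP => [/val_inj ->|]; rewrite ?ltnn ?andbF.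
rewrite (bigID (fun p : 'I_n => (p < k)%N)) /= [X in (_ + X + _)%N]big1 ?addn0; last first.
  by move=> p; rewrite -leqNgt; exact: N0.
have -> : wt (base_set k n) = (\sum_(p : 'I_n | (p < k)%N) p)%N.
  by rewrite /wt; apply: eq_bigl => p; rewrite inE.
rewrite -big_split /= /wt big_imset /=; last by move=> ? ? _ _; exact: perm_inj.
by apply: eq_big => [p|p pk]; rewrite ?inE // N1.
Qed.

Lemma Jset_swap w w' (i j : 'I_n) : val w' = (val w * tperm i j)%g -> Jset w' = swp i j (Jset w).
Proof.
move=> e; apply/setP => x; rewrite mem_swp.
have -> : x = val w' ((val w')^-1 (x))%g by rewrite permKV.
by rewrite mem_Jset e permM tpermK mem_Jset.
Qed.

(** Exchanging adjacent values alters only their mutual order, and they belong to different blocks,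
    so the product is again a minimal representative. *)
Lemma swap_minrep w w' (i j : 'I_n) : j = i.+1 :> nat -> i \in Jset w -> j \notin Jset w ->
  Jset w' = swp i j (Jset w) -> val w' = (val w * tperm i j)%g.
Proof.
move=> ij iJ jJ e.
have lt (x y : 'I_n) : (x < y)%N -> (x, y) != (i, j) -> (tperm i j x < tperm i j y)%N.
  move=> xy; rewrite xpair_eqE negb_and -!val_eqE /= => h.
  by case: tpermP => [xE|xE|/eqP + /eqP]; case: tpermP => [yE|yE|/eqP + /eqP]; rewrite -?val_eqE /= => *;
     move: xy h; rewrite ?xE ?yE ?ij; lia.
have wP : is_minrep k (val w * tperm i j)%g.
  apply/forallP => p; apply/forallP => q; apply/implyP => /andP[pq h]; rewrite !permM.
  apply: lt; first exact: minrep_lt.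
  apply: contraL iJ => /eqP[pi qj]; move: jJ h; rewrite -pi -qj !mem_Jset => /negbTE -> /= kp.
  by rewrite -leqNgt.
have -> : w' = (exist (fun x : 'S_n => is_true (is_minrep k x)) _ wP : minrep n k) by apply: Jset_inj; rewrite e; apply/esym/Jset_swap.
by [].
Qed.

Lemma Gstar_edgeE w w' : Gstar_edge w w' <->
  ell w' = (ell w).+1 /\ exists i j : 'I_n, [/\ j = i.+1 :> nat, i \in Jset w, j \notin Jset w,
    Jset w' = swp i j (Jset w) & eta_star w = eta_star w'].
Proof.
split=> [[[i [j [ij e]]] l et]|[l [i [j [ij iJ jJ e et]]]]]; last first.
  by split=> //; exists i, j; split=> //; exact: swap_minrep.
split=> //; have Je := Jset_swap e; exists i, j.
have := ell_wt w; have := ell_wt w'; rewrite Je => h h'.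
have := wt_swp ij (Jset w); rewrite -h -h' l ij => c.
split=> //; move: c; case: (i \in _); case: (_ \in _); rewrite ?mul1n ?mul0n //; lia.
Qed.

(** If i is the value of w at a, then a = [below (Jset w) i], and the diagram gains the one box in
    row k - a - 1 and column i - a, both from 0. *)
Lemma eta_star_swp w w' (i j : 'I_n) : j = i.+1 :> nat -> i \in Jset w -> j \notin Jset w ->
  Jset w' = swp i j (Jset w) ->
  eta_star w' = (eta_star w + odd ((k - (below (Jset w) i).+1) + (i - below (Jset w) i)))%N.
Proof.
move=> ij iJ jJ e; have we := swap_minrep ij iJ jJ e.
pose a := ((val w)^-1 i)%g; have wa : val w a = i by rewrite permKV.
have ak : (a < k)%N by rewrite -(mem_Jset w) wa.
have ba : below (Jset w) i = a by rewrite -wa below_Jset.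
have ai : (a <= i)%N by rewrite -ba -{2}(@card_ltn_ord n i) ?(ltnW (ltn_ord i)) // subset_leq_card //;
  apply/fintype.subsetP => q; rewrite !inE => /andP[].
have c0 : (i - a < n - k)%N.
  rewrite -ba -below_compl.
  have <- : #|(~: Jset w)%SET| = (n - k)%N by rewrite cardsCs finset.setCK card_ord card_Jset.
  apply: proper_card; apply/properP; split; first by apply/fintype.subsetP => q; rewrite !inE => /andP[].
  by exists j; rewrite !inE ?jJ // ij; lia.
have r0 : (k - a.+1 < k)%N by lia.
pose z : 'I_k * 'I_(n - k) := (Ordinal r0, Ordinal c0).
have wE (l : 'I_n) : (l < k)%N -> val w' l = if l == a then j else val w l.
  move=> lk; rewrite we permM; case: eqP => [->|la]; first by rewrite wa tpermL.
  rewrite tpermD //; apply/eqP => h; first by apply: la; rewrite /a h permK.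
  by move: jJ; rewrite h mem_Jset lk.
have memY v (p : 'I_k * 'I_(n - k)) (l : 'I_n) : (p.1 + l = k.-1)%N -> (p \in young v) = (p.2 < val v l - l)%N.
  move=> pl; rewrite inE; apply/existsP/idP => [[l' /andP[/eqP h]]|h]; last by exists l; rewrite pl eqxx.
  by have -> : l' = l by apply: ord_inj; lia.
have rowl (p : 'I_k * 'I_(n - k)) : exists2 l : 'I_n, (p.1 + l = k.-1)%N & (l < k)%N.
  have h : (k.-1 - p.1 < n)%N by have := ltn_ord p.1; lia.
  by exists (Ordinal h) => /=; have := ltn_ord p.1; lia.
have zY : z \notin young w by rewrite (memY _ _ a) /= ?wa ?ltnn //; lia.
have Y : young w' = (z |: young w)%SET.
  apply/setP => p; rewrite in_setU1; have [l pl lk] := rowl p.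
  rewrite !(memY _ _ l pl) wE //; have [la|la] := eqVneq l a.
    rewrite la wa ij subSn // ltnS leq_eqVlt; congr (_ || _).
    rewrite /z -pair_eqE /= -!val_eqE /= andb_idl // => _; apply/eqP; move: pl; rewrite la; lia.
  rewrite (_ : p == z = false) //; apply: contra_neqF la => /eqP pz; apply: ord_inj.
  by move: pl; rewrite pz /=; lia.
rewrite /eta_star Y ba; move: (young w) zY => S zY; have -> : (k - a.+1 + (i - a) = z.1 + z.2)%N by [].
have [zo|zo] := boolP (odd (z.1 + z.2)).
  rewrite (cardsD1 z) !inE eqxx zo /= addnC; congr (_ + _)%N; apply: eq_card => p.
  by rewrite !inE; have [->|//] := eqVneq p z; rewrite (negbTE zY).
rewrite addn0; apply: eq_card => p; rewrite !inE.
by have [->|//] := eqVneq p z; rewrite (negbTE zo) (negbTE zY) andbF.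
Qed.

End Minreps.

(** * Incidence numbers *)

Section SquaredCosine.
Variables (R : realType) (k n : nat).
Local Notation Gr := (Gr R k n).
Implicit Types (A : 'M[R]_(k, n)) (E : 'M[R]_(n, k)) (V : Gr).

Definition cosq_mx E A : R := \det (A *m E) ^+ 2 / \det (A *m A^T).

(* For E a coordinate frame this is the square of the cosine of the angle between
   V and the coordinate plane. *)
Definition cosq E V : R := cosq_mx E (frame V).

Lemma gram_det A : row_free A -> \det (A *m A^T) != 0.
Proof.
move=> fA; rewrite -unitfE -unitmxE -row_free_unit -kermx_eq0.
apply/eqP/row_matrixP => a; rewrite row0.
set v := row a _; have vA : v *m (A *m A^T) = 0 by rewrite -row_mul mulmx_ker row0.
have {}vA : (v *m A) *m (v *m A)^T = 0 by rewrite trmx_mul mulmxA -(mulmxA v) vA mul0mx.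
apply: (row_free_inj fA); rewrite mul0mx; apply/rowP => b; rewrite [RHS]mxE.
have := congr1 (fun M : 'M[R]_1 => M 0 0) vA; rewrite [RHS]mxE [LHS]mxE => /eqP.
rewrite psumr_eq0 => [/allP/(_ b)|c _]; last by rewrite [_^T _ _]mxE -expr2 sqr_ge0.
by rewrite mem_index_enum [_^T _ _]mxE -expr2 sqrf_eq0 => /(_ isT)/eqP.
Qed.

Lemma cosq_gsp E V A : row_free A -> cosq E (gsp V A) = cosq_mx E A.
Proof.
move=> fA; have [P uP e] := frame_gsp V fA; rewrite /cosq /cosq_mx e.
rewrite trmx_mul !mulmxA -[P *m A *m E]mulmxA -[P *m A *m A^T]mulmxA.
rewrite [\det (P *m (A *m E))]det_mulmx [\det (_ *m P^T)]det_mulmx [\det (P *m _)]det_mulmx det_tr.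
have uP' : \det P != 0 by rewrite -unitfE -unitmxE.
have g := gram_det fA.
by field; rewrite g uP'.
Qed.

Lemma cosq_continuous E : continuous (cosq E).
Proof.
have H (A : @frames R k n) : setT (span_frame A) -> nbhs A (@span_frame R k n @^-1` setT) /\
    {for A, continuous (cosq E \o @span_frame R k n)}.
  move=> _; split; first by rewrite preimage_setT; exact: filterT.
  rewrite (_ : _ \o _ = fun B : @frames R k n => cosq_mx E (val B)); last first.
    by apply/funext => B; rewrite /comp (span_frame_gsp (span_frame A)) cosq_gsp // frames_row_free.
  have vc : {for A, continuous (fun B : @frames R k n => val B)} by exact: continuous_set_val.
  have dc : {for A, continuous (fun B : @frames R k n => \det (val B *m E))}.
    by exact: continuous_det (continuous_mulmx vc (@cont_cst _ _ E A)).
  apply: cont_mul; first exact: (cont_mul dc dc).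
  apply: cont_inv; first exact/gram_det/frames_row_free.
  have tc : {for A, continuous (fun B : @frames R k n => (val B)^T)}.
    apply: continuous_at_mx => i j.
    rewrite (_ : (fun z => _) = fun B : @frames R k n => val B j i); first exact: continuous_entry.
    by apply/funext => B; rewrite mxE.
  exact: continuous_det (continuous_mulmx vc tc).
by move=> V; have [] := Gr_continuous H (I : setT V).
Qed.

End SquaredCosine.

(** Such a cube is a relative cycle: the coboundary of a relative cochain is there a sum over faces
    in [A]. *)
Lemma cohomologous_rel_cycle (R : realType) (T : topologicalType) (L : local_system R T)
    (X A : set T) d (c c' : cochain R T d) (u : cube R d -> T) :
  cohomologous L X A c c' -> singular X u ->
  faces_in A u -> c u = c' u.
Proof.
case: d c c' u => [|d] c c' u; first by move=> h us _; exact: h.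
move=> [b brel bE] us uA; apply/eqP; rewrite -subr_eq0 bE // coboundaryE; last by case: us.
rewrite big1 // => i _; rewrite big1 // => b' _; rewrite pull_zero ?mulr0 //.
apply: brel; last by left; exact: uA.
by apply: continuous_compose; [exact: face_continuous|case: us].
Qed.

Lemma tr_along (R : realType) (T : topologicalType) (L : local_system R T) d
    (u : cube R d -> T) (p : unit_itv R -> cube R d) : continuous u -> continuous p ->
  tr L u (p (I1 R)) = L (u \o p) * tr L u (p (I0 R)).
Proof.
move=> uc pc; apply: (transport_triangle L (@cube_convex R d) uc) => //.
- exact: segc_continuous.
- exact: segc_continuous.
- by rewrite !segc0.
- by rewrite segc1.
- by rewrite segc1.
Qed.

(** * The values of a generator on the cubes of its cell *)

Section CellGenerators.
Variables (R : realType) (k n : nat) (V0 : Gr R k n) (L : local_system R (Gr R k n)).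
Hypothesis kn : (k <= n)%N.
Local Notation Gr := (Gr R k n).
Local Notation I := (unit_itv R).
Local Notation skeleton := (@skeleton R n k).
Implicit Types (V : Gr) (w : minrep n k).

Lemma schubert_cellE w V : schubert_cell w V <-> piv V = Jset w.
Proof. by []. Qed.

Lemma skeletonE d V : skeleton d V <-> (wt (piv V) <= wt (base_set k n) + d)%N.
Proof.
split=> [[w /= wd /schubert_cellE ->]|h]; first by rewrite -ell_wt addnC leq_add2l.
have [w wV] := minrep_exists kn (card_piv V); exists w; last exact/schubert_cellE.
by move: h; rewrite -wV -ell_wt addnC leq_add2l.
Qed.

Definition cell_map J d (c : cellcube V0 J d) (t : cube R d) : Gr := gsp V0 (cc_mx c t).

Lemma cell_map_continuous J d (c : cellcube V0 J d) : continuous (cell_map c).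
Proof. by apply: cont_all => t; apply: gsp_continuous; [exact: cc_free|exact: cc_cont]. Qed.

Lemma face_bdry d (i : 'I_d.+1) b (t : cube R d) :
  exists l, val (face i (bI R b) t) 0 l = 0 \/ val (face i (bI R b) t) 0 l = 1.
Proof. by exists i; rewrite face_same bIE; case: b; [right|left]. Qed.

Lemma cell_interior J d (c : cellcube V0 J d) (t : cube R d) : cell J (cell_map c t) -> interior t.
Proof.
move=> ct l; have /andP[t0 t1] := cubeP t l; rewrite !lt_neqAle t0 t1 !andbT.
apply/andP; split; apply: contraPN ct => /eqP e h.
  by have := @cc_boundary _ _ _ _ _ _ c t (ex_intro _ l (or_introl (esym e))); rewrite [piv _]h ltnn.
by have := @cc_boundary _ _ _ _ _ _ c t (ex_intro _ l (or_intror e)); rewrite [piv _]h ltnn.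
Qed.

Lemma cell_map_center (J : {set 'I_n}) (hJ : #|J| = k) d (c : cellcube V0 J d) :
  cell_map c (center R d) = gsp V0 (selmx R hJ)^T.
Proof. exact: is_coord_unique (cc_center c) (is_coord_gsp V0 hJ). Qed.

Lemma pm1_mul (x y : int) : x = 1 \/ x = -1 -> y = 1 \/ y = -1 -> x * y = 1 \/ x * y = -1.
Proof. by move=> [] -> [] ->; [left|right|right|left]. Qed.

Lemma pm1_signs d (f : 'I_d -> bool) :
  \prod_(j < d) (if f j then -1 else 1 : int) = 1 \/
  \prod_(j < d) (if f j then -1 else 1 : int) = -1.
Proof.
elim/big_ind: _ => [|x y|j _]; [by left|exact: pm1_mul|].
by case: (f j); [right|left].
Qed.

(* Both sides of the final equation are, up to sign, values of the explicit cocycle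
   of [cell_cocycle]; that this cocycle is a multiple of sigma forces m to be a unit. *)
Lemma generator_value w d (c : cellcube V0 (Jset w) d) (sigma : cochain R Gr d) :
  ell w = d -> generates L (skeleton d) (skeleton d `\` schubert_cell w) sigma ->
  exists2 m : int, m = 1 \/ m = -1 &
  forall (u : cube R d -> Gr) (e : nat -> bool), singular (skeleton d) u ->
    faces_in (skeleton d `\` schubert_cell w) u ->
    u (center R d) = cell_map c (center R d) ->
    (forall t (j : 'I_d), cell (Jset w) (u t) ->
       (0 < cc_coord c j (u t)) = if e j then val t 0 j < 2^-1 else 2^-1 < val t 0 j) ->
    sigma u = m * tr L u (center R d) * \prod_(j < d) (if e j then -1 else 1).
Proof.
move=> wd [_ gen]; set J := Jset w; have hJ : #|J| = k by exact: card_Jset.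
have wtJ : wt J = (wt (base_set k n) + d)%N by rewrite -ell_wt wd addnC.
pose E := selmx R hJ.
have solE : chart_sol E E^T by exact: selmx_tr.
pose M0 : chart_sol E := mkS solE; pose g := chart_triv L M0.
pose VJ := cell_map c (center R d).
have VJE : VJ = gsp V0 E^T by exact: cell_map_center.
have rhoJ : cosq E VJ = 1.
  have fE : row_free E^T := chart_sol_free solE.
  by rewrite VJE cosq_gsp // /cosq_mx trmxK selmx_tr det1 expr1n divr1.
have g_triv (p : I -> Gr) : continuous p -> range p `<=` cell J -> L p * g (p (I0 R)) = g (p (I1 R)).
  move=> pc pJ; apply: chart_triv_path => // V Vp.
  by apply: cell_chart_dom; exact: pJ.
have CA V : (skeleton d `\` schubert_cell w) V -> ~ cell J V by case.
have rho_C V : skeleton d V -> 0 < cosq E V -> cell J V.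
  move=> /skeletonE VX rV; apply: (@chart_dom_cell _ _ _ _ hJ); first by rewrite wtJ.
  apply: contraTN rV => /eqP e; rewrite /cosq /cosq_mx e.
  by rewrite expr0n /= mul0r ltxx.
have x_cont j V : (j < d)%N -> cell J V -> {for V, continuous (cc_coord c j)}.
  by move=> jd VC; exact: cc_coord_cont.
(* A point where all coordinates vanish is the center, at which [cosq] is 1 and not 1/2. *)
have x_bdry V : cell J V -> cosq E V = 2^-1 -> exists2 j, (j < d)%N & cc_coord c j V != 0.
  move=> VC rV; apply: contrapT => h; have [t ti tV] := cc_onto c VC.
  have tc : t = center R d.
    apply: cube_ext => l; rewrite centerE; apply: (cc_sign c l ti).2; rewrite tV.
    by apply/eqP; apply: contrapT => /negP nz; apply: h; exists l.
  move: rV; rewrite -tV tc -[gsp _ _]/(VJ) rhoJ => /eqP.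
  by rewrite eq_sym invr_eq1 pnatr_eq1.
have [c0 [c0c c0v]] := cell_cocycle g_triv CA (@cosq_continuous _ _ _ E) rho_C x_cont x_bdry.
have VJc : cell J VJ by rewrite VJE; exact: (is_coord_piv hJ (is_coord_gsp V0 hJ)).
pose s := shuffle_sgn d * g VJ.
have sq : s = 1 \/ s = -1.
  apply: pm1_mul; last exact: chart_triv_pm.
  rewrite /shuffle_sgn; elim/big_ind: _ => [|x y|j _]; [by left|exact: pm1_mul|].
  by rewrite -signr_odd; case: (odd j); [right|left].
have c0E (u : cube R d -> Gr) (e : nat -> bool) : singular (skeleton d) u ->
    faces_in (skeleton d `\` schubert_cell w) u ->
    u (center R d) = VJ ->
    (forall t (j : 'I_d), cell J (u t) ->
       (0 < cc_coord c j (u t)) = if e j then val t 0 j < 2^-1 else 2^-1 < val t 0 j) ->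
    c0 u = s * tr L u (center R d) * \prod_(j < d) (if e j then -1 else 1).
  move=> us uA uc ue; rewrite (c0v u e us uA) ?uc //; first by rewrite /s; ring.
  by rewrite rhoJ invf_lt1 // ltr1n.
have [m hm] := gen c0 c0c.
have cohE (u : cube R d -> Gr) : singular (skeleton d) u ->
    faces_in (skeleton d `\` schubert_cell w) u -> c0 u = m * sigma u.
  exact: (cohomologous_rel_cycle hm).
have us0 : singular (skeleton d) (cell_map c).
  split; first exact: cell_map_continuous.
  move=> _ [t _ <-]; apply/skeletonE; rewrite -wtJ; apply: lepiv_wt; last exact: cc_below.
  by rewrite card_piv hJ.
have uA0 : faces_in (skeleton d `\` schubert_cell w) (cell_map c).
  have : forall t : cube R d, (exists l, val t 0 l = 0 \/ val t 0 l = 1) -> (skeleton d `\` schubert_cell w) (cell_map c t).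
    move=> t /(cc_boundary c) h; split; first by apply/skeletonE; rewrite -wtJ ltnW.
    by move=> /schubert_cellE e; move: h; rewrite [piv _]e ltnn.
  case: (d) (cell_map c) => // d' u h i b _ [t _ <-].
  by apply: h; exact: face_bdry.
have v0 : c0 (cell_map c) = 1 \/ c0 (cell_map c) = -1.
  rewrite (c0E _ (fun=> true) us0 uA0) //.
    apply: pm1_mul; last exact: (pm1_signs (fun=> true)).
    by apply: pm1_mul => //; apply: tr_pm; exact: cell_map_continuous.
  by move=> t j /cell_interior ti; exact: (cc_sign c j ti).1.
have m1 : m = 1 \/ m = -1.
  have : m \is a GRing.unit.
    apply/unitrPr; exists (sigma (cell_map c) * c0 (cell_map c)).
    rewrite mulrA -(cohE _ us0 uA0); by case: v0 => ->.
  by case: (m) => [[|[|?]]|[|?]] //= _; [left|right].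
exists (m * s); first exact: pm1_mul.
move=> u e us uA uc ue; have := cohE u us uA; rewrite (c0E u e us uA uc ue) => h.
have mm : m * m = 1 by case: m1 => ->.
have -> : sigma u = m * (m * sigma u) by rewrite mulrA mm mul1r.
by rewrite -h !mulrA.
Qed.

End CellGenerators.

(** * Evaluation of the cellular coboundary *)

Section Incidence.
Variables (R : realType) (k' n : nat).
Local Notation k := k'.+1.
Local Notation Gr := (Gr R k n).
Local Notation I := (unit_itv R).
Local Notation skeleton := (@skeleton R n k).
Variables (V0 : Gr) (L : local_system R Gr).
Hypotheses (kn : (k <= n)%N) (hL : ~ constant_system L).
Variables (sigma : forall d, minrep n k -> cochain R Gr d) (inc : minrep n k -> minrep n k -> int).
Hypotheses (hsigma : dual_basis L sigma) (hinc : incidence_numbers L sigma inc).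
Implicit Types w : minrep n k.

Lemma skeleton_cell_map J d (c : cellcube V0 J d) e t : #|J| = k ->
  (wt J <= wt (base_set k n) + e)%N -> skeleton e (cell_map c t).
Proof.
move=> hJ wJ; apply/(skeletonE kn); apply: leq_trans wJ; apply: lepiv_wt; last exact: cc_below.
by rewrite card_piv hJ.
Qed.

Lemma skeleton_face J d (c : cellcube V0 J d.+1) e i b t :
  (wt J <= (wt (base_set k n) + e).+1)%N -> skeleton e (cell_map c (face i (bI R b) t)).
Proof.
move=> wJ; apply/(skeletonE kn); rewrite -ltnS; apply: leq_trans wJ.
by apply: cc_boundary; exact: face_bdry.
Qed.

(** The faces of the cube of w' lie in the lower skeleton, so the cochain relating the two sides of
    [hinc] contributes nothing, and only the term of w' survives in the sum. *)
Lemma incidence_value w w' (c : cellcube V0 (Jset w') (ell w).+1) : ell w' = (ell w).+1 ->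
  exists2 m : int, m = 1 \/ m = -1 &
    coboundary L (@sigma (ell w) w) (cell_map c) = m * inc w w'.
Proof.
move=> hl; have cu := @cell_map_continuous _ _ _ _ _ _ c.
have wJ' : wt (Jset w') = (wt (base_set k n) + (ell w).+1)%N by rewrite -ell_wt hl addnC.
have uX : singular (skeleton (ell w).+1) (cell_map c).
  by split=> // _ [t _ <-]; apply: skeleton_cell_map; rewrite ?card_Jset ?wJ'.
have [b brel /(_ _ uX) bE] := hinc w.
have b0 : coboundary L b (cell_map c) = 0.
  rewrite coboundaryE // big1 // => i _; rewrite big1 // => e _; rewrite pull_zero ?mulr0 //.
  apply: brel; first by apply: continuous_compose => //; exact: face_continuous.
  by left=> _ [t _ <-]; apply: skeleton_face; rewrite wJ' addnS.
move/eqP: bE; rewrite b0 subr_eq0 => /eqP ->.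
have hs := hsigma w'; rewrite hl in hs.
have [m m1 mE] := generator_value kn c hl hs.
(* The cube misses every other cell of this dimension: its points have pivots below [Jset w'] in the
   Bruhat order, and equal weight would force equality. *)
rewrite (bigD1 w') ?hl //= [X in _ + X]big1 ?addr0; last first.
  move=> w2 /andP[/eqP l2 ne]; have := hsigma w2; rewrite l2 => -[[rel _] _].
  rewrite rel ?mulr0 //; left=> _ [t _ <-]; split.
    by apply: skeleton_cell_map; rewrite ?card_Jset ?wJ'.
  move=> /schubert_cellE e; case/eqP: ne; apply: Jset_inj.
  apply: lepiv_eq; rewrite ?card_Jset //; last by rewrite -!ell_wt l2 hl.
  by rewrite -e; exact: cc_below.
exists (m * tr L (cell_map c) (center R _) * \prod_(j < (ell w).+1) (-1)).
  apply: pm1_mul; first by apply: pm1_mul => //; exact: tr_pm.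
  exact: (pm1_signs (fun=> true)).
rewrite (mE _ (fun=> true)) //; first by ring.
- move=> i e _ [t _ <-]; split.
    by apply: skeleton_face; rewrite wJ' leqnSn.
  move=> /schubert_cellE h; have := cc_boundary c (face_bdry i e t).
  by rewrite [piv _]h ltnn.
- by move=> t j /cell_interior ti; exact: (cc_sign c j ti).1.
Qed.

(** A face meeting the cell of w would put [Jset w] below [Jset w'] with weight one less, and
    [lepiv_cover] would yield a swap. So all faces lie where [sigma] vanishes. *)
Lemma incidence_zero w w' : ell w' = (ell w).+1 ->
  ~ (exists i j : 'I_n, [/\ j = i.+1 :> nat, i \in Jset w, j \notin Jset w &
       Jset w' = swp i j (Jset w)]) -> inc w w' = 0.
Proof.
move=> hl nrel; have wJ' : wt (Jset w') = (wt (base_set k n) + (ell w).+1)%N by rewrite -ell_wt hl addnC.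
have [c] := cellcube_exists V0 (card_Jset kn w') wJ'.
have [m m1 mE] := incidence_value c hl.
have [[rel _] _] := hsigma w.
suff z : coboundary L (@sigma (ell w) w) (cell_map c) = 0.
  by move: mE; rewrite z; case: m1 => ->; rewrite ?mul1r ?mulN1r => /esym/eqP; rewrite ?oppr_eq0 => /eqP.
have cu := @cell_map_continuous _ _ _ _ _ _ c.
rewrite coboundaryE // big1 // => i _; rewrite big1 // => e _; rewrite pull_zero ?mulr0 //.
apply: rel; first by apply: continuous_compose => //; exact: face_continuous.
left=> _ [t _ <-]; split; first by apply: skeleton_face; rewrite wJ' addnS.
move=> /schubert_cellE h; apply: nrel; apply: lepiv_cover; rewrite ?card_Jset //.
  by rewrite -h; exact: cc_below.
by rewrite -!ell_wt hl.
Qed.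

Lemma selmx_rot (J : {set 'I_n}) (hJ : #|J| = k) (i j : 'I_n) (a : 'I_k) (t : R) : j = i.+1 :> nat ->
  i = enum_val (cast_ord (esym hJ) a) -> j \notin J ->
  (selmx R hJ)^T *m rot i j t = turn_mx (selmx R hJ)^T a (delta_mx 0 j) t.
Proof.
move=> ij ia jJ; apply/row_matrixP => b; rewrite row_mul rowK.
have rE (b' : 'I_k) p : row b' (selmx R hJ)^T 0 p = (p == enum_val (cast_ord (esym hJ) b'))%:R.
  by rewrite !mxE.
have nJ (b' : 'I_k) : (j == enum_val (cast_ord (esym hJ) b')) = false.
  by apply: contraNF jJ => /eqP ->; exact: enum_valP.
have inj (b' : 'I_k) : (i == enum_val (cast_ord (esym hJ) b')) = (b' == a).
  by rewrite ia (inj_eq enum_val_inj) (inj_eq (@cast_ord_inj _ _ _)) eq_sym.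
apply/rowP => p; rewrite (mul_pl ij) !rE nJ inj mul0r addr0.
have [ba|ba] := eqVneq b a.
  rewrite !mul1r !mul0r addr0 !mxE eqxx /= -ba.
  have [->|pi] := eqVneq p i.
    by rewrite inj ba eqxx mulr1 (negbTE (swap_neq ij)) mulr0 addr0.
  have [->|pj] := eqVneq p j; first by rewrite nJ mulr0 add0r mulr1.
  by rewrite ba -ia (negbTE pi) !mulr0 addr0.
rewrite !mul0r addr0 [RHS]rE; have [->|pi] := eqVneq p i; first by rewrite inj (negbTE ba).
by have [->|pj] := eqVneq p j; rewrite ?nJ.
Qed.

Lemma incidence_related w w' (i j : 'I_n) : ell w' = (ell w).+1 -> j = i.+1 :> nat ->
  i \in Jset w -> j \notin Jset w -> Jset w' = swp i j (Jset w) ->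
  exists2 m : int, m = 1 \/ m = -1 &
  inc w w' = m * (1 + (-1) ^+ ((k - (below (Jset w) i).+1) + (i - below (Jset w) i))).
Proof.
move=> hl ij iJ jJ Jw'; set s := (_ + _)%N; set J := Jset w; pose d := ell w.
have hJ : #|J| = k by exact: card_Jset.
have hJ' : #|swp i j J| = k by rewrite card_swp.
have wJ : wt J = (wt (base_set k n) + d)%N by rewrite -ell_wt addnC.
have wJ' : wt (swp i j J) = (wt (base_set k n) + d.+1)%N by rewrite wt_swp_up // wJ addnS.
have [c] := cellcube_exists V0 hJ wJ.
pose c' := cellcube_step ij iJ jJ hJ' c.
have [m' m1' mE'] : exists2 m : int, m = 1 \/ m = -1 &
    coboundary L (@sigma d w) (cell_map c') = m * inc w w'.
  by move: (c'); rewrite /J -Jw' => c''; exact: incidence_value.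
have [m m1 mE] := generator_value kn c erefl (hsigma w).
have [[rel _] _] := hsigma w.
have uc := @cell_map_continuous _ _ _ _ _ _ c; have uc' := @cell_map_continuous _ _ _ _ _ _ c'.
pose u := cell_map c; pose u' := cell_map c'.
have u'E t : u' t = act (rot i j (val t 0 ord0)) (u (tail t)) by exact: step_act.
(* Before the half turn such a point has pivots of weight below [wt J]. The half turn keeps them or
   swaps i and j; to reach J by a swap they would have to be [swp i j J], which is heavier than
   J. *)
have nz (i' : 'I_d) b : @sigma d w (u' \o face (lift ord0 i') (bI R b)) = 0.
  apply: rel; first by apply: continuous_compose => //; exact: face_continuous.
  left=> _ [t _ <-]; split; first by apply: skeleton_face; rewrite wJ' addnS.
  move=> /schubert_cellE; rewrite /comp u'E; set t' := tail _.
  have bt : exists l, val t' 0 l = 0 \/ val t' 0 l = 1.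
    by exists i'; rewrite tailE face_same bIE; case: (b); [right|left].
  have := cc_boundary c bt; rewrite -/(u t') => lt.
  have [->|->] := piv_rot ij (u t') (cubeP (face (lift ord0 i') (bI R b) t) ord0) => e.
    by move: lt; rewrite e ltnn.
  have e' : piv (u t') = swp i j J by rewrite -[LHS](swpK i j) e.
  by move: lt; rewrite e' wt_swp_up // => /ltnW; rewrite ltnn.
have f0 : u' \o face ord0 (bI R false) = u.
  by apply/funext => t; rewrite /comp u'E face_same tail_face [val _](_ : _ = 0) // (rot0 R ij) act1.
pose eps := fun p => (p == i) || (p == j).
have f1 : u' \o face ord0 (bI R true) = fun t => act (sgmx R eps) (u t).
  by apply/funext => t; rewrite /comp u'E face_same tail_face [val _](_ : _ = 1) // (rot1 R ij).
have [r [rE rs]] := cc_flip c eps.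
have singu : singular (skeleton d) u.
  by split=> // _ [t _ <-]; apply: skeleton_cell_map; rewrite ?wJ.
have bdry (t : cube R d) : (exists l, val t 0 l = 0 \/ val t 0 l = 1) -> (skeleton d `\` schubert_cell w) (u t).
  move=> /(cc_boundary c) h; split; first by apply/(skeletonE kn); rewrite -wJ ltnW.
  by move=> /schubert_cellE e; move: h; rewrite [piv _]e ltnn.
have flipc : flip r (center R d) = center R d.
  by apply: cube_ext => l; rewrite flipE !centerE; case: (r l) => //; lra.
have sgu : @sigma d w u = m * tr L u (center R d) * (-1) ^+ d.
  rewrite (mE u (fun=> true)) //.
  - by rewrite prodr_const card_ord.
  - by case: (d) (u) bdry => // d' v h i' b _ [t _ <-]; apply: h; exact: face_bdry.
  - by move=> t l /cell_interior ti; exact: (cc_sign c l ti).1.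
pose v := u' \o face ord0 (bI R true).
have vE t : v t = u (flip r t) by rewrite /v f1 rE.
have vc : continuous v by apply: continuous_compose => //; exact: face_continuous.
(* On [u] every coordinate changes from positive to negative; the reflections in [r] reverse exactly
   those they touch, and their product is [cellsgn J eps], the sign (-1)^s. *)
have sgv : @sigma d w v = m * tr L v (center R d) * ((-1) ^+ d * (-1) ^+ s).
  rewrite (mE v (fun l => ~~ r l)).
  - have -> : (-1) ^+ s = cellsgn J eps by rewrite (cellsgn_pair ij iJ jJ) hJ.
    have -> : (-1) ^+ d = \prod_(l < d) (-1) :> int by rewrite prodr_const card_ord.
    congr (_ * _); rewrite -rs -big_split /=.
    by apply: eq_bigr => l _; case: (r l).
  - by split=> // _ [t _ <-]; rewrite vE; apply: (singu.2); eexists.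
  - have : forall t : cube R d, (exists l, val t 0 l = 0 \/ val t 0 l = 1) -> (skeleton d `\` schubert_cell w) (v t).
      move=> t [l tl]; rewrite vE; apply: bdry; exists l; rewrite flipE.
      by case: (r l) => //; case: tl => ->; [right|left]; ring.
    by case: (d) (v) => // d' v' h i' b _ [t _ <-]; apply: h; exact: face_bdry.
  - by rewrite vE flipc.
  - move=> t l; rewrite vE => /cell_interior ti; rewrite (cc_sign c l ti).1 flipE.
    by case: (r l) => //=; apply/idP/idP => ?; lra.
pose p (x : I) := face ord0 x (center R d).
have pc : continuous p.
  apply: continuous_cube => l; rewrite (_ : (fun z => _) = fun z : I => if l == ord0 then val z else 2^-1).
    by case: (l == ord0) => z; [exact: continuous_set_val|exact: cont_cst].
  apply/funext => z; rewrite /p; have [l' ->|->] := unliftP ord0 l; last by rewrite face_same eqxx.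
  by rewrite face_lift centerE eq_sym (negbTE (neq_lift _ _)).
(* Along the central line the coordinate plane of J turns e_i into e_j and on to its opposite: this
   is a [turn_mx] loop. *)
have Lp : L (u' \o p) = -1.
  have fs : row_free (selmx R hJ)^T by apply: (@chart_sol_free _ _ _ (selmx R hJ)); exact: selmx_tr.
  have [a ia] := selP hJ iJ.
  rewrite -(@nonconstant_turn R k' n V0 L (selmx R hJ)^T a (delta_mx 0 j) hL fs).
    congr (L _); apply/funext => x; rewrite /comp u'E face_same tail_face -(selmx_rot _ ij ia jJ).
    rewrite [u _](cell_map_center hJ) (act_gsp V0 V0) ?fs //.
    by apply: (rot_unit ij); exact: unit_itvP.
  apply/negP; rewrite -(mem_gsp V0) // => /(is_coord_gsp V0 hJ)/(_ j jJ) /eqP.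
  by rewrite mxE !eqxx oner_eq0.
have tr0 : face ord0 (bI R false) (cube0 R d) = cube0 R d.+1.
  apply: cube_ext => l; have [l' ->|->] := unliftP ord0 l; first by rewrite face_lift !mxE.
  by rewrite face_same bIE mxE.
have tru : tr L u' (p (I0 R)) = tr L u (center R d).
  have := tr_comp L (center R d) uc' (@face_continuous R d ord0 (bI R false)).
  by rewrite tr0 tr_cube0 mulr1 -/u' f0.
have trv : tr L u' (p (I1 R)) = tr L v (center R d) * tr L u' (face ord0 (bI R true) (cube0 R d)).
  exact: (tr_comp L (center R d) uc' (@face_continuous R d ord0 (bI R true))).
have loop : tr L u' (p (I1 R)) = - tr L u' (p (I0 R)).
  by rewrite (tr_along L uc' pc) Lp mulN1r.
(* The face t = 1 enters with the transport back from its base point, which by [loop] has an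
   additional sign -1; this turns the difference of the two faces into the sum 1 + (-1)^s. *)
have cobE : coboundary L (@sigma d w) u' =
    - (m * tr L u (center R d) * (-1) ^+ d) * (1 + (-1) ^+ s).
  rewrite coboundaryE // big_ord_recl [X in _ + X]big1 ?addr0 => [|i' _]; last first.
    by rewrite big1 // => b _; rewrite pull_zero ?mulr0.
  rewrite big_bool /= /pull f0 tr0 tr_cube0 -/v sgv sgu.
  have := trv; rewrite loop tru => trv'.
  have sq : tr L v (center R d) * tr L v (center R d) = 1 by case: (tr_pm L (center R d) vc) => ->.
  have -> : tr L u' (face ord0 (bI R true) (cube0 R d)) = - tr L v (center R d) * tr L u (center R d).
    by rewrite mulNr -mulrN trv' mulrA sq mul1r.
  rewrite /fsgn /= addn0 addn1 expr0 expr1 mul1r mul1r mulN1r.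
  transitivity (- (tr L v (center R d) * tr L v (center R d)) * tr L u (center R d) * m * (-1) ^+ d * (-1) ^+ s
     - m * tr L u (center R d) * (-1) ^+ d); first by ring.
  by rewrite sq; ring.
exists (m' * - (m * tr L u (center R d) * (-1) ^+ d)).
  apply: pm1_mul => //.
  have : m * tr L u (center R d) * (-1) ^+ d = 1 \/ m * tr L u (center R d) * (-1) ^+ d = -1.
    apply: pm1_mul; first by apply: pm1_mul => //; exact: tr_pm.
    by rewrite -signr_odd; case: (odd d); [right|left].
  by case=> ->; [right|left; rewrite opprK].
rewrite -mulrA -cobE mE' mulrA; by case: m1' => ->; rewrite ?mulNr ?mul1r ?mulN1r ?opprK.
Qed.

End Incidence.

Theorem mainTheorem2 (R : realType) (k n : nat) (hk : (1 <= k <= n.-1)%N)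
    (L : local_system R (Gr R k n)) (hL : ~ constant_system L)
    (sigma : forall d : nat, minrep n k -> cochain R (Gr R k n) d)
    (hsigma : dual_basis L sigma)
    (inc : minrep n k -> minrep n k -> int)
    (hinc : incidence_numbers L sigma inc)
    (w w' : minrep n k) (hl : ell w' = (ell w).+1) :
  (Gstar_edge w w' -> inc w w' = 2 \/ inc w w' = - 2) /\
  (~ Gstar_edge w w' -> inc w w' = 0).
Proof.
case: k hk L hL sigma hsigma inc hinc w w' hl => [//|k] hk L hL sigma hsigma inc hinc w w' hl.
have kn : (k.+1 <= n)%N by move: hk => /andP[_]; lia.
have cJ := card_Jset kn w.
have fs : row_free (selmx R cJ)^T.
  by apply: (@row_free_right_inv _ _ _ _ (selmx R cJ)); rewrite selmx_tr unitmx1.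
(* Any point of the Grassmannian would do: it is the default value required by [gsp]. *)
pose V0 : Gr R k.+1 n := exist (fun V : {vspace 'rV[R]_n} => is_true (\dim V == k.+1)) _ (dim_span_rows fs).
have val2 (i j : 'I_n) : j = i.+1 :> nat -> i \in Jset w -> j \notin Jset w ->
    Jset w' = swp i j (Jset w) -> exists2 m : int, m = 1 \/ m = -1 &
    inc w w' = m * (if eta_star w == eta_star w' then 2 else 0).
  move=> ij iJ jJ Jw'; have [m m1 ->] := incidence_related V0 kn hL hsigma hinc hl ij iJ jJ Jw'.
  exists m => //; congr (_ * _); rewrite (eta_star_swp kn ij iJ jJ Jw') -signr_odd.
  case: (odd _); last by rewrite addn0 eqxx.
  by rewrite addn1 (ltn_eqF (ltnSn _)) expr1 subrr.
split=> [/(Gstar_edgeE kn)[_ [i [j [ij iJ jJ Jw' e]]]]|ne].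
  have [m m1 ->] := val2 i j ij iJ jJ Jw'; rewrite e eqxx.
  by case: m1 => ->; [left|right].
have [[i [j [ij iJ jJ Jw']]]|nrel] := pselect (exists i j : 'I_n, [/\ j = i.+1 :> nat, i \in Jset w,
    j \notin Jset w & Jset w' = swp i j (Jset w)]); last first.
  exact: (incidence_zero V0 kn hsigma hinc hl nrel).
have [m _ ->] := val2 i j ij iJ jJ Jw'; case: eqP => [e|_]; last by rewrite mulr0.
by case: ne; apply/(Gstar_edgeE kn); split=> //; exists i, j.
Qed.
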